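(* Let $F=\Phi(F)=\bigcup_{j=1}^{J}\varphi_j(F)$ be a self-similar fractal in $\mathbb{R}^d$ with $\dim [F]=d$, where the similitudes $\varphi_j$ have contractivity ratios $r_j$. Assume that the Tileset Condition (TSC), the Nontriviality Condition (NTC) and the Pearse-Winter Condition (PWC) hold, that $T_0=G$ is a single diphase Steiner-like generator, and that $D>d-1$, where $D$ is the Minkowski dimension of $F$. Then: I. If the IFS $\Phi$ is of non-lattice type, then $F$ is Minkowski measurable with Minkowski content $$\mathcal{M}(F)=\mathrm{res}\left(\zeta_{\mathcal{T}}(s,\varepsilon)\,\varepsilon^{s-d};D\right)=\mathrm{res}(\zeta(s);D)\sum_{m=0}^d\frac{g^{D-m}}{D-m}\kappa_m(G)=\frac{\sum_{m=0}^d\frac{g^{D-m}}{D-m}\kappa_m(G)}{\sum_{j=1}^J r_j^D\log r_j^{-1}}.$$ II. If the IFS $\Phi$ is of lattice type, then $F$ is not Minkowski measurable. The average Minkowski content $$\mathcal{M}_{\mathrm{av}}(F)=\lim_{T\to\infty}\frac{1}{\log T}\int_{1/T}^1\varepsilon^{-(d-D)}V_F(\varepsilon)\,\frac{d\varepsilon}{\varepsilon}$$ exists and equals $\mathrm{res}\left(\zeta_{\mathcal{T}}(s,\varepsilon)\,\varepsilon^{s-d};D\right)$.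
   Context: Setting. $J\ge 2$; $\varphi_1,\dots,\varphi_J:\mathbb{R}^d\to\mathbb{R}^d$ are similitudes with scaling (contractivity) ratios $0<r_j<1$; $\Phi(A)=\bigcup_{j=1}^J\varphi_j(A)$ for $A\subset\mathbb{R}^d$; $F$ is the self-similar fractal (attractor, nonempty compact) with $F=\Phi(F)$. The iterated function system (IFS) $\Phi$ satisfies the open set condition, so the Minkowski dimension $D$ of $F$ is the unique real root of $\sum_{j=1}^J r_j^D=1$. $C=[F]$ denotes the convex hull of $F$, with $\dim C=d$. TSC: $\Phi$ satisfies the open set condition with $\mathrm{int}\,C$ as a feasible open set (i.e. the sets $\varphi_j(\mathrm{int}\,C)$ are pairwise disjoint and contained in $\mathrm{int}\,C$). NTC: $\mathrm{int}\,C\not\subseteq\Phi(C)$. PWC: $\partial C\subset F$. $V_F(\varepsilon)$ is the $d$-dimensional volume of $F_\varepsilon=\{x\in\mathbb{R}^d: \mathrm{dist}(x,F)\le\varepsilon\}$. $F$ is Minkowski measurable if $\mathcal{M}(F):=\lim_{\varepsilon\to0^+}V_F(\varepsilon)\varepsilon^{D-d}$ exists, is finite and different from zero; $\mathcal{M}(F)$ is then the Minkowski content. $\Phi$ is of lattice type if the additive subgroup $\sum_{j=1}^J(\log r_j)\mathbb{Z}$ of $\mathbb{R}$ is discrete, and of non-lattice type otherwise. Generator: $T_0=C\setminus\Phi(C)$, assumed to be a single connected component $T_0=G$ (the generator) which is diphase Steiner-like: $G$ is a bounded open set with inradius $g$ (supremum of the radii of balls contained in $G$), and the volume $V_G^-(\varepsilon)$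 of its inner $\varepsilon$-neighborhood $\{x\in\overline{G}:\mathrm{dist}(x,G^c)\le\varepsilon\}$ satisfies $V_G^-(\varepsilon)=\sum_{m=0}^{d-1}\kappa_m(G)\varepsilon^{d-m}$ for $\varepsilon<g$, with constants $\kappa_m(G)$, and $V_G^-(\varepsilon)=\mathrm{volume}(G)=:-\kappa_d(G)$ for $\varepsilon\ge g$. Zeta functions: $\zeta(s)=\frac{1}{1-\sum_{j=1}^Jr_j^s}$ (a meromorphic function on $\mathbb{C}$), and $\zeta_{\mathcal{T}}(s,\varepsilon)=\zeta(s)\,\varepsilon^{d-s}\sum_{m=0}^d\frac{g^{s-m}}{s-m}\kappa_m(G)$. $\mathrm{res}(f(s);\omega)$ denotes the residue of $f$ at $s=\omega$. *)

(* Defs.v *)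
From HB Require Import structures.
From mathcomp Require Import all_boot all_order all_algebra.
From mathcomp Require Import all_classical all_reals all_analysis.
From mathcomp Require Export complex.

Set Implicit Arguments.
Unset Strict Implicit.
Unset Printing Implicit Defensive.

Import Order.TTheory GRing.Theory Num.Theory.
Import numFieldNormedType.Exports.

Local Open Scope classical_set_scope.
Local Open Scope ring_scope.
Local Open Scope complex_scope.

(* R^d is ['rV[R]_d].  Its library norm is the max norm; this gives the usual
   topology, but metric notions must use the Euclidean distance [edist]. *)
Section euclidean_space.
Context {R : realType} {d : nat}.
Implicit Types (A : set 'rV[R]_d) (x y : 'rV[R]_d) (e : R).

Definition edist x y : R := Num.sqrt (\sum_(i < d) (x 0 i - y 0 i) ^+ 2).

Definition set_dist x A : R := inf [set edist x y | y in A].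

Definition neighborhood A e : set 'rV[R]_d := [set x | set_dist x A <= e].

Definition inner_neighborhood A e : set 'rV[R]_d :=
  closure A `&` [set x | set_dist x (~` A) <= e].

Definition inradius A : R :=
  sup [set e | 0 < e /\ exists x, [set y | edist x y < e] `<=` A].

Definition convex_hull A : set 'rV[R]_d :=
  smallest (@convex_set R 'rV[R]_d) A.

Definition affine_hull A : set 'rV[R]_d :=
  [set x | exists (n : nat) (p : 'I_n -> 'rV[R]_d) (c : 'I_n -> R),
    [/\ forall i, A (p i), \sum_(i < n) c i = 1
      & x = \sum_(i < n) c i *: p i]].

Definition has_dim A (k : nat) : Prop :=
  exists (x : 'rV[R]_d) (U : {vspace 'rV[R]_d}),
    affine_hull A = [set x + u | u in [set u | u \in U]] /\ \dim U = k.

Definition box (a b : 'rV[R]_d) : set 'rV[R]_d :=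
  [set x | forall i, a 0 i <= x 0 i <= b 0 i].

(* d-dimensional Lebesgue (outer) measure, the infimum of the total volume of
   countable coverings by boxes.  It is only used on open and on closed sets. *)
Definition lebesgue_outer A : \bar R :=
  ereal_inf [set v | exists a b : nat -> 'rV[R]_d,
    [/\ forall k i, a k 0 i <= b k 0 i,
        A `<=` \bigcup_k box (a k) (b k)
      & v = (\sum_(0 <= k <oo) (\prod_(i < d) (b k 0 i - a k 0 i))%:E)%E]].

Definition volume A : R := fine (lebesgue_outer A).

Definition tube_volume A e : R := volume (neighborhood A e).

Definition minkowski_dimension A (D : R) : Prop :=
  d%:R - ln (tube_volume A e) / ln e @[e --> 0^'+] --> D.

Definition minkowski_content A (D : R) : R :=
  lim (tube_volume A e * e `^ (D - d%:R) @[e --> 0^'+]).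

Definition minkowski_measurable A (D : R) : Prop :=
  cvg (tube_volume A e * e `^ (D - d%:R) @[e --> 0^'+]) /\
  minkowski_content A D != 0.

Definition log_average A (D T : R) : R :=
  (ln T)^-1 * \int[lebesgue_measure]_(e in `[T^-1, 1])
    (e `^ (- (d%:R - D)) * tube_volume A e / e).

Definition average_minkowski_content A (D : R) : R :=
  lim (log_average A D T @[T --> +oo]).

(* Only [kappa 0, ..., kappa d] are constrained (and used). *)
Definition diphase_steiner_like A (kappa : nat -> R) : Prop :=
  [/\ bounded_set A, open A,
      forall e, 0 < e < inradius A ->
        volume (inner_neighborhood A e) = \sum_(m < d) kappa m * e ^+ (d - m),
      forall e, inradius A <= e ->
        volume (inner_neighborhood A e) = volume A
    & kappa d = - volume A].

End euclidean_space.

Section iterated_function_system.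
Context {R : realType} {d J : nat}.
Variable phi : 'I_J -> 'rV[R]_d -> 'rV[R]_d.

Definition similitude (f : 'rV[R]_d -> 'rV[R]_d) (c : R) : Prop :=
  forall x y, edist (f x) (f y) = c * edist x y.

Definition hutchinson (A : set 'rV[R]_d) : set 'rV[R]_d :=
  \bigcup_(j in [set: 'I_J]) (phi j @` A).

Definition tileset_condition (C : set 'rV[R]_d) : Prop :=
  trivIset [set: 'I_J] (fun j => phi j @` C°) /\
  forall j, phi j @` C° `<=` C°.

Definition nontriviality_condition (C : set 'rV[R]_d) : Prop :=
  ~ (C° `<=` hutchinson C).

Definition pearse_winter_condition (C F : set 'rV[R]_d) : Prop :=
  closure C `\` C° `<=` F.

End iterated_function_system.

Definition log_group {R : realType} {J : nat} (r : 'I_J -> R) : set R :=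
  [set x | exists k : 'I_J -> int, x = \sum_(j < J) ln (r j) *~ k j].

Definition lattice_type {R : realType} {J : nat} (r : 'I_J -> R) : Prop :=
  log_group r `<=` isolated (log_group r).

Section zeta_functions.
Context {R : realType}.

(* x ^ s = exp (s log x), for x > 0 and complex s. *)
Definition cpow (x : R) (s : R[i]) : R[i] :=
  let m := expR (complex.Re s * ln x) in
  let t := complex.Im s * ln x in
  (m * cos t) +i* (m * sin t).

(* [f] has at [w] at most a pole: near [w] it is a finite principal part plus
   a holomorphic function [h], and [c] is the coefficient of (s - w)^-1. *)
Definition residue_at (f : R[i] -> R[i]) (w c : R[i]) : Prop :=
  exists (n : nat) (a : 'I_n.+1 -> R[i]) (h : R[i]^o -> R[i]^o),
    [/\ a ord0 = c,
        \forall s \near (w : R[i]^o), derivable h s 1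
      & \forall s \near (w : R[i]^o)^',
          f s = \sum_(k < n.+1) a k / (s - w) ^+ k.+1 + h s].

Definition zeta {J : nat} (r : 'I_J -> R) (s : R[i]) : R[i] :=
  1 / (1 - \sum_(j < J) cpow (r j) s).

Definition zeta_tiling {J : nat} (d : nat) (r : 'I_J -> R) (g : R)
    (kappa : nat -> R) (s : R[i]) (e : R) : R[i] :=
  zeta r s * cpow e (d%:R - s) *
  \sum_(m < d.+1) cpow g (s - m%:R) / (s - m%:R) * (kappa m)%:C.

End zeta_functions.

(* Main.v *)
Require Import Defs.
From HB Require Import structures.
From mathcomp Require Import all_boot all_order all_algebra.
From mathcomp Require Import all_classical all_reals all_analysis.
From mathcomp Require Import measurable_realfun ring lra zify.

(** Let [W e] be the volume of the part of the [e]-neighborhood of [F] that lies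
    in the interior of the hull [C], and [VG e] the volume of the inner
    [e]-neighborhood of the generator [G].  Since the boundary of [C] lies in
    [F], a segment leaving a tile [phi j C] or the generator meets [F] at the
    crossing, so inside each of these pieces the distance to [F] is the distance
    to the part of [F] that belongs to the piece.  The pieces are disjoint open
    sets that exhaust [C] up to the null set [F]; hence the exact recursion
    [W e = VG e + \sum_j r j ^+ d * W (e / r j)] ([inner_tube_rec]).  Outside
    the hull the tube has volume [O(e)] ([tube_le]), which is negligible at the
    scale [e `^ (d - D)] because [D > d - 1].

    Comparing [W] with powers of [e], which are sub- and supersolutions of the
    recursion, identifies the Minkowski dimension as the solution of
    [\sum_j r j `^ D = 1] ([moran_equation]) and bounds the normalized volume
    [Z t = e `^ (D - d) * W e], [t = - ln e].  With the probabilities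
    [p j = r j `^ D] and the steps [a j = - ln (r j)] the recursion is a renewal
    equation [Z t = z t + \sum_j p j * Z (t - a j)] with a forcing term [z] that
    tends to [0] ([log_scale_rec]).  It preserves, up to the contribution of
    [z], the weighted average
    [\sum_j p j * \int_(t - a j)^t Z], which converges to the sum [S] of the
    theorem as [t] grows ([renewal_integral_cvg]); with
    [mu = \sum_j p j * a j], a limit of [Z] can therefore only be [S / mu].

    If the logarithms of the ratios generate a dense group, the sums of steps
    [a j] become dense far out.  Where [Z] is close to its upper limit, so are
    its earlier values along these sums, and since [Z] varies slowly it is close
    to its upper limit on a whole window of times; the weighted average then
    bounds the upper limit by [S / mu] ([renewal_limsup]).  The same argument for
    [- Z] shows that [Z] converges ([nonlattice_tube_cvg]).

    If the ratios are integral powers of one number [exp (- h)], a limit of [Z]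
    would make a discrete analogue of the weighted average along [x + h * N]
    independent of [x].  But it is an explicit combination of exponentials
    [exp ((m - D) x)], [m <= d], in which the exponent [d - D] has a nonzero
    coefficient; by the linear independence of exponentials no limit exists
    ([lattice_tube_not_cvg]).  In both cases the primitive [f] of [Z] satisfies
    [\sum_j p j * (f t - f (t - a j)) --> S], which forces [f t / t --> S / mu]
    ([renewal_average], [tube_log_average]).

    Finally [1 - \sum_j r j `^ s] has a simple zero at [D] with derivative [mu],
    so that the residues are [1 / mu] and [S / mu] ([residue_zeta],
    [residue_zeta_tiling]).  A Taylor estimate for the complex exponential
    provides the local expansions that the residues require. *)

Set Implicit Arguments.
Unset Strict Implicit.
Unset Printing Implicit Defensive.

Import Order.TTheory GRing.Theory Num.Theory.
Import numFieldNormedType.Exports.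

Local Open Scope classical_set_scope.
Local Open Scope ring_scope.
Local Open Scope complex_scope.

Local Notation edist := Defs.edist.

(** * Euclidean distance *)

Section euclidean_distance.
Context {R : realType} {d : nat}.
Implicit Types (x y z : 'rV[R]_d) (A : set 'rV[R]_d) (e c : R).

Definition dotmul x y : R := (x *m y^T) 0 0.

Lemma dotmulE x y : dotmul x y = \sum_i x 0 i * y 0 i.
Proof. by rewrite /dotmul mxE; apply: eq_bigr => i _; rewrite mxE. Qed.

Lemma dotmulC x y : dotmul x y = dotmul y x.
Proof. by rewrite !dotmulE; apply: eq_bigr => i _; rewrite mulrC. Qed.

Lemma dotmulDl x y z : dotmul (x + y) z = dotmul x z + dotmul y z.
Proof. by rewrite /dotmul mulmxDl mxE. Qed.

Lemma dotmulNl x y : dotmul (- x) y = - dotmul x y.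
Proof. by rewrite /dotmul mulNmx mxE. Qed.

Lemma dotmulZl c x y : dotmul (c *: x) y = c * dotmul x y.
Proof. by rewrite /dotmul -scalemxAl mxE. Qed.

Lemma dotmulDr x y z : dotmul z (x + y) = dotmul z x + dotmul z y.
Proof. by rewrite dotmulC dotmulDl !(dotmulC z). Qed.

Lemma dotmulNr x y : dotmul y (- x) = - dotmul y x.
Proof. by rewrite dotmulC dotmulNl dotmulC. Qed.

Lemma dotmulZr c x y : dotmul y (c *: x) = c * dotmul y x.
Proof. by rewrite dotmulC dotmulZl dotmulC. Qed.

Lemma dotmul_ge0 x : 0 <= dotmul x x.
Proof. by rewrite dotmulE sumr_ge0// => i _; rewrite -expr2 sqr_ge0. Qed.

Lemma dotmul_eq0 x : dotmul x x = 0 -> x = 0.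
Proof.
rewrite dotmulE => /eqP; rewrite psumr_eq0 => [|i _]; last by rewrite -expr2 sqr_ge0.
move/allP => h; apply/rowP => i; rewrite mxE.
by have := h i (mem_index_enum i); rewrite /= mulf_eq0 orbb => /eqP.
Qed.

Lemma cauchy_schwarz x y : dotmul x y ^+ 2 <= dotmul x x * dotmul y y.
Proof.
have [/dotmul_eq0->|y0] := eqVneq (dotmul y y) 0.
  by rewrite -(scale0r (0 : 'rV[R]_d)) !dotmulZr !mul0r expr2 !mulr0.
have yp : 0 < dotmul y y by rewrite lt_neqAle eq_sym y0 dotmul_ge0.
have := dotmul_ge0 (dotmul y y *: x - dotmul x y *: y).
rewrite !(dotmulDl, dotmulDr, dotmulNl, dotmulNr, dotmulZl, dotmulZr).
rewrite (dotmulC y x).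
set p := dotmul x y; set q := dotmul y y; set s := dotmul x x.
rewrite (_ : _ + _ = q * (s * q - p ^+ 2)); last by ring.
by rewrite pmulr_rge0// subr_ge0.
Qed.

Lemma edistE x y : edist x y = Num.sqrt (dotmul (x - y) (x - y)).
Proof.
rewrite /edist dotmulE; congr Num.sqrt; apply: eq_bigr => i _.
by rewrite !mxE expr2.
Qed.

Lemma sqr_edist x y : edist x y ^+ 2 = dotmul (x - y) (x - y).
Proof. by rewrite edistE sqr_sqrtr ?dotmul_ge0. Qed.

Lemma euclid_ge0 x y : 0 <= edist x y. Proof. exact: sqrtr_ge0. Qed.

Lemma edistC x y : edist x y = edist y x.
Proof. by rewrite !edistE -opprB dotmulNl dotmulNr opprK. Qed.

Lemma edistxx x : edist x x = 0.
Proof. by rewrite edistE subrr /dotmul mul0mx mxE sqrtr0. Qed.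

Lemma euclid_triangle z x y : edist x y <= edist x z + edist z y.
Proof.
rewrite -(@ler_pXn2r _ 2)// ?nnegrE ?addr_ge0 ?euclid_ge0//.
have e : x - y = (x - z) + (z - y) by rewrite addrA subrK.
rewrite sqrrD !sqr_edist e; move: {e}(x - z) (z - y) (sqr_edist x z) (sqr_edist z y) => a b ea eb.
rewrite [X in X <= _]dotmulDl !dotmulDr (dotmulC b a) -ea -eb.
suff : dotmul a b <= edist x z * edist z y by rewrite mulr2n; lra.
apply: le_trans (ler_norm _) _.
rewrite -(@ler_pXn2r _ 2)// ?nnegrE ?mulr_ge0 ?euclid_ge0//.
by rewrite real_normK ?num_real// exprMn ea eb cauchy_schwarz.
Qed.

Lemma edistDr z x y : edist (x + z) (y + z) = edist x y.
Proof. by rewrite !edistE opprD addrACA subrr addr0. Qed.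

Lemma edistZ c x y : edist (c *: x) (c *: y) = `|c| * edist x y.
Proof.
rewrite !edistE -scalerBr dotmulZl dotmulZr mulrA -expr2 sqrtrM ?sqr_ge0//.
by rewrite sqrtr_sqr.
Qed.

Lemma coord_le_edist x y i : `|x 0 i - y 0 i| <= edist x y.
Proof.
rewrite -(@ler_pXn2r _ 2)// ?nnegrE ?euclid_ge0//.
rewrite real_normK ?num_real// sqr_edist dotmulE (bigD1 i)//= !mxE -expr2.
by rewrite lerDl sumr_ge0// => j _; rewrite -expr2 sqr_ge0.
Qed.

Lemma edist_le_coord x y e :
  (forall i, `|x 0 i - y 0 i| <= e) -> edist x y <= d%:R * e.
Proof.
move=> h; have [i _|d0] := pickP (fun _ : 'I_d => true); last first.
  rewrite edistE dotmulE big1 ?sqrtr0 => [|i _]; last by have := d0 i.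
  by case: d d0 {x y h} => [|n] d0; [rewrite mul0r|have := d0 ord0].
have e0 : 0 <= e := le_trans (normr_ge0 _) (h i).
rewrite -(@ler_pXn2r _ 2)// ?nnegrE ?euclid_ge0 ?mulr_ge0//.
rewrite sqr_edist dotmulE exprMn.
have : \sum_i (x - y) 0 i * (x - y) 0 i <= \sum_(i < d) e ^+ 2.
  apply: ler_sum => j _; rewrite -expr2 -real_normK ?num_real//.
  by rewrite ler_pXn2r// !mxE.
move/le_trans; apply; rewrite sumr_const card_ord -[_ *+ _]mulr_natl ler_wpM2r ?sqr_ge0//.
by rewrite -natrX ler_nat; case: d {x y h i} => // n; rewrite expnS leq_pmulr// expn_gt0.
Qed.

(** The ambient topology comes from the maximum norm; its comparison with the
    Euclidean distance lets open, closed and bounded sets be handled with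
    [edist]. *)
Lemma nbhs_edistP x A :
  nbhs x A <-> exists2 e, 0 < e & forall y, edist x y < e -> A y.
Proof.
split=> [/nbhs_ballP[e /= e0 eA]|[e e0 eA]].
  exists e => // y xy; apply: eA; split=> // i j.
  rewrite (ord1 i); apply: le_lt_trans xy; exact: coord_le_edist.
apply/nbhs_ballP; exists (e / (d%:R + 1)); first by rewrite /= divr_gt0// ltr_wpDl.
move=> y [_ xy]; apply: eA.
have /le_lt_trans : edist x y <= d%:R * (e / (d%:R + 1)).
  by apply: edist_le_coord => i; apply: ltW; exact: xy.
apply; rewrite mulrA ltr_pdivrMr ?ltr_wpDl// mulrDr mulr1 mulrC.
by rewrite ltrDl.
Qed.

Lemma edist_ball_open x e : open [set y | edist x y < e].
Proof.
rewrite openE => y /= xy; apply/nbhs_edistP; exists (e - edist x y).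
  by rewrite subr_gt0.
by move=> z yz; apply: le_lt_trans (euclid_triangle y x z) _; lra.
Qed.

Lemma closure_edistP A x :
  closure A x <-> forall e, 0 < e -> exists2 y, A y & edist x y < e.
Proof.
split=> [cAx e e0|h B /nbhs_edistP[e e0 eB]].
  have /cAx[y [Ay xy]] : nbhs x [set y | edist x y < e].
    by apply/nbhs_edistP; exists e.
  by exists y.
by have [y Ay xy] := h e e0; exists y; split=> //; exact: eB.
Qed.

Lemma interior_edistP A x :
  A° x <-> exists2 e, 0 < e & forall y, edist x y < e -> A y.
Proof. exact: nbhs_edistP. Qed.

Lemma bounded_edistP A :
  bounded_set A <-> exists2 M, 0 < M & forall x, A x -> edist 0 x <= M.
Proof.
split=> [[M [_ MA]]|[M M0 MA]].
  exists (d%:R * (`|M| + 1) + 1).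
    by rewrite ltr_wpDl// mulr_ge0// addr_ge0.
  move=> x Ax; have xM : `|x| <= `|M| + 1.
    by apply: MA => //; rewrite (le_lt_trans (ler_norm _))// ltrDl.
  apply: le_trans (@edist_le_coord _ _ (`|M| + 1) _) _; last by rewrite lerDl.
  move=> i; rewrite mxE sub0r normrN.
  apply: le_trans xM; rewrite [leRHS]/Num.Def.normr /= mx_normrE.
  by apply/bigmax_geP; right => /=; exists (0, i).
exists M; split=> [|K MK x Ax]; first exact: num_real.
rewrite /Num.Def.normr /= mx_normrE; apply/bigmax_leP; split=> [|[i j] _ /=]; first by lra.
rewrite (ord1 i); have := coord_le_edist 0 x j. rewrite mxE sub0r normrN.
by have := MA x Ax; lra.
Qed.

End euclidean_distance.

Section set_distance.
Context {R : realType} {d : nat}.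
Implicit Types (x y z : 'rV[R]_d) (A B : set 'rV[R]_d) (e c : R).

Let has_inf_dist A x : A !=set0 -> has_inf [set edist x y | y in A].
Proof.
move=> [a Aa]; split; first by exists (edist x a), a.
by exists 0 => _ [y _ <-]; exact: euclid_ge0.
Qed.

Lemma set_dist_le A x y : A y -> set_dist x A <= edist x y.
Proof.
move=> Ay; apply: ge_inf; last by exists y.
by have [] := @has_inf_dist A x (ex_intro _ y Ay).
Qed.

Lemma le_set_dist A x e : A !=set0 ->
  (forall y, A y -> e <= edist x y) -> e <= set_dist x A.
Proof.
move=> A0 h; apply: lb_le_inf; first by have [] := @has_inf_dist A x A0.
by move=> _ [y Ay <-]; exact: h.
Qed.

Lemma set_dist_lt A x e : A !=set0 -> set_dist x A < e ->
  exists2 y, A y & edist x y < e.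
Proof.
move=> A0 h; have e0 : 0 < e - set_dist x A by rewrite subr_gt0.
have [_ [y Ay <-] ye] := inf_adherent e0 (@has_inf_dist A x A0).
by exists y => //; move: ye; rewrite -/(set_dist x A); lra.
Qed.

End set_distance.

(** * Similitudes *)

Section similitudes.
Context {R : realType} {d : nat}.
Implicit Types (x y z : 'rV[R]_d) (A : set 'rV[R]_d) (c : R) (f : 'rV[R]_d -> 'rV[R]_d).

(** Normalized at the origin, a similitude multiplies inner products by
    [c ^+ 2]; the images of the unit vectors are then the rows of a matrix [M]
    with [M *m M^T] scalar, and inner products with them determine every image. *)
Lemma similitude_affine f c : 0 < c -> similitude f c ->
  exists M : 'M[R]_d, [/\ M *m M^T = (c ^+ 2)%:M, M^T *m M = (c ^+ 2)%:M
    & forall x, f x = x *m M + f 0].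
Proof.
move=> c0 fc; have [f0 f0E] : exists f0, forall x, f0 x = f x - f 0 by exists (fun x => f x - f 0).
have dist0 x y : dotmul (f0 x - f0 y) (f0 x - f0 y) = c ^+ 2 * dotmul (x - y) (x - y).
  rewrite -!sqr_edist -exprMn -fc; congr (_ ^+ 2).
  by rewrite !f0E edistDr.
have f00 : f0 0 = 0 by rewrite f0E subrr.
have norm0 x : dotmul (f0 x) (f0 x) = c ^+ 2 * dotmul x x.
  by have := dist0 x 0; rewrite f00 !subr0.
have dot0 x y : dotmul (f0 x) (f0 y) = c ^+ 2 * dotmul x y.
  have := dist0 x y; rewrite !(dotmulDl, dotmulDr, dotmulNl, dotmulNr) !norm0.
  by rewrite (dotmulC (f0 y)) (dotmulC y); lra.
pose M : 'M[R]_d := \matrix_(i, j) f0 (delta_mx 0 i) 0 j.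
have fM x : f0 x *m M^T = c ^+ 2 *: x.
  apply/rowP => i; have := dot0 x (delta_mx 0 i).
  rewrite [X in _ = _ * X]/dotmul trmx_delta -colE !mxE => <-.
  by rewrite dotmulE; apply: eq_bigr => j _; rewrite !mxE.
have MM : M *m M^T = (c ^+ 2)%:M.
  apply/row_matrixP => i; rewrite row_mul.
  have -> : row i M = f0 (delta_mx 0 i) by apply/rowP => j; rewrite !mxE.
  by rewrite fM rowE -scalemx1 -scalemxAr mulmx1.
have c2 : c ^+ 2 != 0 by rewrite expf_neq0// gt_eqF.
have MM' : M^T *m M = (c ^+ 2)%:M.
  have : M *m (c ^- 2 *: M^T) = 1%:M.
    by rewrite -scalemxAr MM scale_scalar_mx mulVf.
  move/mulmx1C; rewrite -scalemxAl => /(congr1 (GRing.scale (c ^+ 2))).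
  by rewrite scalerA divff// scale1r scalemx1.
exists M; split=> // x; apply/eqP; rewrite -subr_eq -f0E; apply/eqP.
have := congr1 (mulmx^~ M) (fM x); rewrite -mulmxA MM' -scalemxAl.
rewrite mul_mx_scalar => /(congr1 (GRing.scale (c ^- 2))).
by rewrite !scalerA mulVf// !scale1r.
Qed.

Lemma similitude_inverse f c : 0 < c -> similitude f c ->
  exists f', [/\ similitude f' c^-1, cancel f f' & cancel f' f].
Proof.
move=> c0 fc; have [M [MM MM' fM]] := similitude_affine c0 fc.
have c2 : c ^+ 2 != 0 by rewrite expf_neq0// gt_eqF.
exists (fun y => c ^- 2 *: ((y - f 0) *m M^T)).
have K : cancel (fun y => c ^- 2 *: ((y - f 0) *m M^T)) f.
  move=> y; rewrite fM -scalemxAl -mulmxA MM' mul_mx_scalar scalerA mulVf//.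
  by rewrite scale1r subrK.
split=> // [x y|x].
  by rewrite -{2}(K x) -{2}(K y) fc mulrA mulVf ?mul1r// gt_eqF.
by rewrite fM addrK -mulmxA MM mul_mx_scalar scalerA mulVf// scale1r.
Qed.

Lemma similitude_homothety c z : 0 <= c -> similitude (fun x => c *: x + z) c.
Proof. by move=> c0 x y; rewrite edistDr edistZ ger0_norm. Qed.

Lemma similitude_image_open f c A : 0 < c -> similitude f c ->
  open A -> open (f @` A).
Proof.
move=> c0 fc; rewrite !openE => oA _ [x Ax <-].
have /interior_edistP[e e0 eA] := oA _ Ax.
have [f' [f'c fK f'K]] := similitude_inverse c0 fc.
apply/interior_edistP; exists (c * e); first by rewrite mulr_gt0.
move=> y xy; exists (f' y); last by [].
apply: eA; rewrite -(fK x) f'c mulrC ltr_pdivrMr// mulrC //.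
Qed.

Lemma similitude_closure f c A x : 0 < c -> similitude f c ->
  closure A x -> closure (f @` A) (f x).
Proof.
move=> c0 fc /closure_edistP h; apply/closure_edistP => e e0.
have [|y Ay xy] := h (e / c); first by rewrite divr_gt0.
by exists (f y); [exists y | rewrite fc mulrC -ltr_pdivlMr].
Qed.

End similitudes.

(** * Lebesgue outer measure *)

Section box_covering.
Context {R : realType}.
Local Open Scope ereal_scope.
Implicit Types (s t : R) (c : R).

(** Integrate the inequality between indicator functions over the line. *)
Lemma itv_cover_length c s t (ck sk tk : nat -> R) :
  (0 <= c)%R -> (s <= t)%R ->
  (forall k, (0 <= ck k)%R) -> (forall k, (sk k <= tk k)%R) ->
  (forall y : R, (c * \1_(`[s, t]%classic) y)%:E <=
    \sum_(0 <= k <oo) (ck k * \1_(`[sk k, tk k]%classic) y)%:E) ->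
  (c * (t - s))%:E <= \sum_(0 <= k <oo) (ck k * (tk k - sk k))%:E.
Proof.
move=> c0 st ck0 stk h.
have len (a b : R) : (a <= b)%R -> lebesgue_measure `[a, b]%classic = (b - a)%:E.
  move=> ab; rewrite lebesgue_measure_itv/= lte_fin.
  by case: ltP ab => // ba ab; rewrite (_ : b = a) ?subrr//; apply: le_anti; rewrite ba.
have int (e a b : R) : (0 <= e)%R -> (a <= b)%R ->
    \int[lebesgue_measure]_y (e * \1_(`[a, b]%classic) y)%:E = (e * (b - a))%:E.
  move=> e0 ab; under eq_integral do rewrite EFinM.
  rewrite ge0_integralZl_EFin//; last first.
    by apply/measurable_EFinP; exact: measurable_indic.
  by rewrite integral_indic// setIT EFinM; congr (_ * _); exact: len.
have mE (e a b : R) : measurable_fun [set: R] (fun y => (e * \1_(`[a, b]%classic) y)%:E).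
  by apply/measurable_EFinP; apply: measurable_funM => //; exact: measurable_indic.
rewrite -int//; under eq_eseriesr do rewrite -int//.
rewrite -integral_nneseries//; last by move=> n x _; rewrite lee_fin mulr_ge0.
have f0 k y : 0 <= (ck k * \1_(`[sk k, tk k]%classic) y)%:E by rewrite lee_fin mulr_ge0.
apply: (@ge0_le_integral _ (measurableTypeR R) R lebesgue_measure setT measurableT
  (fun y => (c * \1_(`[s, t]%classic) y)%:E)
  (fun y => \sum_(0 <= k <oo) (ck k * \1_(`[sk k, tk k]%classic) y)%:E)).
- by move=> x _; rewrite lee_fin mulr_ge0.
- exact: mE.
- by apply: (@ge0_emeasurable_sum _ _ _ _ _ xpredT) => k *; [exact: f0|exact: mE].
- by move=> y _; exact: h.
by move=> n; exact: mE.
Qed.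

(** Indicator functions of boxes are products over the coordinates, and
    integrating one coordinate at a time turns each factor into a length.
    Points are sequences [nat -> R], so that all dimensions share one type in
    the induction. *)
Lemma box_cover_volume n c (s t : nat -> R) (ck : nat -> R) (sk tk : nat -> nat -> R) :
  (0 <= c)%R -> (forall i, (s i <= t i)%R) ->
  (forall k, (0 <= ck k)%R) -> (forall k i, (sk k i <= tk k i)%R) ->
  (forall x : nat -> R, (c * \prod_(i < n) \1_(`[s i, t i]%classic) (x i))%:E <=
    \sum_(0 <= k <oo) (ck k * \prod_(i < n) \1_(`[sk k i, tk k i]%classic) (x i))%:E) ->
  (c * \prod_(i < n) (t i - s i))%:E <=
    \sum_(0 <= k <oo) (ck k * \prod_(i < n) (tk k i - sk k i))%:E.
Proof.
elim: n c ck => [|n IH] c ck c0 st ck0 stk h.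
  by have := h (fun=> 0%R); under eq_eseriesr do rewrite big_ord0; rewrite !big_ord0; under [in X in _ -> X]eq_eseriesr do rewrite big_ord0.
rewrite big_ord_recr/= mulrA mulrAC.
under eq_eseriesr do rewrite big_ord_recr/= mulrA mulrAC.
apply: IH => //.
- by rewrite mulr_ge0// subr_ge0.
- by move=> k; rewrite mulr_ge0// subr_ge0.
move=> x.
rewrite mulrAC; under eq_eseriesr do rewrite mulrAC.
apply: itv_cover_length => //.
- by rewrite mulr_ge0// prodr_ge0.
- by move=> k; rewrite mulr_ge0// prodr_ge0.
move=> y; have := h (fun i => if i == n then y else x i).
under eq_eseriesr do rewrite big_ord_recr/= eqxx mulrA.
rewrite big_ord_recr/= eqxx mulrA.
have e (a b : nat -> R) : (\prod_(i < n) \1_(`[a i, b i]%classic) (if i == n :> nat then y else x i) =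
  \prod_(i < n) \1_(`[a i, b i]%classic) (x i) :> R)%R.
  by apply: eq_bigr => i _; rewrite ltn_eqF.
rewrite e; under eq_eseriesr do rewrite e.
by [].
Qed.

End box_covering.

(** The two pieces of the interval from [x] to [y] cut at [t]; one of them is
    degenerate when [t] lies outside the interval. *)
Lemma itv_split_length (R : realType) (x y t : R) : x <= y ->
  y - x = (Num.max x (Num.min y t) - x) + (y - Num.min y (Num.max x t)).
Proof.
move=> xy; have [yt|ty] := leP y t.
  have xt := le_trans xy yt.
  by rewrite (max_r xy) (max_r xt) (min_l yt); lra.
have [xt|tx] := leP x t; first by rewrite (min_r (ltW ty)); lra.
by rewrite (min_r xy); lra.
Qed.

Section outer_measure.
Context {R : realType} {n : nat}.
Local Notation d := n.+1.
Local Open Scope ereal_scope.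
Implicit Types (a b x : 'rV[R]_d) (A : set 'rV[R]_d).

Definition box_volume a b : R := \prod_(i < d) (b 0 i - a 0 i).

Definition box_cover A (ab : nat -> 'rV[R]_d * 'rV[R]_d) :=
  (forall k i, ((ab k).1 0 i <= (ab k).2 0 i)%R) /\
  A `<=` \bigcup_k box (ab k).1 (ab k).2.

Lemma box_volume_ge0 a b : (forall i, (a 0 i <= b 0 i)%R) -> (0 <= box_volume a b)%R.
Proof. by move=> ab; apply: prodr_ge0 => i _; rewrite subr_ge0. Qed.

Lemma lebesgue_outer_cover A ab : box_cover A ab ->
  lebesgue_outer A <= \sum_(0 <= k <oo) (box_volume (ab k).1 (ab k).2)%:E.
Proof.
move=> [abP Aab]; apply: ereal_inf_lbound => /=.
by exists (fst \o ab), (snd \o ab).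
Qed.

Lemma le_lebesgue_outer A y :
  (forall ab, box_cover A ab ->
    y <= \sum_(0 <= k <oo) (box_volume (ab k).1 (ab k).2)%:E) ->
  y <= lebesgue_outer A.
Proof.
move=> h; apply: le_ereal_inf_tmp => _ [a [b [ab Aab ->]]].
exact: (h (fun k => (a k, b k))).
Qed.

Lemma lebesgue_outer_cover_adherent A (e : R) : (0 < e)%R ->
  lebesgue_outer A < +oo ->
  exists2 ab, box_cover A ab &
    \sum_(0 <= k <oo) (box_volume (ab k).1 (ab k).2)%:E <= lebesgue_outer A + e%:E.
Proof.
move=> e0 Aoo; apply: contrapT => h.
suff : lebesgue_outer A + e%:E <= lebesgue_outer A.
  have : 0 <= lebesgue_outer A.
    by apply: le_lebesgue_outer => ab [abP _]; apply: nneseries_ge0 => k _ _;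
      rewrite lee_fin box_volume_ge0.
  move: Aoo; case: (lebesgue_outer A) => //= v _ _.
  by rewrite -EFinD lee_fin; lra.
apply: le_lebesgue_outer => ab Aab; rewrite leNgt; apply/negP => /ltW abe.
by apply: h; exists ab.
Qed.

Lemma lebesgue_outer_ge0 A : 0 <= lebesgue_outer A.
Proof.
apply: le_lebesgue_outer => ab [abP _]; apply: nneseries_ge0 => k _ _.
by rewrite lee_fin box_volume_ge0.
Qed.

Lemma box_volumexx a : box_volume a a = 0%R.
Proof. by rewrite /box_volume big_ord_recl subrr mul0r. Qed.

Lemma lebesgue_outer_le_box a b A : (forall i, (a 0 i <= b 0 i)%R) ->
  A `<=` box a b -> lebesgue_outer A <= (box_volume a b)%:E.
Proof.
move=> ab Aab; pose c k := if k is 0%N then (a, b) else (a, a).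
apply: (@le_trans _ _ (\sum_(0 <= k <oo) (box_volume (c k).1 (c k).2)%:E)).
  apply: lebesgue_outer_cover; split=> [[|k] i //=|x /Aab abx].
  by exists 0%N.
rewrite nneseries_recl//=; last first.
  by move=> [|k] _ /=; rewrite lee_fin box_volume_ge0.
by rewrite eseries0 ?adde0// => -[|k] //= _ _; rewrite box_volumexx.
Qed.

Lemma lebesgue_outer0 : lebesgue_outer (set0 : set 'rV[R]_d) = 0.
Proof.
apply/eqP; rewrite eq_le lebesgue_outer_ge0 andbT.
have := @lebesgue_outer_le_box 0 0 set0; rewrite box_volumexx; apply=> //.
Qed.

Lemma le_lebesgue_outer_set :
  {homo (@lebesgue_outer R d) : A B / A `<=` B >-> A <= B}.
Proof.
move=> A B AB; apply: le_lebesgue_outer => ab [abP Bab].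
by apply: lebesgue_outer_cover; split=> //; exact: subset_trans Bab.
Qed.

(** Coverings of the sets [A k] with errors [e / 2 ^ k.+1] are merged along a
    bijection between [nat] and [nat * nat]. *)
Lemma lebesgue_outer_sigma_subadditive : sigma_subadditive (@lebesgue_outer R d).
Proof.
move=> A; have [[i ioo]|] := pselect (exists i, lebesgue_outer (A i) = +oo).
  rewrite (eseries_pinfty _ _ ioo) ?leey// => k _.
  by rewrite -ltNye (lt_le_trans _ (lebesgue_outer_ge0 _)).
rewrite -forallNE => Aoo.
apply/lee_addgt0Pr => e e0.
rewrite (le_trans _ (epsilon_trick _ _ (ltW e0)))//; last first.
  by move=> k; exact: lebesgue_outer_ge0.
pose P k ab := box_cover (A k) ab /\
  \sum_(0 <= i <oo) (box_volume (ab i).1 (ab i).2)%:E <=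
    lebesgue_outer (A k) + (e / (2 ^ k.+1)%:R)%:E.
have [G PG] : {G & forall k, P k (G k)}.
  apply: (@choice _ _ P) => k.
  have ek : (0 < e / (2 ^ k.+1)%:R)%R by rewrite divr_gt0// ltr0n expn_gt0.
  have [|ab Aab abk] := lebesgue_outer_cover_adherent (A := A k) ek.
    by rewrite ltey; apply/eqP; exact: Aoo.
  by exists ab.
pose v (ij : nat * nat) := (box_volume (G ij.1 ij.2).1 (G ij.1 ij.2).2)%:E.
have v0 ij : 0 <= v ij.
  by rewrite lee_fin; apply: box_volume_ge0; exact: (PG ij.1).1.1.
apply: (@le_trans _ _ (\esum_(i in setT) v i)).
  have /card_esym/ppcard_eqP[f] := card_nat2.
  apply: (@le_trans _ _ (\sum_(0 <= k <oo) v (f k))).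
    apply: (@lebesgue_outer_cover _ (fun k => G (f k).1 (f k).2)); split.
      by move=> k i; exact: (PG (f k).1).1.1.
    move=> x [i _ /(PG i).1.2[j _ xij]]; exists (f^-1%FUN (i, j)) => //=.
    by rewrite invK ?inE.
  rewrite nneseries_esumT//.
  by rewrite (reindex_esum setT setT f v)//; exact: 'bij_f.
rewrite (_ : [set: nat * nat] = [set: nat] `*`` (fun=> [set: nat])); last first.
  by apply/seteqP; split.
rewrite -(@esum_esum _ _ _ _ _ (fun i j => v (i, j)))//.
rewrite -nneseries_esumT; last by move=> k; apply: esum_ge0.
apply: lee_nneseries => [k _ _|k _]; first exact: esum_ge0.
by rewrite -nneseries_esumT//; exact: (PG k).2.
Qed.

HB.instance Definition _ := isOuterMeasure.Build R 'rV[R]_d (@lebesgue_outer R d)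
  lebesgue_outer0 lebesgue_outer_ge0 le_lebesgue_outer_set
  lebesgue_outer_sigma_subadditive.

(** A covering of a box gives a pointwise inequality between products of
    indicator functions, which [box_cover_volume] integrates. *)
Lemma lebesgue_outer_box a b : (forall i, (a 0 i <= b 0 i)%R) ->
  lebesgue_outer (box a b) = (box_volume a b)%:E.
Proof.
move=> ab; apply/eqP; rewrite eq_le lebesgue_outer_le_box//=.
apply: le_lebesgue_outer => c [cP abc].
have := @box_cover_volume R d 1 (fun i => a 0 (inord i))%R (fun i => b 0 (inord i))%R
  (fun=> 1%R) (fun k i => (c k).1 0 (inord i))%R (fun k i => (c k).2 0 (inord i))%R
  ler01 (fun i => ab _) (fun=> ler01) (fun k i => cP k _).
have e (u v : 'rV[R]_d) : (\prod_(i < d) (v 0 (inord i) - u 0 (inord i)) = box_volume u v)%R.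
  by apply: eq_bigr => i _; rewrite inord_val.
rewrite mul1r e; under eq_eseriesr do rewrite mul1r e; apply => x.
have ind (u v : 'rV[R]_d) : box u v (\row_i x i)%R <->
    (\prod_(i < d) \1_(`[u 0 (inord i), v 0 (inord i)]%classic) (x i) = 1 :> R)%R.
  split=> [uvx|h i].
    apply: big1 => i _; rewrite indicE mem_set//= in_itv/= inord_val.
    by have := uvx i; rewrite mxE.
  rewrite mxE; apply: contrapT => /negP xi; move: h.
  rewrite (bigD1 i)//= indicE memNset ?mul0r => [/eqP|]; first by rewrite eq_sym oner_eq0.
  by rewrite /= in_itv/= inord_val; exact/negP.
have ind0 (u v : 'rV[R]_d) : (0 <= \prod_(i < d) \1_(`[u 0 (inord i), v 0 (inord i)]%classic) (x i) :> R)%R.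
  by apply: prodr_ge0.
have [abx|abx] := pselect (box a b (\row_i x i)%R); last first.
  have [i abxi] : exists i, ~~ (a 0 i <= x i <= b 0 i)%R.
    apply: contrapT => h; apply: abx => i; rewrite mxE.
    by apply: contrapT => /negP xi; apply: h; exists i.
  rewrite (bigD1 i)//= indicE memNset ?mul0r ?mulr0.
    by apply: nneseries_ge0 => k _ _; rewrite mul1r lee_fin.
  by rewrite /= in_itv/= inord_val; exact/negP.
have [k _ /ind xk] := abc _ abx.
rewrite (proj1 (ind _ _) abx) mulr1.
apply: le_trans (nneseries_lim_ge k.+1 _); last by move=> *; rewrite mul1r lee_fin.
rewrite big_nat_recr//= xk mulr1 leeDr// sume_ge0// => j _.
by rewrite mul1r lee_fin.
Qed.

(** A coordinate hyperplane cuts every covering box into two boxes whose volumes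
    add up, so a covering of a set splits into coverings of its two parts. *)
Lemma halfspace_measurable (i : 'I_d) (t : R) :
  (@lebesgue_outer R d).-caratheodory [set x | (x 0 i <= t)%R].
Proof.
apply: le_caratheodory_measurable => X; apply: le_lebesgue_outer => c [cP Xc].
pose c1 k := ((c k).1, (\row_j if j == i then Num.max ((c k).1 0 i) (Num.min ((c k).2 0 i) t)
  else (c k).2 0 j)%R : 'rV[R]_d).
pose c2 k := ((\row_j if j == i then Num.min ((c k).2 0 i) (Num.max ((c k).1 0 i) t)
  else (c k).1 0 j)%R : 'rV[R]_d, (c k).2).
have v0 k : forall i, ((c1 k).1 0 i <= (c1 k).2 0 i)%R.
  by move=> j; rewrite /c1 /= !mxE; case: eqP => // ->; rewrite le_max lexx.
have v1 k : forall i, ((c2 k).1 0 i <= (c2 k).2 0 i)%R.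
  by move=> j; rewrite /c2 /= !mxE; case: eqP => // ->; rewrite ge_min lexx.
have -> : \sum_(0 <= k <oo) (box_volume (c k).1 (c k).2)%:E =
    \sum_(0 <= k <oo) ((box_volume (c1 k).1 (c1 k).2)%:E + (box_volume (c2 k).1 (c2 k).2)%:E).
  apply: eq_eseriesr => k _; rewrite -EFinD; congr (_%:E).
  have e u v : box_volume u v = ((v 0 i - u 0 i) * \prod_(j < d | j != i) (v 0 j - u 0 j))%R.
    by rewrite /box_volume (bigD1 i).
  rewrite !e /= !mxE eqxx.
  set P := (\prod_(j < d | j != i) ((c k).2 0 j - (c k).1 0 j))%R.
  rewrite [X in (_ * X + _)%R](_ : (_ = P)%R); last first.
    by apply: eq_bigr => j ji; rewrite !mxE (negbTE ji).
  rewrite [X in (_ + _ * X)%R](_ : (_ = P)%R); last first.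
    by apply: eq_bigr => j ji; rewrite !mxE (negbTE ji).
  rewrite -mulrDl; congr (_ * _)%R; have := cP k i.
  exact: itv_split_length.
rewrite nneseriesD => [|k _ _|k _ _]; try by rewrite lee_fin box_volume_ge0.
apply: leeD; apply: lebesgue_outer_cover; split=> //.
  move=> x [/Xc[k _ xk] xt]; exists k => // j /=; rewrite !mxE.
  have := xk j; case: eqP => // -> /andP[-> x2] /=.
  by rewrite le_max le_min x2 xt orbT.
move=> x [/Xc[k _ xk] /negP]; rewrite -ltNge => xt; exists k => // j /=; rewrite !mxE.
have := xk j; case: eqP => // -> /andP[x1 ->]; rewrite andbT.
by rewrite ge_min ge_max x1 (ltW xt) orbT.
Qed.

End outer_measure.

Section measurable_open.
Context {R : realType} {n : nat}.
Local Notation d := n.+1.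
Local Notation mu := (@lebesgue_outer R d).
Implicit Types (a b x : 'rV[R]_d) (A B : set 'rV[R]_d).

(** An open set is a countable union of half-open boxes with rational corners. *)
Lemma open_caratheodory A : open A -> mu.-caratheodory A.
Proof.
move=> oA; pose T : measurableType _ := caratheodory_type mu.
pose B (pq : 'rV[rat]_d * 'rV[rat]_d) : set 'rV[R]_d :=
  [set x | forall i, ratr (pq.1 0 i) < x 0 i <= ratr (pq.2 0 i)].
have mB pq : @measurable _ T (B pq).
  have -> : B pq = \bigcap_(i in [set: 'I_d])
      (~` [set x | x 0 i <= ratr (pq.1 0 i)] `&` [set x | x 0 i <= ratr (pq.2 0 i)]).
    apply/seteqP; split=> [x xB i _|x xB i].
      by have /andP[x1 x2] := xB i; split=> //=; apply/negP; rewrite -ltNge.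
    by have [/= /negP] := xB i I; rewrite -ltNge => -> ->.
  apply: (@fin_bigcap_measurable _ T) => [|i _]; first exact: finite_finset.
  apply: measurableI; last exact: halfspace_measurable.
  by apply: measurableC; exact: halfspace_measurable.
have -> : A = \bigcup_pq (if pselect (B pq `<=` A) then B pq else set0).
  apply/seteqP; split=> [x Ax|x [pq _]]; last by case: pselect => // h /h.
  have /nbhs_edistP[e e0 eA] : nbhs x A by move: oA; rewrite openE; apply.
  have e'0 : 0 < e / (d%:R + 1) by rewrite divr_gt0// ltr_wpDl.
  set e' := e / (d%:R + 1) in e'0.
  have de : d%:R * e' < e.
    by rewrite /e' mulrA ltr_pdivrMr ?ltr_wpDl// mulrDr mulr1 mulrC ltrDl.
  have /(@choice _ _ _)[p pP] i : exists q : rat, ratr q \in `](x 0 i - e'), (x 0 i)[.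
    by apply: rat_in_itvoo; lra.
  have /(@choice _ _ _)[q qP] i : exists q : rat, ratr q \in `](x 0 i), (x 0 i + e')[.
    by apply: rat_in_itvoo; lra.
  exists (\row_i p i, \row_i q i) => //; case: pselect => [? /= i|[]].
    by rewrite !mxE; move: (pP i) (qP i); rewrite !in_itv/= => /andP[_ ->] /andP[/ltW ->].
  move=> y yB; apply: eA; apply: le_lt_trans de; apply: edist_le_coord => i.
  move: (pP i) (qP i) (yB i) => /=; rewrite !in_itv/= !mxE => p1 p2 p3.
  by rewrite ler_norml; apply/andP; lra.
apply: (@countable_bigcupT_measurable _ T) => // pq.
by case: pselect => ? /=; [exact: mB|exact: measurable0].
Qed.

End measurable_open.

(** * Volumes of similar sets *)

(** The volume of a box grows by [O(s)] when its sides grow by [s]. *)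
Lemma prod_shift_le (R : realType) m (l : 'I_m -> R) : (forall i, 0 <= l i) ->
  exists2 C : R, 0 <= C & forall s : R, 0 <= s <= 1 ->
    \prod_(i < m) (l i + s) <= \prod_(i < m) l i + s * C.
Proof.
elim: m l => [|m IH] l l0; first by exists 0 => // s _; rewrite !big_ord0 mulr0 addr0.
have [C C0 CP] := IH _ (fun i => l0 (widen_ord (leqnSn m) i)).
set P := \prod_(i < m) l (widen_ord (leqnSn m) i) in CP.
have P0 : 0 <= P by exact: prodr_ge0.
have lm := l0 ord_max.
exists (P + C * l ord_max + C); first by rewrite !addr_ge0// mulr_ge0.
move=> s /andP[s0 s1]; rewrite !big_ord_recr/= -/P.
have := CP s; rewrite s0 s1 => /(_ isT) h.
apply: (le_trans (ler_wpM2r _ h)); first by rewrite addr_ge0.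
have : s * (s * C) <= s * C by rewrite ler_wpM2l// ler_piMl.
by nra.
Qed.

Lemma outer_measure_bigsetU (R : realType) T (mu : {outer_measure set T -> \bar R})
    (I : finType) (P : pred I) (A : I -> set T) :
  (mu (\big[setU/set0]_(i | P i) A i) <= \sum_(i | P i) mu (A i))%E.
Proof.
elim/big_ind2 : _ => [|x a y b xa yb|//]; first by rewrite outer_measure0.
by apply: le_trans (outer_measureU2 _ _ _) _; exact: leeD.
Qed.

Section similitude_volume.
Context {R : realType} {n : nat}.
Local Notation d := n.+1.
Local Notation mu := (@lebesgue_outer R d).
Implicit Types (a b x z : 'rV[R]_d) (A B : set 'rV[R]_d) (f : 'rV[R]_d -> 'rV[R]_d) (c s : R).

(** An estimate for the images of boxes extends to all sets by pushing
    coverings forward. *)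
Lemma lebesgue_outer_image_le f c A : 0 < c ->
  (forall a b, (forall i, a 0 i <= b 0 i) ->
    (mu (f @` box a b) <= (c * box_volume a b)%:E)%E) ->
  (mu (f @` A) <= c%:E * mu A)%E.
Proof.
move=> c0 fbox; rewrite -lee_pdivrMl//; apply: le_lebesgue_outer => ab [abP Aab].
rewrite lee_pdivrMl// -nneseriesZl => [|k _]; last by rewrite lee_fin box_volume_ge0.
apply: (@le_trans _ _ (mu (\bigcup_k (f @` box (ab k).1 (ab k).2)))).
  apply: le_lebesgue_outer_set => _ [x /Aab[k _ xk] <-].
  by exists k => //; exists x.
apply: le_trans (lebesgue_outer_sigma_subadditive _) _.
by apply: lee_nneseries => [k _ _|k _]; [exact: lebesgue_outer_ge0|exact: fbox].
Qed.

Lemma homothety_volume_le s z A : 0 < s ->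
  (mu ((fun x => (s *: x + z)%R) @` A) <= (s ^+ d)%:E * mu A)%E.
Proof.
move=> s0; apply: lebesgue_outer_image_le; first by rewrite exprn_gt0.
move=> a b ab.
have -> : s ^+ d * box_volume a b = box_volume (s *: a + z) (s *: b + z).
  have -> : s ^+ d = \prod_(i < d) s by rewrite prodr_const card_ord.
  rewrite /box_volume -big_split/=.
  by apply: eq_bigr => i _; rewrite !mxE; ring.
apply: lebesgue_outer_le_box => [i|_ [x abx <-] i].
  by rewrite !mxE lerD2r ler_pM2l.
by rewrite !mxE !lerD2r !ler_pM2l.
Qed.

Lemma homothety_volume s z A : 0 < s ->
  mu ((fun x => (s *: x + z)%R) @` A) = ((s ^+ d)%:E * mu A)%E.
Proof.
move=> s0; apply/eqP; rewrite eq_le homothety_volume_le//=.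
have := homothety_volume_le (- (s^-1 *: z)) ((fun x => s *: x + z) @` A) (s := s^-1).
rewrite invr_gt0 => /(_ s0); rewrite image_comp (_ : _ \o _ = id); last first.
  apply/funext => x /=; rewrite scalerDr scalerA mulVf ?gt_eqF// scale1r addrK //.
by rewrite image_id exprVn lee_pdivlMl ?exprn_gt0.
Qed.

Let cube s z : set 'rV[R]_d := [set x | forall i, z 0 i <= x 0 i <= z 0 i + s].

(** The image of a cube under [f] is a homothetic copy of the image of the unit
    cube, because [f] is affine. *)
Let cube_volume f c s z : 0 < c -> similitude f c -> 0 < s ->
  mu (f @` cube s z) = ((s ^+ d)%:E * mu (f @` cube 1 0))%E.
Proof.
move=> c0 fc s0; have [M [_ _ fM]] := similitude_affine c0 fc.
rewrite -(homothety_volume (z *m M + f 0 - s *: f 0) _ s0) image_comp.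
congr (mu _).
have e x : f (s *: x + z) = s *: f x + (z *m M + f 0 - s *: f 0).
  rewrite (fM (_ + z)) (fM x) mulmxDl -scalemxAl scalerDr.
  by rewrite -!addrA; congr (_ + _); rewrite [RHS]addrCA; congr (_ + _); rewrite [RHS]addrC subrK.
apply/seteqP; split=> [_ [x xz <-]|_ [x x01 <-]] /=.
  exists (s^-1 *: (x - z)); last by rewrite -e scalerA divff ?gt_eqF// scale1r subrK.
  move=> i; have := xz i; rewrite !mxE add0r => /andP[x1 x2].
  rewrite mulr_ge0 ?invr_ge0 ?(ltW s0)//= ?subr_ge0//.
  by rewrite mulrC ler_pdivrMr//; lra.
exists (s *: x + z) => // i; rewrite !mxE; have := x01 i; rewrite mxE add0r => /andP[x1 x2].
by rewrite lerDr mulr_ge0 ?(ltW s0)//= addrC lerD2l -[leRHS]mulr1 ler_pM2l.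
Qed.

Let cube_volume_fin f c : 0 < c -> similitude f c -> mu (f @` cube 1 0) \is a fin_num.
Proof.
move=> c0 fc; rewrite ge0_fin_numE ?lebesgue_outer_ge0//.
pose u : 'rV[R]_d := const_mx (c * d%:R).
have : (mu (f @` cube 1 0) <= (box_volume (f 0 - u) (f 0 + u))%:E)%E.
  apply: lebesgue_outer_le_box => [i|_ [x x01 <-] i].
    by have cd : 0 <= c * d%:R; [rewrite mulr_ge0// ltW|rewrite !mxE; lra].
  rewrite !mxE -ler_distlC; apply: le_trans (coord_le_edist _ _ _) _.
  rewrite fc ler_pM2l// -[leRHS]mulr1; apply: edist_le_coord => j.
  by have := x01 j; rewrite !mxE add0r distrC subr0 => /andP[x1 x2]; rewrite ger0_norm.
by move/le_lt_trans; apply; rewrite ltry.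
Qed.

(** A grid of cubes of side [s] covers the box with a total volume that tends to
    that of the box as [s] tends to [0]. *)
Let box_image_le f c a b : 0 < c -> similitude f c -> (forall i, a 0 i <= b 0 i) ->
  (mu (f @` box a b) <= (fine (mu (f @` cube 1 0)) * box_volume a b)%:E)%E.
Proof.
move=> c0 fc ab; set K := fine _.
have K0 : 0 <= K by rewrite fine_ge0// lebesgue_outer_ge0.
have KE s z : 0 < s -> mu (f @` cube s z) = (s ^+ d * K)%:E.
  by move=> s0; rewrite (cube_volume z c0 fc s0) EFinM fineK// (cube_volume_fin c0 fc).
have ba i : 0 <= (b - a) 0 i by rewrite !mxE subr_ge0.
have [C C0 CP] := prod_shift_le ba.
have small s : 0 < s -> (mu (f @` box a b) <= (K * \prod_(i < d) ((b - a) 0 i + s))%:E)%E.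
  move=> s0; pose m (i : 'I_d) := (Num.truncn ((b - a) 0 i / s)).+1.
  pose N := (\max_i m i).+1.
  pose F (i : 'I_d) : pred 'I_N := [pred j : 'I_N | (j < m i)%N].
  pose z (k : {ffun 'I_d -> 'I_N}) : 'rV[R]_d := a + s *: \row_i (k i)%:R.
  apply: (@le_trans _ _ (mu (\big[setU/set0]_(k in family F) (f @` cube s (z k))))).
    apply: le_lebesgue_outer_set => _ [x xab <-].
    have q0 i : 0 <= (x 0 i - a 0 i) / s.
      by rewrite divr_ge0// ?(ltW s0)// subr_ge0; have /andP[] := xab i.
    have km i : (Num.truncn ((x 0 i - a 0 i) / s)%R < m i)%N.
      rewrite ltnS; apply: le_truncn.
      by rewrite ler_pM2r ?invr_gt0// !mxE lerD2r; have /andP[] := xab i.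
    have kN i : (Num.truncn ((x 0 i - a 0 i) / s)%R < N)%N.
      by rewrite ltnS; apply: leq_trans (ltnW (km i)) _; exact: leq_bigmax.
    pose k : {ffun 'I_d -> 'I_N} := [ffun i => Ordinal (kN i)].
    have kF : k \in family F by apply/familyP => i; rewrite ffunE inE /=.
    rewrite (bigD1 k)//=; left; exists x => // i.
    rewrite !mxE ffunE /=; have := truncn_itv (q0 i) => /andP[t1 t2].
    rewrite ler_pdivlMr// in t1; rewrite ltr_pdivrMr// -natr1 mulrDl mul1r in t2.
    by apply/andP; lra.
  apply: le_trans (outer_measure_bigsetU _ _ _) _.
  rewrite (eq_bigr (fun=> (s ^+ d * K)%:E)) => [|k _]; last exact: KE.
  rewrite sumEFin lee_fin -mulr_suml mulrC ler_wpM2l//.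
  have -> : s ^+ d = \prod_(i < d) s by rewrite prodr_const card_ord.
  rewrite -(bigA_distr_big_dep _ (fun i j => s)); apply: ler_prod => i _.
  rewrite sumr_ge0 => [/=|j _]; last exact: ltW.
  have -> : \sum_(j in F i) s = \sum_(j < m i) s.
    rewrite [RHS](big_ord_widen N (fun=> s))//.
    by apply: leqW; exact: leq_bigmax.
  rewrite sumr_const card_ord -[_ *+ _]mulr_natl /m -natr1 mulrDl mul1r lerD2r.
  have q0 : 0 <= (b - a) 0 i / s.
    by rewrite divr_ge0// ?(ltW s0)// !mxE subr_ge0.
  by have /andP[] := truncn_itv q0; rewrite ler_pdivlMr.
apply/lee_addgt0Pr => e e0.
have KC0 : 0 < K * C + 1 by rewrite ltr_wpDl// mulr_ge0.
pose s := Num.min 1 (e / (K * C + 1)).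
have s0 : 0 < s by rewrite lt_min ltr01 divr_gt0.
have s1 : s <= 1 by rewrite ge_min lexx.
apply: le_trans (small s s0) _; rewrite -EFinD lee_fin.
have -> : box_volume a b = \prod_(i < d) (b - a) 0 i.
  by apply: eq_bigr => i _; rewrite !mxE.
have h := CP s; rewrite (ltW s0) s1 in h.
apply: (le_trans (ler_wpM2l K0 (h isT))); rewrite mulrDr lerD2l.
have : s * (K * C + 1) <= e by rewrite -ler_pdivlMr// ge_min lexx orbT.
by rewrite mulrDr mulr1; lra.
Qed.

(** Let [K] be the volume of the image of the unit cube: the image of any set has
    at most [K] times its volume, with equality for cubes.  A ball [B] in a cube
    [Q] is mapped into a ball whose volume is [c ^+ d] times that of [B], and so
    [K * mu Q <= c ^+ d * mu B + K * mu (Q `\` B)], which gives [K <= c ^+ d]. *)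
Lemma similitude_volume_le f c A : 0 < c -> similitude f c ->
  (mu (f @` A) <= (c ^+ d)%:E * mu A)%E.
Proof.
move=> c0 fc; set K := fine (mu (f @` cube 1 0)).
have K0 : 0 <= K by rewrite fine_ge0// lebesgue_outer_ge0.
have KE s z : 0 < s -> mu (f @` cube s z) = (s ^+ d * K)%:E.
  by move=> s0; rewrite (cube_volume z c0 fc s0) EFinM fineK// (cube_volume_fin c0 fc).
have le e B : 0 < e -> (mu (f @` B) <= (K + e)%:E * mu B)%E.
  move=> e0; apply: lebesgue_outer_image_le => [|a b ab]; first by rewrite ltr_wpDl.
  apply: le_trans (box_image_le c0 fc ab) _; rewrite lee_fin ler_wpM2r ?box_volume_ge0//.
  by rewrite lerDl ltW.
pose B : set 'rV[R]_d := [set x | edist 0 x < 1].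
pose Q := cube 2 (const_mx (- 1)).
have QE : mu Q = (2 ^+ d)%:E.
  have -> : Q = box (const_mx (- 1)) (const_mx 1).
    by apply/seteqP; split=> x xQ i; have := xQ i; rewrite !mxE => /andP[]; [move=> -> | move=> ->]; lra.
  rewrite lebesgue_outer_box => [|i]; last by rewrite !mxE; lra.
  congr (_%:E); rewrite /box_volume (eq_bigr (fun=> 2)) => [|i _]; last by rewrite !mxE; lra.
  by rewrite prodr_const card_ord.
have BQ : B `<=` Q.
  move=> x /= xB i; have := coord_le_edist 0 x i; rewrite !mxE distrC subr0 ler_norml => /andP[x1 x2].
  by rewrite /B /= in xB; apply/andP; lra.
have mB : mu.-caratheodory B by exact/open_caratheodory/edist_ball_open.
have split : mu Q = (mu B + mu (Q `\` B))%E.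
  by rewrite (mB Q) setIidr// setDE.
have finB : mu B \is a fin_num.
  rewrite ge0_fin_numE ?lebesgue_outer_ge0//.
  by apply: le_lt_trans (le_lebesgue_outer_set BQ) _; rewrite QE ltry.
have finD : mu (Q `\` B) \is a fin_num.
  rewrite ge0_fin_numE ?lebesgue_outer_ge0//.
  by apply: le_lt_trans (le_lebesgue_outer_set _) _; [exact: subDsetl|rewrite QE ltry].
have p0 : 0 < fine (mu B).
  have dd : 0 < d%:R^-1 * 2^-1 :> R by rewrite mulr_gt0// invr_gt0.
  rewrite -lte_fin fineK//; apply: (@lt_le_trans _ _ (mu (cube (d%:R^-1 * 2^-1) 0))).
    have -> : cube (d%:R^-1 * 2^-1) 0 = box 0 (const_mx (d%:R^-1 * 2^-1)).
      by apply/seteqP; split=> x xQ i; have := xQ i; rewrite !mxE add0r.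
    rewrite lebesgue_outer_box => [|i]; last by rewrite !mxE ltW.
    by rewrite lte_fin; apply: prodr_gt0 => i _; rewrite !mxE subr0.
  apply: le_lebesgue_outer_set => x xQ; rewrite /B /=.
  apply: (@le_lt_trans _ _ (d%:R * (d%:R^-1 * 2^-1))); last first.
    by rewrite mulrA divff// mul1r invf_lt1// ltr1n.
  apply: edist_le_coord => i; have := xQ i; rewrite !mxE add0r distrC subr0 => /andP[x1 x2].
  by rewrite ger0_norm.
(* [f @` B] is a ball of radius [c], hence a homothetic image of [B]. *)
have fB : (mu (f @` B) <= (c ^+ d)%:E * mu B)%E.
  apply: (@le_trans _ _ (mu ((fun x => (c *: x + f 0)%R) @` B))).
    apply: le_lebesgue_outer_set => _ [x xB <-].
    exists (c^-1 *: (f x - f 0)); last by rewrite scalerA divff ?gt_eqF// scale1r subrK.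
    rewrite /B /= -[X in edist X](scaler0 _ c^-1) edistZ gtr0_norm ?invr_gt0//.
    rewrite -(edistDr (f 0)) add0r subrK fc mulrA mulVf ?gt_eqF// mul1r //.
  exact: homothety_volume_le.
suff Kc : K <= c ^+ d.
  have [Aoo|] := eqVneq (mu A) +oo%E.
    by rewrite Aoo gt0_muley ?leey// lte_fin exprn_gt0.
  rewrite -ltey => Afin; have finA : mu A \is a fin_num.
    by rewrite ge0_fin_numE ?lebesgue_outer_ge0.
  have v0 : 0 <= fine (mu A) by rewrite fine_ge0// lebesgue_outer_ge0.
  apply/lee_addgt0Pr => e e0.
  have e'0 : 0 < e / (fine (mu A) + 1) by rewrite divr_gt0// ltr_wpDl.
  apply: le_trans (le _ A e'0) _.
  rewrite -(fineK finA) -!EFinM -EFinD lee_fin mulrDl lerD ?ler_wpM2r//.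
  by rewrite mulrAC ler_pdivrMr ?ltr_wpDl// mulrDr mulr1 lerDl ltW.
rewrite -(ler_pM2r p0); apply/ler_addgt0Pr => e e0.
set p := fine (mu B) in p0 *; pose q := fine (mu (Q `\` B)).
have q0 : 0 <= q by rewrite fine_ge0// lebesgue_outer_ge0.
have pq : 2 ^+ d = p + q.
  by apply: EFin_inj; rewrite -QE split EFinD !fineK.
have e'0 : 0 < e / (q + 1) by rewrite divr_gt0// ltr_wpDl.
have : ((2 ^+ d * K)%:E <= (c ^+ d * p + (K + e / (q + 1)) * q)%:E)%E.
  rewrite -(KE 2 (const_mx (- 1))) //.
  apply: (@le_trans _ _ (mu (f @` B) + mu (f @` (Q `\` B)))%E).
    apply: le_trans (outer_measureU2 mu _ _); apply: le_lebesgue_outer_set.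
    move=> _ [x xQ <-]; have [xB|xB] := pselect (B x); [left|right]; exists x => //.
  rewrite EFinD !EFinM (fineK finB) (fineK finD) leeD//; exact: le.
rewrite lee_fin pq => h.
have : e / (q + 1) * q <= e.
  by rewrite mulrAC ler_pdivrMr ?ltr_wpDl// mulrDr mulr1 lerDl ltW.
by nra.
Qed.

(** The upper bound applies to the inverse similitude as well. *)
Lemma similitude_volume f c A : 0 < c -> similitude f c ->
  mu (f @` A) = ((c ^+ d)%:E * mu A)%E.
Proof.
move=> c0 fc; apply/eqP; rewrite eq_le similitude_volume_le//=.
have [f' [f'c fK _]] := similitude_inverse c0 fc.
have := similitude_volume_le (f @` A) _ f'c.
rewrite invr_gt0 image_comp (_ : f' \o f = id); last by apply/funext => x /=; exact: fK.
by rewrite image_id exprVn lee_pdivlMl ?exprn_gt0//; apply.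
Qed.

End similitude_volume.

(** * Real-valued volume *)

Section volume_theory.
Context {R : realType} {n : nat}.
Local Notation d := n.+1.
Local Notation mu := (@lebesgue_outer R d).
Local Notation volume := (@Defs.volume R d).
Implicit Types (x : 'rV[R]_d) (A B E N : set 'rV[R]_d).

Lemma volume_ge0 A : 0 <= volume A.
Proof. by rewrite fine_ge0// lebesgue_outer_ge0. Qed.

Lemma bounded_volume_fin A : bounded_set A -> mu A \is a fin_num.
Proof.
move=> /bounded_edistP[M M0 AM]; rewrite ge0_fin_numE ?lebesgue_outer_ge0//.
have : (mu A <= (box_volume (const_mx (- M)) (const_mx M : 'rV[R]_d))%:E)%E.
  apply: lebesgue_outer_le_box => [i|x /AM xM i]; first by rewrite !mxE; lra.
  have := coord_le_edist 0 x i; rewrite !mxE distrC subr0 ler_norml => /andP[x1 x2].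
  by apply/andP; lra.
by move/le_lt_trans; apply; rewrite ltry.
Qed.

Lemma bounded_subset A B : A `<=` B -> bounded_set B -> bounded_set A.
Proof.
move=> AB /bounded_edistP[M M0 BM]; apply/bounded_edistP; exists M => // x /AB.
exact: BM.
Qed.

Lemma bounded_setU A B : bounded_set A -> bounded_set B -> bounded_set (A `|` B).
Proof.
move=> /bounded_edistP[M M0 AM] /bounded_edistP[K K0 BK].
by apply/bounded_edistP; exists (M + K); [lra|move=> x [/AM|/BK]; lra].
Qed.

Lemma le_volume A B : bounded_set B -> A `<=` B -> volume A <= volume B.
Proof.
move=> bB AB; apply: fine_le; rewrite ?bounded_volume_fin//.
  exact: bounded_subset bB.
exact: le_lebesgue_outer_set.
Qed.

Lemma volumeID A E : bounded_set A -> mu.-caratheodory E ->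
  volume A = volume (A `&` E) + volume (A `\` E).
Proof.
move=> bA mE; rewrite /Defs.volume (mE A) -setDE fineD// bounded_volume_fin//.
  by apply: bounded_subset bA; exact: subIsetl.
by apply: bounded_subset bA; exact: subDsetl.
Qed.

Lemma volumeU_le A B : bounded_set A -> bounded_set B ->
  volume (A `|` B) <= volume A + volume B.
Proof.
move=> bA bB; rewrite -fineD ?bounded_volume_fin//.
apply: fine_le; first exact/bounded_volume_fin/bounded_setU.
  by rewrite fin_numD !bounded_volume_fin.
exact: (outer_measureU2 mu).
Qed.

Lemma volume_eq_mod_null A B N : bounded_set A -> bounded_set N -> volume N = 0 ->
  A `<=` B -> B `<=` A `|` N -> volume B = volume A.
Proof.
move=> bA bN N0 AB BAN; have bB := bounded_subset BAN (bounded_setU bA bN).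
apply/le_anti/andP; split; last exact: le_volume.
apply: le_trans (le_volume (bounded_setU bA bN) BAN) _.
by apply: le_trans (volumeU_le bA bN) _; rewrite N0 addr0.
Qed.

Lemma volume0 : volume set0 = 0.
Proof. by rewrite /Defs.volume lebesgue_outer0. Qed.

(** Each piece is measurable, being open, so it splits the volume of whatever the
    remaining pieces cover; induction on the pieces. *)
Lemma volume_bigcup_open (I : finType) (E : I -> set 'rV[R]_d) A :
  bounded_set A -> (forall i, open (E i)) -> trivIset setT E ->
  A `<=` \bigcup_i E i -> volume A = \sum_i volume (A `&` E i).
Proof.
move=> bA oE /trivIsetP tE AE.
suff h (s : seq I) : uniq s ->
    volume (A `&` [set x | exists2 i, i \in s & E i x]) =
    \sum_(i <- s) volume (A `&` E i).
  rewrite -(h _ (index_enum_uniq I)); congr Defs.volume.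
  apply/seteqP; split=> [x Ax|x []//]; split=> //.
  by have [i _ Eix] := AE x Ax; exists i; rewrite ?mem_index_enum.
elim: s => [_|i s IH /= /andP[si us]].
  by rewrite big_nil [X in volume X](_ : _ = set0) ?volume0// -subset0 => x [_ []].
rewrite big_cons -IH//; set B := _ `&` _.
have bB : bounded_set B by apply: bounded_subset bA => x [].
rewrite (volumeID bB (open_caratheodory (oE i))); congr (volume _ + volume _).
  apply/seteqP; split=> x; first by move=> [[Ax _] Eix].
  by move=> [Ax Eix]; split=> //; split=> //; exists i; rewrite ?mem_head.
apply/seteqP; split=> x.
  move=> [[Ax [j]]]; rewrite inE => /predU1P[-> //|js Ejx] Eix.
  by split=> //; exists j.
move=> [Ax [j js Ejx]]; split.
  by split=> //; exists j => //; rewrite inE js orbT.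
move=> Eix; have /negP ji : i != j by apply: contraNneq si => ->.
have := tE i j Logic.I Logic.I; move/negP: ji => -> /(_ isT).
by rewrite -subset0 => /(_ x); apply.
Qed.

Lemma volume_open_gt0 A : open A -> bounded_set A -> A !=set0 -> 0 < volume A.
Proof.
rewrite openE => oA bA [x /oA /interior_edistP[e e0 eA]].
pose s := d%:R^-1 * (e / 2).
have s0 : 0 < s by rewrite mulr_gt0// ?invr_gt0// divr_gt0.
pose b := x + const_mx s.
have xb i : x 0 i <= b 0 i by rewrite !mxE; lra.
apply: (@lt_le_trans _ _ (volume (box x b))).
  rewrite /Defs.volume lebesgue_outer_box//=; apply: prodr_gt0 => i _.
  by rewrite !mxE; lra.
apply: le_volume => // y xyb; apply: eA.
apply: (@le_lt_trans _ _ (d%:R * s)); last by rewrite mulrA divff// mul1r; lra.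
apply: edist_le_coord => i; have := xyb i; rewrite !mxE distrC => /andP[x1 x2].
by rewrite ger0_norm; lra.
Qed.

Lemma volume_similitude f c A : 0 < c -> similitude f c ->
  volume (f @` A) = c ^+ d * volume A.
Proof.
move=> c0 fc; rewrite /Defs.volume (similitude_volume _ c0 fc).
case: (mu A) (lebesgue_outer_ge0 A) => [v| |] //= _.
by rewrite gt0_muley ?mulr0// lte_fin exprn_gt0.
Qed.

Lemma bounded_similitude_image f c A : similitude f c ->
  bounded_set A -> bounded_set (f @` A).
Proof.
move=> fc /bounded_edistP[M M0 AM]; apply/bounded_edistP.
exists (edist 0 (f 0) + `|c| * M + 1).
  by have := mulr_ge0 (normr_ge0 c) (ltW M0); have := euclid_ge0 0 (f 0); lra.
move=> _ [x Ax <-]; apply: le_trans (euclid_triangle (f 0) _ _) _.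
rewrite fc -addrA lerD2l; apply: (@le_trans _ _ (`|c| * M)); last by rewrite lerDl.
apply: (@le_trans _ _ (`|c| * edist 0 x)); first by rewrite ler_wpM2r ?euclid_ge0// ler_norm.
by rewrite ler_wpM2l// AM.
Qed.

End volume_theory.

(** * Convex hulls *)

Section convexity.
Context {R : realType} {d : nat}.
Implicit Types (x y : 'rV[R]_d) (A : set 'rV[R]_d) (t : R).

Lemma convex_setP A : @convex_set R 'rV[R]_d A <->
  (forall x y t, 0 <= t <= 1 -> A x -> A y -> A (t *: x + (1 - t) *: y)).
Proof.
split=> [cA x y t t01 Ax Ay|h x y t /set_mem Ax /set_mem Ay].
  have := cA x y (Itv01 (proj1 (andP t01)) (proj2 (andP t01))) (mem_set Ax) (mem_set Ay).
  by move/set_mem.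
by apply: mem_set; apply: (h x y t%:num) => //; apply/andP; split.
Qed.

Lemma convex_hull_convex A : @convex_set R 'rV[R]_d (convex_hull A).
Proof.
apply/convex_setP => x y t t01 Ax Ay B [cB AB].
by apply: (proj1 (convex_setP B)) => //; [exact: Ax|exact: Ay].
Qed.

Lemma edist0Z t x : edist 0 (t *: x) = `|t| * edist 0 x.
Proof. by rewrite -edistZ scaler0. Qed.

Lemma edist_addl x y : edist x (x + y) = edist 0 y.
Proof. by rewrite -{1}(add0r x) (addrC x) edistDr. Qed.

Lemma edist0D x y : edist 0 (x + y) <= edist 0 x + edist 0 y.
Proof.
apply: le_trans (euclid_triangle x _ _) _.
by rewrite -{2}(add0r x) (addrC x) edistDr.
Qed.

Lemma convex_hull_bounded A : bounded_set A -> bounded_set (convex_hull A).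
Proof.
move=> /bounded_edistP[M M0 AM]; apply/bounded_edistP; exists M => //.
move=> x /(_ [set y | edist 0 y <= M]); apply; split=> //; apply/convex_setP => y z t /andP[t0 t1] yM zM /=.
apply: le_trans (edist0D _ _) _; rewrite !edist0Z !ger0_norm ?subr_ge0//.
have t1' : 0 <= 1 - t by rewrite subr_ge0.
by have := ler_wpM2l t0 yM; have := ler_wpM2l t1' zM; lra.
Qed.

End convexity.

(** * The tube of the fractal and its recursion *)

Section boundary_crossing.
Context {R : realType} {d : nat}.
Implicit Types (x y z : 'rV[R]_d) (A : set 'rV[R]_d).

(** Take the point of the segment from [x] to [y] at the supremum of the
    parameters whose points lie in [A]: it is a limit of points of [A], and
    openness keeps it out of [A]. *)
Lemma boundary_crossing A x y : open A -> A x -> ~ A y ->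
  exists2 z, closure A z /\ ~ A z & edist x z <= edist x y.
Proof.
move=> oA Ax nAy; pose p t := x + t *: (y - x).
pose S := [set t | 0 <= t <= 1 /\ A (p t)].
have dp s t : edist (p s) (p t) = `|s - t| * edist 0 (y - x).
  rewrite /p [x + _]addrC [x + t *: _]addrC edistDr.
  rewrite -{1}(subrK t s) scalerDl -{2}(add0r (t *: _)) edistDr edistC.
  by rewrite edist0Z.
have exy : edist 0 (y - x) = edist x y by rewrite -(edistDr x) add0r subrK.
have p0 : p 0 = x by rewrite /p scale0r addr0.
have S0 : S 0 by rewrite /S /= p0 lexx ler01.
have hS : has_sup S by split; [exists 0 | exists 1 => t [/andP[]]].
set t0 := sup S; have t00 : 0 <= t0 by apply: sup_ubound => //; case: hS.
have t01 : t0 <= 1 by apply: sup_le_ub; [exists 0|move=> t [/andP[]]].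
have M0 : 0 < edist 0 (y - x) + 1 by rewrite ltr_wpDl// euclid_ge0.
exists (p t0); last first.
  rewrite -{1}p0 dp sub0r normrN ger0_norm// exy ler_piMl//; exact: euclid_ge0.
split.
  apply/closure_edistP => e e0.
  have eM : 0 < e / (edist 0 (y - x) + 1) by rewrite divr_gt0.
  have [t St te] := sup_adherent eM hS.
  exists (p t); first by case: St.
  have tt0 : t <= t0 by apply: sup_ubound => //; case: hS.
  rewrite dp ger0_norm ?subr_ge0//.
  apply: (@le_lt_trans _ _ ((t0 - t) * (edist 0 (y - x) + 1))).
    by rewrite ler_wpM2l ?subr_ge0// lerDl.
  by rewrite -ltr_pdivlMr// -/t0 in te *; lra.
move=> Apt0; have t0lt1 : t0 < 1.
  rewrite lt_neqAle t01 andbT; apply/eqP => t1; apply: nAy.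
  by move: Apt0; rewrite t1 /p scale1r addrC subrK.
have /nbhs_edistP[e e0 eA] : nbhs (p t0) A by move: oA; rewrite openE; apply.
pose h := Num.min (1 - t0) (e / 2 / (edist 0 (y - x) + 1)).
have h0 : 0 < h by rewrite lt_min subr_gt0 t0lt1 !divr_gt0.
have h1 : h <= 1 - t0 by rewrite ge_min lexx.
have : S (t0 + h).
  split; first by apply/andP; lra.
  apply: eA; rewrite dp opprD addNKr normrN gtr0_norm//.
  have : h * (edist 0 (y - x) + 1) <= e / 2 by rewrite -ler_pdivlMr// ge_min lexx orbT.
  by rewrite mulrDr mulr1; lra.
move/(sup_ubound (proj2 hS)); rewrite -/t0; lra.
Qed.

End boundary_crossing.

Section fractal_geometry.
Context {R : realType} {n J : nat}.
Local Notation d := n.+1.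
Local Notation volume := (@Defs.volume R d).
Local Notation neighborhood := (@Defs.neighborhood R d).
Variables (phi : 'I_J -> 'rV[R]_d -> 'rV[R]_d) (r : 'I_J -> R) (F : set 'rV[R]_d).
Local Notation C := (convex_hull F).
Local Notation G := (C `\` hutchinson phi C).
Hypotheses (r01 : forall j, 0 < r j < 1)
  (simi : forall j, similitude (phi j) (r j))
  (F0 : F !=set0) (cptF : compact F) (FE : F = hutchinson phi F)
  (TSC : tileset_condition phi C) (NTC : nontriviality_condition phi C)
  (PWC : pearse_winter_condition C F) (oG : open G).

Implicit Types (x y z : 'rV[R]_d) (e : R) (j : 'I_J).

Let r0 j : 0 < r j. Proof. by have /andP[] := r01 j. Qed.

Let tile_sub j : phi j @` C° `<=` C°. Proof. by have [_] := TSC; apply. Qed.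

Let tile_disjoint : trivIset [set: 'I_J] (fun j => phi j @` C°).
Proof. by have [] := TSC. Qed.

Let bF : bounded_set F. Proof. exact: compact_bounded. Qed.

Lemma hull_bounded : bounded_set C. Proof. exact: convex_hull_bounded. Qed.

Lemma sub_hull : F `<=` C. Proof. exact: sub_gen_smallest. Qed.

Lemma closed_hull x : closure C x -> C x.
Proof.
move=> cx; have [/interior_subset//|nx] := pselect (C° x).
by apply: sub_hull; apply: PWC.
Qed.

Lemma hullE x : C x -> C° x \/ F x.
Proof.
move=> Cx; have [|nx] := pselect (C° x); first by left.
by right; apply: PWC; split=> //; exact: subset_closure.
Qed.

Lemma hull_conv x y t : 0 <= t <= 1 -> C x -> C y -> C (t *: x + (1 - t) *: y).
Proof. by move=> t01 Cx Cy; have /convex_setP := @convex_hull_convex _ _ F; apply. Qed.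

Lemma interior_hull_nonempty : exists x : 'rV[R]_d, (C°) x.
Proof.
apply: contrapT => h; apply: NTC => x Cx.
by exfalso; apply: h; exists x.
Qed.

(** Moving the point slightly towards a fixed interior point makes it interior,
    by convexity. *)
Lemma hull_closure_interior x : C x -> closure C° x.
Proof.
move=> Cx; have [c /[dup] Cc /interior_edistP[e e0 eC]] := interior_hull_nonempty.
apply/closure_edistP => k k0.
have M0 : 0 < edist x c + 1 by rewrite ltr_wpDl// euclid_ge0.
pose t := Num.min 1 (k / 2 / (edist x c + 1)).
have t0 : 0 < t by rewrite lt_min ltr01 !divr_gt0.
have t1 : t <= 1 by rewrite ge_min lexx.
have tE y : t *: y + (1 - t) *: x = x + t *: (y - x).
  by rewrite scalerBl scale1r scalerBr addrCA.
exists (t *: c + (1 - t) *: x).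
  apply/interior_edistP; exists (t * e); first by rewrite mulr_gt0.
  move=> y ye; pose z := c + t^-1 *: (y - (t *: c + (1 - t) *: x)).
  have Cz : C z.
    apply: eC; rewrite /z edist_addl edist0Z.
    rewrite gtr0_norm ?invr_gt0// mulrC ltr_pdivrMr// mulrC.
    by rewrite -(edistDr (t *: c + (1 - t) *: x)) add0r subrK.
  have -> : y = t *: z + (1 - t) *: x.
    by rewrite /z scalerDr scalerA divff ?gt_eqF// scale1r addrAC addrC subrK.
  by apply: hull_conv => //; rewrite (ltW t0).
rewrite tE edist_addl edist0Z gtr0_norm//.
rewrite -(edistDr x) add0r subrK edistC.
have : t * (edist x c + 1) <= k / 2 by rewrite -ler_pdivlMr// ge_min lexx orbT.
rewrite edistC mulrDr mulr1; lra.
Qed.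

Lemma phi_interior_open j : open (phi j @` C°).
Proof. by apply: similitude_image_open (r0 j) (simi j) _; exact: open_interior. Qed.

Lemma generator_interior : G `<=` C°.
Proof.
move=> x Gx; have : G° x by move: oG; rewrite openE; apply.
by apply: interiorS => y [].
Qed.

Lemma generator_tile_disjoint j x : G x -> ~ (phi j @` C°) x.
Proof.
move=> [_ nx] [y Cy yx]; apply: nx; exists j => //; exists y => //.
exact: interior_subset.
Qed.

Lemma generator_fractal_disjoint x : G x -> ~ F x.
Proof.
move=> [_ nx]; rewrite FE => -[j _ [y /sub_hull Cy yx]].
by apply: nx; exists j => //; exists y.
Qed.

(** A point outside the generator lies in some [phi j C], and [C] consists of its
    interior and of points of [F] by the boundary condition. *)
Lemma interior_hullE x : C x -> [\/ G x, exists j, (phi j @` C°) x | F x].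
Proof.
move=> Cx; have [[j _ [y /hullE[Cy|Fy] <-]]|nx] := pselect (hutchinson phi C x).
- by apply: Or32; exists j, y.
- by apply: Or33; rewrite FE; exists j => //; exists y.
- by apply: Or31.
Qed.

Lemma generator_nonempty : G !=set0.
Proof.
apply: contrapT => h; apply: NTC => x Cx; apply: contrapT => nx.
by apply: h; exists x; split=> //; exact: interior_subset.
Qed.

(** The point lies in some [phi k F], hence in the closure of the open tile [k];
    the open tiles being disjoint, this forces [k = j]. *)
Lemma fractal_in_tile j x : (phi j @` C°) x -> F x -> (phi j @` F) x.
Proof.
move=> tx; rewrite {1}FE => -[k _ [y Fy yx]].
have [jk|jk] := eqVneq k j; first by exists y; rewrite -?jk.
have : closure (phi k @` C°) x.
  rewrite -yx; apply: similitude_closure (r0 k) (simi k) _.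
  by apply: hull_closure_interior; exact: sub_hull.
have : nbhs x (phi j @` C°) by move: (@phi_interior_open j); rewrite openE; apply.
move=> /[swap] /[apply] -[z [zk zj]].
by have := @tile_disjoint k j Logic.I Logic.I (ex_intro _ z (conj zk zj)) => /eqP; rewrite (negbTE jk).
Qed.

(** The inverse similitude carries the boundary of the tile to that of the hull,
    which lies in [F]. *)
Lemma boundary_tile j z : closure (phi j @` C°) z -> ~ (phi j @` C°) z ->
  (phi j @` F) z.
Proof.
have [f' [f'c fK f'K]] := similitude_inverse (r0 j) (simi j).
move=> cz nz; exists (f' z); last exact: f'K.
apply: PWC; split.
  have rV0 : 0 < (r j)^-1 by rewrite invr_gt0.
  have := similitude_closure rV0 f'c cz.
  rewrite image_comp (_ : f' \o phi j = id); last by apply/funext => y /=; exact: fK.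
  by rewrite image_id; apply: closureS; exact: interior_subset.
by move=> Cz; apply: nz; exists (f' z).
Qed.

(** The point lies in the hull, which is closed, but not in an open tile, since
    such a tile is a neighborhood disjoint from the generator. *)
Lemma boundary_generator z : closure G z -> ~ G z -> F z.
Proof.
move=> cz nz; have Cz : C z.
  by apply: closed_hull; apply: closureS cz => y [].
have [//|[j tz]|//] := interior_hullE Cz.
have : nbhs z (phi j @` C°) by move: (@phi_interior_open j); rewrite openE; apply.
by move/cz => [y [Gy ty]]; have := generator_tile_disjoint Gy ty.
Qed.

(** Points of [F] outside the tile are never the nearest ones: a segment towards
    such a point leaves the tile through its boundary, which lies in [phi j F].
    Inside the tile the distance to [F] is thus the distance to [phi j F]. *)
Lemma set_dist_tile j x : C° x ->
  set_dist (phi j x) F = r j * set_dist x F.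
Proof.
move=> Cx; have tx : (phi j @` C°) (phi j x) by exists x.
apply/le_anti/andP; split.
  rewrite -ler_pdivrMl//; apply: le_set_dist => // y Fy.
  rewrite ler_pdivrMl// -simi; apply: set_dist_le; rewrite FE.
  by exists j => //; exists y.
suff h y : F y -> exists2 u, F u & edist (phi j x) (phi j u) <= edist (phi j x) y.
  apply: le_set_dist => // y /h[u Fu]; apply: le_trans.
  by rewrite simi ler_pM2l//; exact: set_dist_le.
move=> Fy; have [ty|ty] := pselect ((phi j @` C°) y).
  by have [u Fu <-] := fractal_in_tile ty Fy; exists u.
have [z [cz nz] le_z] := boundary_crossing (@phi_interior_open j) tx ty.
by have [u Fu uz] := boundary_tile cz nz; exists u; rewrite ?uz.
Qed.

(** A segment that leaves the generator meets [F] when it crosses the boundary. *)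
Lemma set_dist_generator x : G x -> set_dist x (~` G) = set_dist x F.
Proof.
move=> Gx; apply/le_anti/andP; split.
  apply: le_set_dist => // y Fy; apply: set_dist_le => Gy.
  exact: generator_fractal_disjoint Fy.
apply: le_set_dist => [|y nGy].
  by have [y Fy] := F0; exists y => Gy; exact: generator_fractal_disjoint Fy.
have [z [cz nz] le_z] := boundary_crossing oG Gx nGy.
by apply: le_trans le_z; apply: set_dist_le; exact: boundary_generator.
Qed.

Let hullD0 : bounded_set C°.
Proof. by apply: bounded_subset hull_bounded; exact: interior_subset. Qed.

Let generatorD0 : bounded_set G.
Proof. by apply: bounded_subset hull_bounded => x []. Qed.

Let simi_volume j A : volume (phi j @` A) = r j ^+ d * volume A.
Proof. exact: volume_similitude. Qed.

Lemma hull_volume_gt0 : 0 < volume C°.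
Proof.
by apply: volume_open_gt0 => //; [exact: open_interior|exact: interior_hull_nonempty].
Qed.

Lemma generator_volume_gt0 : 0 < volume G.
Proof. by apply: volume_open_gt0 => //; exact: generator_nonempty. Qed.

(** The generator, at the index [None], and the first-level tiles form one finite
    family of disjoint open sets. *)
Let piece (i : option 'I_J) : set 'rV[R]_d := if i is Some j then phi j @` C° else G.

Let piece_open i : open (piece i).
Proof. by case: i => [j|] //=; exact: phi_interior_open. Qed.

Let piece_disjoint : trivIset setT piece.
Proof.
move=> [j|] [k|] _ _ //= [x [xj xk]].
- by congr Some; apply: (@tile_disjoint j k) => //; exists x.
- by have := generator_tile_disjoint xk xj.
- by have := generator_tile_disjoint xj xk.
Qed.

Let volume_pieces A : bounded_set A -> A `<=` \bigcup_i piece i ->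
  volume A = volume (A `&` G) + \sum_j volume (A `&` phi j @` C°).
Proof.
move=> bA /(volume_bigcup_open bA piece_open piece_disjoint) ->.
rewrite (bigD1 None)//=; congr (_ + _).
rewrite (reindex_omap Some id) => [|[] //=].
by apply: eq_bigl => j /=; rewrite eqxx.
Qed.

(** The tiles and the generator are disjoint in the hull, and the generator has
    positive volume. *)
Lemma sum_ratio_lt1 : \sum_j r j ^+ d < 1.
Proof.
pose U := \bigcup_i piece i.
have UC : U `<=` C°.
  move=> x [[j|] _] /=; first exact: tile_sub.
  exact: generator_interior.
have bU := bounded_subset UC hullD0.
have := le_volume hullD0 UC; rewrite volume_pieces//.
have -> : U `&` G = G by apply/setIidPr => x Gx; exists None.
have e j : U `&` phi j @` C° = phi j @` C° by apply/setIidPr => x tx; exists (Some j).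
under eq_bigr do rewrite e simi_volume.
rewrite -mulr_suml => h; rewrite -(ltr_pM2r hull_volume_gt0) mul1r.
by have := generator_volume_gt0; lra.
Qed.

(** By self-similarity the volume of [F] is at most [\sum_j r j ^+ d < 1] times
    itself. *)
Lemma fractal_volume0 : volume F = 0.
Proof.
have h : volume F <= \sum_j r j ^+ d * volume F.
  have sub : F `<=` \big[setU/set0]_j (phi j @` F).
    rewrite {1}FE => x [j _ xj]; rewrite (bigD1 j)//=; by left.
  suff : forall s, bounded_set (\big[setU/set0]_(j <- s) (phi j @` F)) /\
     volume (\big[setU/set0]_(j <- s) (phi j @` F)) <= \sum_(j <- s) r j ^+ d * volume F.
    move=> /(_ (index_enum 'I_J))[b1 le1].
    exact: le_trans (le_volume b1 sub) le1.
  elim=> [|j s [b1 le1]]; first by rewrite !big_nil volume0; split=> //; exact: bounded_subset bF.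
  have bj : bounded_set (phi j @` F) by exact: bounded_similitude_image (simi j) bF.
  rewrite !big_cons; split; first exact: bounded_setU.
  apply: le_trans (volumeU_le bj b1) _.
  by rewrite simi_volume lerD2l.
rewrite -mulr_suml in h; have := sum_ratio_lt1; have := volume_ge0 F.
by move: h; set v := volume F; set q := \sum_j _; nra.
Qed.

(** Up to the null set [F] the pieces exhaust the hull. *)
Lemma hull_volumeE : volume C° = volume G + \sum_j r j ^+ d * volume C°.
Proof.
pose U := \bigcup_i piece i.
have UC : U `<=` C°.
  move=> x [[j|] _] /=; first exact: tile_sub.
  exact: generator_interior.
have bU := bounded_subset UC hullD0.
rewrite {1}(volume_eq_mod_null bU bF fractal_volume0 UC); last first.
  move=> x /interior_subset /interior_hullE[Gx|[j tx]|]; last by right.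
    by left; exists None.
  by left; exists (Some j).
rewrite volume_pieces//; congr (volume _ + _).
  by apply/setIidPr => x Gx; exists None.
apply: eq_bigr => j _; rewrite -simi_volume; congr (volume _).
by apply/setIidPr => x tx; exists (Some j).
Qed.

(** Only this part of the tube satisfies an exact recursion; what lies outside
    the hull is estimated in [tube_le]. *)
Definition inner_tube e : R := volume (neighborhood F e `&` C°).

(** Up to the null set [F] the inner tube splits along the pieces.  In the
    generator it is the inner neighborhood of the generator, by
    [set_dist_generator]; in the tile [j] it is the image of the inner tube of
    size [e / r j], by [set_dist_tile]. *)
Lemma inner_tube_rec e : inner_tube e =
  volume (inner_neighborhood G e) + \sum_j r j ^+ d * inner_tube (e / r j).
Proof.
rewrite /inner_tube; set A := _ `&` C°.
have bA : bounded_set A by apply: bounded_subset hullD0 => x [].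
pose U := \bigcup_i piece i.
have bAU : bounded_set (A `&` U) by apply: bounded_subset bA => x [].
rewrite (volume_eq_mod_null bAU bF fractal_volume0 (@subIsetl _ _ _)); last first.
  move=> x Ax; have [_ /interior_subset/interior_hullE[Gx|[j tx]|]] := Ax; last by right.
    by left; split=> //; exists None.
  by left; split=> //; exists (Some j).
rewrite volume_pieces => [||x []//]; last by [].
congr (_ + _); last first.
  apply: eq_bigr => j _; rewrite -simi_volume; congr (volume _).
  apply/seteqP; split=> [x [[[xF Cx] _] [y Cy yx]]|_ [y [yF Cy] <-]].
    exists y => //; split=> //; move: xF; rewrite /neighborhood /= -yx.
    by rewrite set_dist_tile// ler_pdivlMr// mulrC.
  have ty : (phi j @` C°) (phi j y) by exists y.
  split; last by [].
  split; last by exists (Some j).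
  split; last exact: (@tile_sub j).
  by move: yF; rewrite /neighborhood /= set_dist_tile// ler_pdivlMr// mulrC.
symmetry; apply: (volume_eq_mod_null _ bF fractal_volume0).
- by apply: bounded_subset bAU => x [].
- move=> x [[[xF Cx] _] Gx]; split; first exact: subset_closure.
  by rewrite /= set_dist_generator.
- move=> x [cx xG]; have [Gx|nGx] := pselect (G x); last by right; exact: boundary_generator.
  left; split=> //; split; last by exists None.
  split; last exact: generator_interior.
  by rewrite /neighborhood /= -set_dist_generator.
Qed.

Lemma neighborhood_bounded e : bounded_set (neighborhood F e).
Proof.
have /bounded_edistP[M M0 FM] := bF.
apply/bounded_edistP; exists (M + `|e| + 1); first by have := normr_ge0 e; lra.
move=> x xe; have [|y Fy xy] := @set_dist_lt _ _ F x (e + 1) F0.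
  by rewrite /neighborhood /= in xe; lra.
apply: le_trans (euclid_triangle y _ _) _; have := FM y Fy; have := ler_norm e.
by rewrite (edistC y x); lra.
Qed.

Lemma tube_nondecreasing : {homo tube_volume F : a b / a <= b}.
Proof.
move=> a b ab; apply: le_volume; first exact: neighborhood_bounded.
by move=> x; rewrite /neighborhood /=; lra.
Qed.

Lemma inner_tube_nondecreasing : {homo inner_tube : a b / a <= b}.
Proof.
move=> a b ab; apply: le_volume; first by apply: bounded_subset hullD0 => x [].
by move=> x [xa Cx]; split=> //; move: xa; rewrite /neighborhood /=; lra.
Qed.

Lemma inner_tube_le e : inner_tube e <= volume C°.
Proof. by apply: le_volume => // x []. Qed.

(** The [e]-neighborhood of the hull is contained in a homothetic copy of the hull
    with ratio [1 + O(e)], centered at an interior point, so its part outside the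
    hull has volume [O(e)]. *)
Lemma tube_le : exists2 K : R, 0 <= K & forall e, 0 < e <= 1 ->
  inner_tube e <= tube_volume F e <= inner_tube e + K * e.
Proof.
have [c0 /interior_edistP[rho rho0 rhoC]] := interior_hull_nonempty.
have ones0 (i : 'I_d) : 0 <= (1 : R) by [].
have [K K0 KP] := prod_shift_le ones0; clear ones0.
pose v := volume C°; have v0 : 0 < v := hull_volume_gt0.
pose e0 : R := rho / 2; have e00 : 0 < e0 by rewrite divr_gt0.
pose K' : R := K * v / e0 + tube_volume F 1 / e0.
have K'0 : 0 <= K' by rewrite addr_ge0// divr_ge0 ?mulr_ge0// ?(ltW e00) ?volume_ge0// ltW.
exists K' => // e /andP[ep e1].
have bN := @neighborhood_bounded e.
have mE : (@lebesgue_outer R d).-caratheodory C° by apply: open_caratheodory; exact: open_interior.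
have -> : tube_volume F e = inner_tube e + volume (neighborhood F e `\` C°).
  by rewrite /tube_volume (volumeID bN mE).
rewrite lerDl volume_ge0 lerD2l /=.
have [ee0|e0e] := leP e e0; last first.
  apply: (@le_trans _ _ (tube_volume F 1)).
    apply: le_trans (tube_nondecreasing e1); apply: le_volume => //.
  rewrite /K' mulrDl; set t := tube_volume F 1.
  have t0 : 0 <= t := volume_ge0 _.
  have : 0 <= K * v / e0 * e by rewrite mulr_ge0 ?divr_ge0 ?mulr_ge0// ltW.
  have : t <= t / e0 * e.
    by rewrite mulrAC ler_pdivlMr// ler_wpM2l// ltW.
  by move=> h1 h2; rewrite -[X in X <= _]add0r; exact: lerD.
have [l [l0 l1 lE]] : exists l : R, [/\ 0 < l, l <= 1 & e = l * e0].
  exists (e / e0); split; [exact: divr_gt0|by rewrite ler_pdivrMr// mul1r|].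
  by rewrite divfK// gt_eqF.
have l1' : 0 < 1 + l by lra.
pose f x := (1 + l) *: x + (- l) *: c0.
have fs : similitude f (1 + l) by apply: similitude_homothety; exact: ltW.
have fC x : (exists2 y, F y & edist x y < 2 * e) \/ C x -> (f @` C) x.
  move=> h; pose t := (1 + l)^-1.
  have t01 : 0 <= t <= 1.
    by rewrite invr_ge0 (ltW l1')/= invf_le1// lerDl ltW.
  have tl : 1 - t = t * l.
    by rewrite /t -{1}(mulVf (lt0r_neq0 l1')) -[X in _ - X]mulr1 -mulrBr addrAC subrr add0r.
  exists (t *: (x + l *: c0)); last first.
    rewrite /f scalerA divff ?gt_eqF// scale1r scaleNr addrK //.
  case: h => [[y Fy xy]|Cx]; last first.
    rewrite scalerDr scalerA -tl; apply: hull_conv => //.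
    by apply: rhoC; rewrite edistxx.
  have -> : t *: (x + l *: c0) = t *: y + (1 - t) *: (c0 + l^-1 *: (x - y)).
    rewrite tl -scalerA -scalerDr [l *: (_ + _)]scalerDr scalerA divff ?gt_eqF// scale1r.
    by rewrite addrCA addrC [y + _]addrC subrK.
  apply: hull_conv => //; first exact: sub_hull.
  apply: rhoC; rewrite edist_addl edist0Z gtr0_norm ?invr_gt0//.
  rewrite mulrC ltr_pdivrMr// -(edistDr y) add0r subrK edistC.
  have -> : rho * l = 2 * e by rewrite lE /e0; field.
  by [].
have bf : bounded_set (f @` C) by exact: bounded_similitude_image fs hull_bounded.
apply: (@le_trans _ _ (volume (f @` C `\` C°))).
  apply: le_volume; first by apply: bounded_subset bf => x [].
  move=> x [xe nCx]; split=> //; apply: fC; left.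
  by apply: set_dist_lt => //; rewrite /neighborhood /= in xe; lra.
have vC : volume C = v.
  apply: (volume_eq_mod_null _ bF fractal_volume0) => //.
    exact: interior_subset.
  by move=> x /hullE.
have := volumeID bf mE; rewrite (volume_similitude _ l1' fs) vC.
have -> : f @` C `&` C° = C°.
  by apply/setIidPr => x /interior_subset Cx; apply: fC; right.
rewrite -/v => h; have := KP l; rewrite (ltW l0) l1 => /(_ isT).
rewrite !prodr_const card_ord expr1n => h2.
have : (1 + l) ^+ d * v <= (1 + l * K) * v by rewrite ler_wpM2r// ltW.
have : 0 <= tube_volume F 1 / e0 * e.
  by rewrite mulr_ge0 ?divr_ge0 ?volume_ge0// ltW.
have -> : K' * e = l * K * v + tube_volume F 1 / e0 * e.
  by rewrite /K' mulrDl {1}lE; congr (_ + _); field; rewrite gt_eqF.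
by lra.
Qed.

(** The radii of balls in [G] must be shown to be bounded, as the supremum of an
    unbounded set is [0] by convention. *)
Lemma inradius_gt0 : 0 < inradius G.
Proof.
have [x Gx] := generator_nonempty.
have /nbhs_edistP[e e0 eG] : nbhs x G by move: oG; rewrite openE; apply.
have /bounded_edistP[M M0 GM] := generatorD0.
apply: (@lt_le_trans _ _ e) => //; apply: ub_le_sup; last by split=> //; exists x.
(* A ball of radius [k] in [G] contains two points at distance [k / 2], while
   points of [G] are at distance at most [2 * M]. *)
exists (4 * M) => k [k0 [y yG]]; rewrite leNgt; apply/negP => Mk.
have ey : edist 0 ((k / 2) *: (delta_mx 0 ord0 : 'rV[R]_d)) = k / 2.
  rewrite edist0Z gtr0_norm ?divr_gt0// edistE sub0r dotmulNl dotmulNr opprK.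
  rewrite dotmulE (bigD1 ord0)//= big1 => [|i i0]; last by rewrite !mxE (negbTE i0) andbF mul0r.
  by rewrite !mxE /= mul1r addr0 sqrtr1 mulr1.
have Gz : G (y + (k / 2) *: delta_mx 0 ord0).
  by apply: yG; rewrite /= edist_addl ey; lra.
have Gy : G y by apply: yG; rewrite /= edistxx.
have := euclid_triangle 0 y (y + (k / 2) *: delta_mx 0 ord0).
rewrite edist_addl ey (edistC y 0); have := GM _ Gz; have := GM _ Gy; lra.
Qed.

End fractal_geometry.

(** * Comparison with powers and Moran's equation *)

Lemma cvg_sumr (R : realType) (I : finType) (P : pred I) T (H : set_system T)
    (f : I -> T -> R) (l : I -> R) : Filter H ->
  (forall i, f i x @[x --> H] --> l i) ->
  \sum_(i | P i) f i x @[x --> H] --> \sum_(i | P i) l i.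
Proof. by move=> FH h; apply: cvg_big => // -[x y]; exact: add_continuous. Qed.

Section ratios.
Context {R : realType} {J : nat}.
Variable r : 'I_J -> R.
Hypothesis r01 : forall j, 0 < r j < 1.

Let r0 j : 0 < r j. Proof. by have /andP[] := r01 j. Qed.
Let r1 j : r j < 1. Proof. by have /andP[] := r01 j. Qed.

Lemma ratio_lower : exists2 rho : R, 0 < rho & forall j, rho <= r j.
Proof.
exists (\prod_j r j); first by apply: prodr_gt0.
move=> j; rewrite (bigD1 j)//= ler_piMr ?(ltW (r0 j))//.
by apply: prodr_ile1 => i _; rewrite !ltW.
Qed.

Lemma ratio_upper : exists2 lam : R, 0 < lam < 1 & forall j, r j <= lam.
Proof.
have [j0 _|none] := pickP (fun _ : 'I_J => true); last first.
  by exists 2^-1; [apply/andP; lra|move=> j; have := none j].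
have P0 : 0 < \prod_j (1 - r j) by apply: prodr_gt0 => i _; rewrite subr_gt0.
have h j : r j <= 1 - \prod_i (1 - r i).
  rewrite lerBrDl -lerBrDr (bigD1 j)//= ler_piMr ?subr_ge0 ?(ltW (r1 j))//.
  apply: prodr_ile1 => i _; rewrite subr_ge0 (ltW (r1 i))/=.
  by rewrite lerBlDr lerDl ltW.
exists (1 - \prod_j (1 - r j)) => //.
by have := h j0; have := r0 j0; move=> ? ?; apply/andP; lra.
Qed.

Lemma ratio_powR_mul (d : nat) (s e : R) j : 0 < e ->
  r j ^+ d * (e / r j) `^ (d%:R - s) = e `^ (d%:R - s) * r j `^ s.
Proof.
move=> e0; rewrite powRM ?(ltW e0) ?invr_ge0 ?(ltW (r0 j))//.
rewrite mulrCA; congr (_ * _); rewrite -powR_mulrn ?(ltW (r0 j))//.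
rewrite -powR_inv1 ?(ltW (r0 j))// -powRrM -powRD; last by rewrite (gt_eqF (r0 j)) implybT.
by congr (_ `^ _); ring.
Qed.

(** The recursion refers from a scale [e] to the larger scales [e / r j], so the
    sign of [X] on one fundamental range of scales propagates to all smaller
    ones. *)
Lemma recursion_comparison (d : nat) (g rho : R) (X : R -> R) :
  0 < rho -> (forall j, rho <= r j) -> 0 < g ->
  (forall e, 0 < e < g -> X e <= \sum_j r j ^+ d * X (e / r j)) ->
  (forall e, g <= e <= g / rho -> X e <= 0) ->
  forall e, 0 < e <= g / rho -> X e <= 0.
Proof.
move=> rho0 rhor g0 Xrec Xbase.
have [lam /andP[lam0 lam1] lamr] := ratio_upper.
have h k : forall e, g * lam ^+ k <= e <= g / rho -> X e <= 0.
  elim: k => [|k IH] e /andP[e1 e2].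
    by apply: Xbase; rewrite -[X in X <= e]mulr1 -(expr0 lam) e1.
  have [ge|eg] := leP g e; first by apply: Xbase; rewrite ge.
  have e0 : 0 < e by apply: lt_le_trans e1; rewrite mulr_gt0// exprn_gt0.
  apply: (le_trans (Xrec e _)); first by rewrite e0.
  rewrite -oppr_ge0 -sumrN sumr_ge0// => j _.
  rewrite oppr_ge0 pmulr_rle0 ?exprn_gt0//; apply: IH.
  rewrite ler_pdivlMr// ler_pdivrMr//; apply/andP; split.
    apply: le_trans e1; rewrite exprSr mulrA ler_pM2l ?mulr_gt0 ?exprn_gt0//.
  apply: (le_trans (ltW eg)); rewrite mulrAC ler_pdivlMr// ler_pM2l//.
move=> e /andP[e0 eg].
have [k _ ke] : exists2 k, true & lam ^+ k < e / g.
  have : lam ^+ k @[k --> \oo] --> 0 by apply: cvg_expr; rewrite gtr0_norm.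
  move/cvgrPdist_lt => /(_ (e / g)); rewrite divr_gt0// => /(_ isT)[N _ HN].
  by exists N => //; have := HN N (leqnn _); rewrite sub0r normrN gtr0_norm ?exprn_gt0.
apply: (h k); rewrite eg andbT mulrC -ler_pdivlMr//; exact: ltW.
Qed.

Lemma sum_ratio_powR_continuous : continuous (fun s : R => \sum_j r j `^ s).
Proof.
move=> s; apply: cvg_sumr => j.
rewrite /powR gt_eqF//; apply: continuous_comp; last exact: continuous_expR.
by apply: cvgM; [exact: cvg_id|exact: cvg_cst].
Qed.

Lemma sum_ratio_powR_decr : (0 < J)%N ->
  forall s t, s < t -> \sum_j r j `^ t < \sum_j r j `^ s.
Proof.
move=> J0 s t st; have lt j : r j `^ t < r j `^ s.
  rewrite /powR gt_eqF// ltr_expR ltr_nM2r//; apply: ln_lt0; exact: r01.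
rewrite (bigD1 (Ordinal J0))//= [ltRHS](bigD1 (Ordinal J0))//=.
by apply: ltr_leD => //; apply: ler_sum => j _; exact: ltW.
Qed.

End ratios.

(** The analytic content of the self-similarity of a tube: [W] is the volume of
    the part of the tube that lies in the hull, [VG] the volume of the inner
    tube of the generator, [v0] and [vG] the total volumes. *)
Record tube_recursion {R : realType} {J : nat} (d : nat) (r : 'I_J -> R)
    (kappa : nat -> R) (g v0 vG : R) (W VG : R -> R) : Prop := TubeRecursion {
  rec_index : (0 < J)%N;
  rec_ratio : forall j, 0 < r j < 1;
  rec_inradius : 0 < g;
  rec_hull : 0 < v0;
  rec_generator : 0 < vG;
  rec_nondecreasing : {homo W : a b / a <= b};
  rec_ge0 : forall e : R, 0 <= W e;
  rec_le : forall e : R, W e <= v0;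
  rec_tube : forall e : R, W e = VG e + \sum_j r j ^+ d * W (e / r j);
  rec_volume : v0 = vG + \sum_j r j ^+ d * v0;
  rec_generator_ge0 : forall e : R, 0 <= VG e;
  rec_generator_small : forall e : R, 0 < e < g ->
    VG e = \sum_(m < d) kappa m * e ^+ (d - m);
  rec_generator_large : forall e : R, g <= e -> VG e = vG;
  rec_contracting : \sum_j r j ^+ d < 1
}.

Section tube_recursion_theory.
Context {R : realType} {J d : nat}.
Variables (r : 'I_J -> R) (kappa : nat -> R) (g v0 vG : R) (W VG : R -> R).
Hypothesis H : tube_recursion d r kappa g v0 vG W VG.

Let J0 := rec_index H.
Let r01 := rec_ratio H.
Let g0 := rec_inradius H.
Let v00 := rec_hull H.
Let vG0 := rec_generator H.
Let W_ge0 := rec_ge0 H.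
Let W_le := rec_le H.
Let W_rec := rec_tube H.
Let v_rec := rec_volume H.
Let VG_ge0 := rec_generator_ge0 H.
Let VG_small := rec_generator_small H.
Let VG_large := rec_generator_large H.
Let q_lt1 := rec_contracting H.

Let r0 j : 0 < r j. Proof. by have /andP[] := r01 j. Qed.
Let r1 j : r j < 1. Proof. by have /andP[] := r01 j. Qed.

(** The defect [v0 - W] satisfies a homogeneous recursion with total weight less
    than [1] on large scales, so its supremum there is at most [0]. *)
Lemma tube_large e : g <= e -> W e = v0.
Proof.
pose X e := v0 - W e; pose S := [set X e | e in [set e | g <= e]].
have X0 e' : 0 <= X e' by rewrite subr_ge0.
have hS : has_sup S.
  by split; [exists (X g), g => //=|exists v0 => _ [k _ <-]; rewrite /X gerBl].
have Sub k : g <= k -> X k <= sup S.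
  by move=> gk; apply: (sup_ubound (proj2 hS)); exists k.
have s0 : 0 <= sup S := le_trans (X0 g) (Sub g (lexx g)).
have : sup S <= (\sum_j r j ^+ d) * sup S.
  apply: sup_le_ub; first by case: hS.
  move=> _ [k /= gk <-]; rewrite mulr_suml.
  have -> : X k = \sum_j r j ^+ d * X (k / r j).
    rewrite /X {1}v_rec W_rec VG_large// opprD addrACA subrr add0r -sumrB.
    by apply: eq_bigr => j _; rewrite mulrBr.
  apply: ler_sum => j _; rewrite ler_pM2l ?exprn_gt0//; apply: Sub.
  by rewrite ler_pdivlMr//; apply: le_trans gk; rewrite ler_piMr ?(ltW g0)// ltW.
move=> h; have S0 : sup S <= 0.
  rewrite leNgt; apply/negP => Sp; have := ltr_pM2r Sp (\sum_j r j ^+ d) 1.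
  by rewrite q_lt1 mul1r => /(lt_le_trans)/(_ h); rewrite ltxx.
move=> ge; apply/eqP; rewrite eq_le W_le /=.
rewrite -subr_le0; exact: le_trans (Sub e ge) S0.
Qed.

Lemma generator_tube_linear : exists2 K : R, 0 <= K & forall e, 0 < e <= g -> VG e <= K * e.
Proof.
pose K := \sum_(m < d) `|kappa m| * (1 + g) ^+ d + vG / g.
have g0' := g0; have gg : 1 <= 1 + g by lra.
have s0 : 0 <= \sum_(m < d) `|kappa m| * (1 + g) ^+ d.
  by apply: sumr_ge0 => m _; rewrite mulr_ge0// exprn_ge0//; lra.
have vg : 0 < vG / g by rewrite divr_gt0.
exists K; first by rewrite /K; lra.
move=> e /andP[e0]; rewrite le_eqVlt => /predU1P[->|eg].
  rewrite VG_large// /K mulrDl divfK ?gt_eqF// lerDr mulr_ge0// ltW//.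
rewrite VG_small ?e0// /K mulrDl; apply: (@le_trans _ _ (\sum_(m < d) `|kappa m| * (1 + g) ^+ d * e)).
  apply: ler_sum => m _; rewrite -mulrA.
  apply: le_trans (_ : `|kappa m| * e ^+ (d - m) <= _).
    by rewrite ler_wpM2r ?exprn_ge0 ?(ltW e0)// ler_norm.
  rewrite ler_wpM2l//.
  have /prednK <- : (0 < d - m)%N by rewrite subn_gt0.
  rewrite exprSr ler_wpM2r ?(ltW e0)//.
  apply: (@le_trans _ _ ((1 + g) ^+ (d - m).-1)).
    by rewrite lerXn2r ?nnegrE//; lra.
  by rewrite ler_weXn2l//; lia.
by rewrite mulr_suml lerDl mulr_ge0// ltW.
Qed.

Let powR_bounds (a b s : R) : 0 < a -> a <= b ->
  exists c : R * R, [/\ 0 < c.1, 0 < c.2 & forall e, a <= e <= b -> c.1 <= e `^ s <= c.2].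
Proof.
move=> a0 ab; have b0 := lt_le_trans a0 ab.
have [s0|s0] := leP 0 s.
  exists (a `^ s, b `^ s); rewrite !powR_gt0//; split=> // e /andP[ae eb] /=.
  have e0 := lt_le_trans a0 ae.
  by apply/andP; split; apply: ge0_ler_powR; rewrite ?nnegrE ?(ltW e0) ?(ltW a0) ?(ltW b0).
have s0' : 0 <= - s by rewrite oppr_ge0 ltW.
exists (b `^ s, a `^ s); rewrite !powR_gt0//; split=> // e /andP[ae eb] /=.
have e0 := lt_le_trans a0 ae.
rewrite -(opprK s) !(powRN _ (- s)) !lef_pV2 ?posrE ?powR_gt0//.
by apply/andP; split; apply: ge0_ler_powR; rewrite ?nnegrE ?(ltW e0) ?(ltW a0) ?(ltW b0).
Qed.

Let le_gdivrho rho : 0 < rho -> (forall j, rho <= r j) -> g <= g / rho.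
Proof.
move=> rho0 rhor; rewrite ler_pdivlMr// ler_piMr ?(ltW g0)//.
by apply: le_trans (rhor (Ordinal J0)) _; exact: ltW.
Qed.

(** Multiples of [e `^ (d - s)] are subsolutions of the recursion, as [VG] is
    nonnegative; they are compared with [W] on the scales where it is constant. *)
Lemma tube_lower_bound s : 1 <= \sum_j r j `^ s ->
  exists2 c : R, 0 < c & forall e, 0 < e <= g -> c * e `^ (d%:R - s) <= W e.
Proof.
move=> qs; have [rho rho0 rhor] := ratio_lower r01.
have gr := le_gdivrho rho0 rhor.
have [[c1 c2] /= [c10 c20 cP]] := powR_bounds (d%:R - s) g0 gr.
exists (v0 / c2); first exact: divr_gt0.
pose X e := v0 / c2 * e `^ (d%:R - s) - W e.
suff h : forall e, 0 < e <= g / rho -> X e <= 0.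
  move=> e /andP[e0 eg]; have := h e; rewrite /X e0 (le_trans eg gr) => /(_ isT).
  by rewrite subr_le0.
apply: (recursion_comparison r01 (d := d) rho0 rhor g0) => [e /andP[e0 eg]|e eg].
  have -> : \sum_j r j ^+ d * X (e / r j) =
      v0 / c2 * (e `^ (d%:R - s) * \sum_j r j `^ s) - \sum_j r j ^+ d * W (e / r j).
    rewrite !mulr_sumr -sumrB; apply: eq_bigr => j _.
    by rewrite /X mulrBr mulrCA (ratio_powR_mul r01).
  rewrite /X W_rec opprD addrA lerD2r.
  have := VG_ge0 e; have p0 : 0 < e `^ (d%:R - s) by rewrite powR_gt0.
  have c0 : 0 < v0 / c2 by rewrite divr_gt0.
  have : v0 / c2 * e `^ (d%:R - s) <= v0 / c2 * (e `^ (d%:R - s) * \sum_j r j `^ s).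
    by rewrite ler_pM2l// ler_pMr.
  by lra.
have /andP[c1e ec2] := cP e eg; have /andP[ge _] := eg.
rewrite /X tube_large// subr_le0 mulrAC ler_pdivrMr// ler_pM2l//.
Qed.

Lemma tube_gt0 e : 0 < e -> 0 < W e.
Proof.
move=> e0; have [ge|/ltW eg] := leP g e; first by rewrite tube_large.
have [|c c0 cP] := @tube_lower_bound 0.
  have -> : \sum_j r j `^ 0 = \sum_(j < J) 1 by apply: eq_bigr => j _; rewrite powRr0.
  by rewrite sumr_const card_ord ler1n.
by apply: lt_le_trans (cP e _); rewrite ?mulr_gt0 ?powR_gt0// e0.
Qed.

(** A supersolution of the form [A * e `^ (d - s) - B * e].  The bound [VG e <= K * e]
    is absorbed by the first term if [\sum_j r j `^ s < 1], and by the linear term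
    if [\sum_j r j `^ (d - 1) > 1]; the second case covers the critical exponent. *)
Lemma tube_upper_bound s : d%:R - 1 < s -> \sum_j r j `^ s <= 1 ->
  \sum_j r j `^ s < 1 \/ 1 < \sum_j r j `^ (d%:R - 1) ->
  exists2 A : R, 0 < A & forall e, 0 < e <= g -> W e <= A * e `^ (d%:R - s).
Proof.
have v00' := v00; have g0' := g0; move=> ds qs alt; have [rho rho0 rhor] := ratio_lower r01.
have gr := le_gdivrho rho0 rhor.
have [K K0 KP] := generator_tube_linear.
have [[c1 c2] /= [c10 c20 cP]] := powR_bounds (d%:R - s) g0 gr.
pose q := \sum_j r j `^ s; pose q' := \sum_j r j `^ (d%:R - 1).
have dd : d%:R - (d%:R - 1) = 1 :> R by ring.
have gp e : 0 < e < g -> e <= e `^ (d%:R - s) * g `^ (1 - d%:R + s).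
  move=> /andP[e0 eg].
  have {1}-> : e = e `^ ((d%:R - s) + (1 - d%:R + s)).
    have -> : (d%:R - s) + (1 - d%:R + s) = 1 by ring.
    by rewrite powRr1// ltW.
  rewrite powRD; last by rewrite (gt_eqF e0) implybT.
  rewrite ler_pM2l ?powR_gt0//; apply: ge0_ler_powR; rewrite ?nnegrE ?(ltW e0) ?(ltW g0) ?(ltW eg)//.
  by lra.
have gp0 : 0 < g `^ (1 - d%:R + s) by rewrite powR_gt0.
have [A [B [A0 B0 AB]]] : exists A B, [/\ 0 < A, 0 <= B & forall e, 0 < e < g ->
    K * e + (A * e `^ (d%:R - s) * q - B * e * q') <= A * e `^ (d%:R - s) - B * e].
  case: alt => [q1|q1].
    exists (K * g `^ (1 - d%:R + s) / (1 - q) + 1), 0; split; [|by []|].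
      by rewrite ltr_wpDl// divr_ge0// ?subr_ge0// mulr_ge0// ltW.
    move=> e /[dup] /andP[e0 eg] /gp; set p := e `^ _ => ep.
    have p0 : 0 < p by rewrite powR_gt0.
    have K1 : K * e <= K * (p * g `^ (1 - d%:R + s)) by rewrite ler_wpM2l.
    set y := g `^ _ in K1 *.
    have q1' : 0 < 1 - q by rewrite subr_gt0.
    have -> : (K * y / (1 - q) + 1) * p - 0 * e = (K * y / (1 - q) + 1) * p * q - 0 * e * q' + K * (p * y) + p * (1 - q).
      by field; rewrite gt_eqF.
    have : 0 <= p * (1 - q) by rewrite mulr_ge0 ?ltW.
    by lra.
  exists 1, (K / (q' - 1)); split=> //; first by rewrite divr_ge0// subr_ge0 ltW.
  move=> e /andP[e0 eg]; set p := e `^ _.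
  have p0 : 0 < p by rewrite powR_gt0.
  have -> : K / (q' - 1) * e * q' = K * e + K / (q' - 1) * e.
    by field; rewrite subr_eq0 gt_eqF.
  have : 1 * p * q <= 1 * p by rewrite mul1r ler_piMr// ltW.
  by lra.
pose A' := A + (v0 + B * (g / rho)) / c1.
have grho : 0 < g / rho by rewrite divr_gt0.
have E0 : 0 <= (v0 + B * (g / rho)) / c1.
  by rewrite divr_ge0 ?(ltW c10)// addr_ge0 ?(ltW v00)// mulr_ge0// ltW.
have A'0 : 0 < A' by rewrite /A'; lra.
exists A' => //.
pose X e := W e - (A' * e `^ (d%:R - s) - B * e).
suff h : forall e, 0 < e <= g / rho -> X e <= 0.
  move=> e /andP[e0 eg]; have := h e; rewrite /X e0 (le_trans eg gr) => /(_ isT).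
  have : 0 <= B * e by rewrite mulr_ge0// ltW.
  by lra.
apply: (recursion_comparison r01 (d := d) rho0 rhor g0) => [e /andP[e0 eg]|e /[dup] /andP[ge eg] /cP/andP[c1e _]].
  have -> : \sum_j r j ^+ d * X (e / r j) = \sum_j r j ^+ d * W (e / r j) -
      (A' * e `^ (d%:R - s) * q - B * e * q').
    have -> : B * e = B * e `^ (d%:R - (d%:R - 1)).
      by rewrite dd powRr1// ltW.
    rewrite /q /q' !mulr_sumr -!sumrB; apply: eq_bigr => j _.
    have -> : X (e / r j) = W (e / r j) - (A' * (e / r j) `^ (d%:R - s) - B * (e / r j) `^ (d%:R - (d%:R - 1))).
      by rewrite /X dd powRr1// divr_ge0// ltW.
    rewrite -!mulrA -!(ratio_powR_mul r01)//; ring.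
  rewrite /X W_rec; have := KP e; rewrite e0 (ltW eg) => /(_ isT) KPe.
  have := AB e; rewrite e0 eg => /(_ isT).
  set p := e `^ _; have p0 : 0 < p by rewrite powR_gt0.
  set Y := (v0 + B * (g / rho)) / c1 in E0 A'0 *.
  have : Y * p * q <= Y * p by rewrite ler_piMr// mulr_ge0// ltW.
  by rewrite /A' -/Y; lra.
have e0 := lt_le_trans g0 ge.
rewrite /X tube_large//; set p := e `^ _ in c1e *.
have : B * e <= B * (g / rho) by rewrite ler_wpM2l.
have : (v0 + B * (g / rho)) / c1 * c1 <= (v0 + B * (g / rho)) / c1 * p by rewrite ler_wpM2l.
rewrite divfK ?gt_eqF//.
have : 0 <= A * p by rewrite mulr_ge0 ?(ltW A0)// powR_ge0.
by rewrite /A'; lra.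
Qed.

End tube_recursion_theory.

Section dimension_bounds.
Context {R : realType}.
Implicit Types (V : R -> R) (D s c e : R).

Lemma near0_exists (P : R -> Prop) (k : R) : 0 < k ->
  (\forall e \near 0^'+, P e) -> exists e, [/\ P e, 0 < e & e < k].
Proof.
move=> k0 hP.
have h0 : \forall e \near 0^'+, 0 < e :> R by exact: nbhs_right_gt.
have h1 : \forall e \near 0^'+, e < k by exact: nbhs_right_lt.
by have [e [Pe [e0 ek]]] :=
  @filter_ex _ (0 : R)^'+ (at_right_proper_filter (0 : R)) _ (filterI hP (filterI h0 h1)); exists e.
Qed.

Let dim_exp V (d : nat) D (k : R) (L : R) : 0 < k -> 0 < L ->
  d%:R - ln (V e) / ln e @[e --> 0^'+] --> D ->
  forall e0, 0 < e0 -> exists e, [/\ 0 < e, e < e0, ln e < - L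
    & `|D - (d%:R - ln (V e) / ln e)| < k].
Proof.
move=> k0 L0 /cvgrPdist_lt/(_ k k0) h e0 e00.
have m0 : 0 < Num.min e0 (expR (- L)) by rewrite lt_min e00 expR_gt0.
have [e [he ep]] := near0_exists m0 h.
rewrite lt_min => /andP[ee0 eL]; exists e; split=> //.
by rewrite -[ltRHS]expRK ltr_ln// posrE// expR_gt0.
Qed.

Lemma dimension_ge V (d : nat) D s c e0 : 0 < c -> 0 < e0 ->
  (forall e, 0 < e <= e0 -> c * e `^ (d%:R - s) <= V e) ->
  d%:R - ln (V e) / ln e @[e --> 0^'+] --> D -> s <= D.
Proof.
move=> c0 e00 hV cD; rewrite leNgt; apply/negP => Ds.
pose k := (s - D) / 2; have k0 : 0 < k by rewrite /k; lra.
(* The term [ln c] is at most [k * `|ln e|] as soon as [ln e < - L]. *)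
pose L := `|ln c| / k + 1; have L0 : 0 < L by rewrite ltr_wpDl// divr_ge0// ltW.
have [e [ep ee0 eL hk]] := dim_exp k0 L0 cD e00.
have ce : 0 < c * e `^ (d%:R - s) by rewrite mulr_gt0// powR_gt0.
have lnV : ln c + (d%:R - s) * ln e <= ln (V e).
  rewrite -ln_powR -lnM ?posrE ?powR_gt0// ler_ln ?posrE//; last first.
    by apply: (lt_le_trans ce); apply: hV; rewrite ep ltW.
  by apply: hV; rewrite ep ltW.
have lne : 0 < - ln e by lra.
have hq : (ln (V e) / ln e) * (- ln e) = - ln (V e).
  by rewrite mulrN divfK// -oppr_eq0 gt_eqF.
have lnc : - (k * (- ln e)) <= ln c.
  have : `|ln c| <= k * (- ln e).
    by rewrite mulrC -ler_pdivrMr//; rewrite /L in eL; lra.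
  by have := ler_norm (- ln c); rewrite normrN; lra.
move: hk; rewrite ltr_distlC => /andP[_ h2].
have := ltr_pM2r lne (d%:R - ln (V e) / ln e) (D + k); rewrite h2 mulrBl hq => h3.
have : (D + k) * - ln e = s * - ln e - k * - ln e by rewrite /k; field.
by move=> h4; rewrite h4 in h3; lra.
Qed.

Lemma dimension_le V (d : nat) D s c e0 : 0 < c -> 0 < e0 ->
  (forall e, 0 < e <= e0 -> 0 < V e <= c * e `^ (d%:R - s)) ->
  d%:R - ln (V e) / ln e @[e --> 0^'+] --> D -> D <= s.
Proof.
move=> c0 e00 hV cD; rewrite leNgt; apply/negP => Ds.
pose k := (D - s) / 2; have k0 : 0 < k by rewrite /k; lra.
(* The term [ln c] is at most [k * `|ln e|] as soon as [ln e < - L]. *)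
pose L := `|ln c| / k + 1; have L0 : 0 < L by rewrite ltr_wpDl// divr_ge0// ltW.
have [e [ep ee0 eL hk]] := dim_exp k0 L0 cD e00.
have ce : 0 < c * e `^ (d%:R - s) by rewrite mulr_gt0// powR_gt0.
have /andP[V0 Vle] : 0 < V e <= c * e `^ (d%:R - s) by apply: hV; rewrite ep ltW.
have lnV : ln (V e) <= ln c + (d%:R - s) * ln e.
  by rewrite -ln_powR -lnM ?posrE ?powR_gt0// ler_ln ?posrE.
have lne : 0 < - ln e by lra.
have hq : (ln (V e) / ln e) * (- ln e) = - ln (V e).
  by rewrite mulrN divfK// -oppr_eq0 gt_eqF.
have lnc : ln c <= k * (- ln e).
  have : `|ln c| <= k * (- ln e).
    by rewrite mulrC -ler_pdivrMr//; rewrite /L in eL; lra.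
  by have := ler_norm (ln c); lra.
move: hk; rewrite ltr_distlC => /andP[h2 _].
have := ltr_pM2r lne (D - k) (d%:R - ln (V e) / ln e); rewrite h2 => h3.
have : (D - k) * - ln e = s * - ln e + k * - ln e by rewrite /k; field.
by move=> h4; rewrite h4 mulrBl hq in h3; lra.
Qed.

End dimension_bounds.

Section moran.
Context {R : realType} {J d : nat}.
Variables (r : 'I_J -> R) (kappa : nat -> R) (g v0 vG K D : R) (W VG V : R -> R).
Hypotheses (H : tube_recursion d r kappa g v0 vG W VG) (K0 : 0 <= K)
  (V_bounds : forall e, 0 < e <= 1 -> W e <= V e <= W e + K * e)
  (V_dim : d%:R - ln (V e) / ln e @[e --> 0^'+] --> D) (dD : d%:R - 1 < D).

Let r01 := rec_ratio H.
Let g0 := rec_inradius H.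

(** If the sum were less than [1], it would still be so at some [s < D], and the
    upper bound with exponent [s] would make the dimension at most [s]; if it were
    greater than [1], the lower bound would apply with some [s > D]. *)
Lemma moran_equation : \sum_j r j `^ D = 1.
Proof.
have g0' := g0; have K0' := K0; have dD' := dD.
have m0 : 0 < Num.min g 1 by rewrite lt_min g0 ltr01.
have qc := @sum_ratio_powR_continuous R J r r01 D.
have [q1|q1|//] := ltgtP (\sum_j r j `^ D) 1.
- have [s [sd sD qs]] : exists s, [/\ d%:R - 1 < s, s < D & \sum_j r j `^ s < 1].
    have /cvgrPdist_lt/(_ (1 - \sum_j r j `^ D)) := qc; rewrite subr_gt0 => /(_ q1).
    move=> /nbhs_ballP[k /= k0 hk].
    pose s := Num.max (D - k / 2) ((D + d%:R - 1) / 2).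
    have sD : s < D by rewrite gt_max; apply/andP; lra.
    exists s; split=> //; first by rewrite lt_max; apply/orP; right; lra.
    have : ball D k s.
      rewrite /ball /= ger0_norm ?subr_ge0 ?(ltW sD)//.
      have : D - k / 2 <= s by rewrite le_max lexx.
      by lra.
    move/hk; rewrite distrC => h; have := ler_norm (\sum_j r j `^ s - \sum_j r j `^ D).
    by lra.
  have [A A0 hA] := tube_upper_bound H sd (ltW qs) (or_introl qs).
  suff : D <= s by rewrite leNgt sD.
  apply: (dimension_le (c := A + K) (e0 := Num.min g 1) _ _ _ V_dim) => //; first by lra.
  move=> e /andP[e0]; rewrite le_min => /andP[eg e1].
  have /andP[V1 V2] : W e <= V e <= W e + K * e by apply: V_bounds; rewrite e0.
  have W0 : 0 < W e := tube_gt0 H e0.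
  rewrite (lt_le_trans W0 V1)/=; apply: (le_trans V2).
  have := hA e; rewrite e0 eg => /(_ isT).
  have : K * e <= K * e `^ (d%:R - s).
    rewrite ler_wpM2l// -{1}(powRr1 (ltW e0)) ger_powR ?e0//; lra.
  by lra.
- have [s sD qs] : exists2 s, D < s & 1 <= \sum_j r j `^ s.
    have /cvgrPdist_lt/(_ (\sum_j r j `^ D - 1)) := qc; rewrite subr_gt0 => /(_ q1).
    move=> /nbhs_ballP[k /= k0 hk].
    exists (D + k / 2); first by lra.
    have : ball D k (D + k / 2).
      by rewrite /ball /= opprD addNKr normrN gtr0_norm; lra.
    move/hk => h; have := ler_norm (\sum_j r j `^ D - \sum_j r j `^ (D + k / 2)).
    by lra.
  have [c c0 hc] := tube_lower_bound H qs.
  suff : s <= D by rewrite leNgt sD.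
  apply: (dimension_ge (c := c) (e0 := Num.min g 1) _ _ _ V_dim) => //.
  move=> e /andP[e0]; rewrite le_min => /andP[eg e1].
  have /andP[V1 _] : W e <= V e <= W e + K * e by apply: V_bounds; rewrite e0.
  by apply: le_trans V1; apply: hc; rewrite e0.
Qed.

Lemma dimension_lt : D < d%:R.
Proof.
have r0 j : 0 < r j by have /andP[] := r01 j.
have qd : \sum_j r j `^ d%:R < 1.
  by have := rec_contracting H; under [X in _ -> X < _] eq_bigr do rewrite powR_mulrn ?(ltW (r0 _))//.
rewrite ltNge; apply/negP; rewrite le_eqVlt => /predU1P[dE|dlt].
  by move: qd; rewrite dE moran_equation ltxx.
by have := sum_ratio_powR_decr r01 (rec_index H) dlt; rewrite moran_equation; lra.
Qed.

End moran.

(** * An upper limit for renewal equations *)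

Section renewal.
Context {R : realType} {J : nat}.
Variables (p a : 'I_J -> R) (X x M : R -> R) (T0 K S : R).
Let mu := \sum_j p j * a j.
Let word (l : seq 'I_J) : R := \sum_(j <- l) a j.
Hypotheses (J0 : (0 < J)%N) (p0 : forall j, 0 < p j) (p1 : \sum_j p j = 1)
  (a0 : forall j, 0 < a j)
  (X_rec : forall t, T0 <= t -> X t = x t + \sum_j p j * X (t - a j))
  (x_small : forall eta, 0 < eta -> exists T, forall t, T <= t -> `|x t| <= eta)
  (X_bounded : exists B T, forall t, T <= t -> `|X t| <= B)
  (* Slow variation is one-sided, with an offset [e], so as to apply to a function
     that increases slowly and to its opposite. *)
  (X_slow : forall w, 0 < w -> exists delta e T, 0 < delta /\
    forall t u, T <= t -> t - e <= u <= t - e + delta -> X u <= X t + w)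
  (words_dense : forall delta, 0 < delta -> exists S0, forall y, S0 <= y ->
    exists l, y <= word l <= y + delta)
  (* [M] plays the role of [\sum_j p j * \int_(tau - a j)^tau X]. *)
  (M_window : forall c tau, T0 <= tau -> (forall t, tau - K <= t <= tau -> c <= X t) ->
    mu * c <= M tau)
  (M_limit : forall eta, 0 < eta -> exists T, forall tau, T <= tau -> M tau <= S + eta).

Let mu_gt0 : 0 < mu.
Proof.
rewrite /mu (bigD1 (Ordinal J0))//= ltr_pwDl ?mulr_gt0//.
by apply: sumr_ge0 => j _; rewrite mulr_ge0// ltW.
Qed.

Let E := [set y | exists T, forall t, T <= t -> X t <= y].
Let L := inf E.

Let has_inf_E : has_inf E.
Proof.
have [B [T h]] := X_bounded; split.
  by exists B, T => t /h; apply: le_trans; exact: ler_norm.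
exists (- B) => y [T' h'].
have T1 : T <= Num.max T T' by rewrite le_max lexx.
have T2 : T' <= Num.max T T' by rewrite le_max lexx orbT.
by have := h _ T1; have := h' _ T2; rewrite ler_norml => ? /andP[? ?]; lra.
Qed.

Let eventually_le eta : 0 < eta -> exists T, forall t, T <= t -> X t <= L + eta.
Proof.
move=> eta0; have [y [T h] yL] := inf_adherent eta0 has_inf_E.
by exists T => t /h; rewrite -/L in yL *; lra.
Qed.

Let frequently_ge eta T : 0 < eta -> exists2 t, T <= t & L - eta <= X t.
Proof.
move=> eta0; apply: contrapT => h.
have : E (L - eta).
  exists T => t Tt; rewrite leNgt; apply/negP => /ltW tL.
  by apply: h; exists t.
by move=> /(ge_inf (proj2 has_inf_E)); rewrite -/L; lra.
Qed.

(** If [X t] is close to its upper limit, then so is [X (t - a j)], since [X t] is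
    nearly an average of these values and none of them is much larger. *)
Let propagate l : forall eta, 0 < eta -> exists eta' T, 0 < eta' /\
  forall t, T <= t -> L - eta' <= X t -> L - eta <= X (t - word l).
Proof.
elim: l => [|j l IH] eta eta0.
  exists eta, 0; split=> // t _; by rewrite /word big_nil subr0.
have [eta1 [T1 [eta10 h1]]] := IH eta eta0.
have pj := p0 j.
have e0 : 0 < p j * eta1 / 3 by rewrite divr_gt0// mulr_gt0.
have [T2 h2] := eventually_le e0; have [T3 h3] := x_small e0.
pose A := \sum_i a i.
have aA i : a i <= A.
  by rewrite /A (bigD1 i)//= lerDl sumr_ge0// => k _; exact: ltW.
have A0 : 0 < A by apply: lt_le_trans (aA j); exact: a0.
pose m := `|T0| + `|T1| + `|T2| + `|T3| + A.
have := ler_norm T0; have := ler_norm T1; have := ler_norm T2; have := ler_norm T3.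
have := normr_ge0 T0; have := normr_ge0 T1; have := normr_ge0 T2; have := normr_ge0 T3.
move=> n3 n2 n1 n0 m3 m2 m1 m0.
exists (p j * eta1 / 3), m; split=> // t mt LX.
rewrite /m in mt.
have -> : t - word (j :: l) = t - a j - word l by rewrite /word big_cons opprD addrA.
have aj := aA j; apply: h1; first by lra.
have : X t <= p j * eta1 / 3 + (p j * X (t - a j) + (1 - p j) * (L + p j * eta1 / 3)).
  rewrite X_rec; last by lra.
  apply: lerD.
    by apply: le_trans (ler_norm _) _; apply: h3; lra.
  have -> : 1 - p j = \sum_(i | i != j) p i by rewrite -p1 (bigD1 j)//= addrAC subrr add0r.
  rewrite (bigD1 j)//= lerD2l mulr_suml.
  apply: ler_sum => i _; rewrite ler_pM2l//; apply: h2.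
  by have := aA i; lra.
move=> h; rewrite -(ler_pM2l pj).
have : 0 <= p j * (p j * eta1 / 3) by rewrite mulr_ge0 ?ltW.
by lra.
Qed.

Let propagate_all (l : nat -> seq 'I_J) N eta : 0 < eta -> exists eta' T, 0 < eta' /\
  forall t, T <= t -> L - eta' <= X t ->
    forall i, (i < N)%N -> L - eta <= X (t - word (l i)).
Proof.
move=> eta0; elim: N => [|N [e1 [T1 [e10 h1]]]]; first by exists 1, 0; split.
have [e2 [T2 [e20 h2]]] := propagate (l N) eta0.
exists (Num.min e1 e2), (Num.max T1 T2); split; first by rewrite lt_min e10.
move=> t; rewrite ge_max => /andP[t1 t2] LX i; rewrite ltnS leq_eqVlt => /predU1P[->|iN].
  apply: h2 => //; apply: le_trans LX; rewrite lerD2l lerN2 ge_min lexx orbT //.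
apply: h1 => //; apply: le_trans LX; rewrite lerD2l lerN2 ge_min lexx //.
Qed.

(** Words whose lengths approximate the points of a grid of step [delta / 2] carry
    a large value at [t0] to a whole window, by slow variation. *)
Let window eta T : 0 < eta -> exists2 tau, T <= tau &
  forall t, tau - K <= t <= tau -> L - eta <= X t.
Proof.
move=> eta0; have e2 : 0 < eta / 2 by rewrite divr_gt0.
have [delta [e [T1 [d0 slow]]]] := X_slow e2.
have dd : 0 < delta / 2 by rewrite divr_gt0.
have [S0 dense] := words_dense dd.
pose x0 := S0 - e + delta / 2.
have /(@choice _ _ _)[l lP] i : exists l, x0 + i%:R * (delta / 2) + e - delta / 2 <= word l
    <= x0 + i%:R * (delta / 2) + e - delta / 2 + delta / 2.
  apply: dense; rewrite /x0; have : 0 <= i%:R * (delta / 2) by rewrite mulr_ge0// ltW.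
  by lra.
pose N := (Num.truncn (`|K| / (delta / 2))).+1.
have [e' [T2 [e'0 hT]]] := propagate_all l N e2.
have [t0 Tt0 Lt0] := frequently_ge (`|T| + `|T1| + `|T2| + `|K| + `|x0|) e'0.
have := ler_norm T; have := ler_norm T1; have := ler_norm T2; have := ler_norm x0; have := ler_norm K.
have := normr_ge0 T; have := normr_ge0 T1; have := normr_ge0 T2; have := normr_ge0 x0; have := normr_ge0 K.
move=> n4 n3 n2 n1 n0 m4 m3 m2 m1 m0.
exists (t0 - x0); first by lra.
move=> t /andP[t1 t2]; pose y := t0 - t - x0.
have y0 : 0 <= y / (delta / 2) by rewrite divr_ge0 ?(ltW dd)// /y; lra.
have iN : (Num.truncn (y / (delta / 2)) < N)%N.
  by rewrite ltnS; apply: le_truncn; rewrite ler_pM2r ?invr_gt0// /y; lra.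
have /andP[i1 i2] := truncn_itv y0.
set i := Num.truncn _ in iN i1 i2.
rewrite ler_pdivlMr// in i1; rewrite ltr_pdivrMr// -natr1 mulrDl mul1r in i2.
have T2t0 : T2 <= t0 by lra.
have /= Li := hT t0 T2t0 Lt0 i iN.
have /andP[l1 l2] := lP i.
have := slow t (t0 - word (l i)); rewrite /y in i1 i2 *.
have -> : t - e <= t0 - word (l i) <= t - e + delta by apply/andP; split; lra.
have -> : T1 <= t by lra.
by move=> /(_ isT isT); lra.
Qed.

(** The upper limit [L] is nearly attained on a window of length [K], where
    [M_window] and [M_limit] give [mu * L <= S]. *)
Lemma renewal_limsup eta : 0 < eta -> exists T, forall t, T <= t -> X t <= S / mu + eta.
Proof.
have mu0 := mu_gt0.
have LS : mu * L <= S.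
  apply/ler_addgt0Pr => k k0.
  have e1 : 0 < k / 2 by rewrite divr_gt0.
  have e2 : 0 < k / 2 / mu by rewrite divr_gt0.
  have [T hT] := M_limit e1.
  have [tau] := window (Num.max T0 T) e2; rewrite ge_max => /andP[T0tau Ttau] h.
  have := M_window T0tau h; rewrite mulrBr [mu * (_ / mu)]mulrC divfK ?gt_eqF//.
  by have := hT tau Ttau; lra.
move=> eta0; have [T h] := eventually_le eta0; exists T => t /h.
have : L <= S / mu by rewrite ler_pdivlMr// mulrC.
by lra.
Qed.

End renewal.

(** * The group generated by the logarithms of the ratios *)

Section log_groups.
Context {R : realType} {J : nat}.
Variable r : 'I_J -> R.
Hypotheses (J0 : (0 < J)%N) (r01 : forall j, 0 < r j < 1).
Let a j := - ln (r j).

Let a0 j : 0 < a j. Proof. by rewrite /a oppr_gt0 ln_lt0. Qed.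

Let groupE z : log_group r z <-> exists k : 'I_J -> int, z = \sum_j a j *~ k j.
Proof.
split=> -[k ->]; exists (fun j => - k j); apply: eq_bigr => j _.
  by rewrite /a mulrNz mulNrz opprK.
by rewrite /a mulrNz mulNrz.
Qed.

Let groupB y z : log_group r y -> log_group r z -> log_group r (y - z).
Proof.
move=> /groupE[k ->] /groupE[l ->]; apply/groupE; exists (fun j => k j - l j).
by rewrite -sumrB; apply: eq_bigr => j _; rewrite mulrzBr.
Qed.

Let group0 : log_group r 0.
Proof. by exists (fun=> 0); rewrite big1. Qed.

Let group_gen j : log_group r (a j).
Proof.
apply/groupE; exists (fun i => (i == j)%:Z); rewrite (bigD1 j)//= eqxx mulr1z.
by rewrite big1 ?addr0// => i /negbTE ->; rewrite mulr0z.
Qed.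

Let group_mul z n : log_group r z -> log_group r (z *+ n).
Proof.
move=> gz; elim: n => [|n IH]; first by rewrite mulr0n.
have -> : z *+ n.+1 = z *+ n - (0 - z) by rewrite sub0r opprK mulrSr.
by apply: groupB => //; exact: groupB.
Qed.

Let words := [set s : R | exists l : seq 'I_J, s = \sum_(j <- l) a j].

Let words0 : words 0. Proof. by exists [::]; rewrite big_nil. Qed.

Let wordsD s t : words s -> words t -> words (s + t).
Proof. by move=> [l ->] [m ->]; exists (l ++ m); rewrite big_cat. Qed.

Let words_gen j : words (a j). Proof. by exists [:: j]; rewrite big_seq1. Qed.

Let words_mul s n : words s -> words (s *+ n).
Proof.
move=> ws; elim: n => [|n IH]; first by rewrite mulr0n.
by rewrite mulrS; exact: wordsD.
Qed.

Let group_words z : log_group r z -> exists u v, [/\ words u, words v & z = u - v].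
Proof.
move=> /groupE[k ->]; apply: (big_ind (fun z => exists u v, [/\ words u, words v & z = u - v])).
- by exists 0, 0; rewrite subrr.
- move=> _ _ [u [v [wu wv ->]]] [u' [v' [wu' wv' ->]]].
  exists (u + u'), (v + v'); split; try exact: wordsD.
  by rewrite opprD addrACA.
move=> j _; case: (k j) => n.
  by exists (a j *+ n), 0; split; [exact: words_mul| |rewrite subr0].
exists 0, (a j *+ n.+1); split; [by []|exact: words_mul|].
by rewrite sub0r NegzE mulrNz.
Qed.

(** A nondiscrete group contains a positive [z < delta], and [z = u - v] for two
    sums [u], [v] of generators.  The sums of [n] terms equal to [u] or [v] fill
    the interval from [n * v] to [n * u] with step [z], and for large [n] these
    intervals overlap. *)
Lemma nonlattice_words_dense : ~ lattice_type r ->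
  forall delta : R, 0 < delta -> exists S0, forall y, S0 <= y ->
    exists l : seq 'I_J, y <= \sum_(j <- l) a j <= y + delta.
Proof.
move=> nl delta d0.
have [z [gz z0 zd]] : exists z, [/\ log_group r z, 0 < z & z < delta].
  apply: contrapT => h; apply: nl => x gx; split; first exact: mem_set.
  exists (ball x delta); first exact: nbhsx_ballx.
  apply/seteqP; split=> [y [yx gy]|_ ->]; last by split=> //; exact: ballxx.
  apply: contrapT => /eqP yx'; apply: h.
  move: yx; rewrite /ball /= ltr_distl => /andP[y1 y2].
  have [xy|yx] := ltP x y.
    by exists (y - x); split; [exact: groupB|rewrite subr_gt0|lra].
  exists (x - y); split; [exact: groupB| |lra].
  by rewrite subr_gt0 lt_neqAle yx' .
have [u [v [wu wv zE]]] := group_words gz.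
pose b := a (Ordinal J0).
(* Adding the same generator to [u] and [v] makes [v'] positive. *)
have [v' v'E] : exists v', v' = v + b by exists (v + b).
have [u' u'E] : exists u', u' = u + b by exists (u + b).
have wv' : words v' by rewrite v'E; apply: wordsD => //; exact: words_gen.
have wu' : words u' by rewrite u'E; apply: wordsD => //; exact: words_gen.
have v0 : 0 <= v by case: wv => l ->; apply: sumr_ge0 => j _; exact: ltW.
have v'0 : 0 < v' by rewrite v'E; have := a0 (Ordinal J0); rewrite -/b; lra.
have zE' : u' = v' + z by rewrite u'E v'E zE; ring.
pose N := (Num.truncn (v' / z)).+1.
have Nz : v' < N%:R * z.
  have q0 : 0 <= v' / z by rewrite divr_ge0// ltW.
  by have /andP[_] := truncn_itv q0; rewrite ltr_pdivrMr.
exists (N%:R * v') => y Ny.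
have y0 : 0 <= y by apply: le_trans Ny; rewrite mulr_ge0// ltW.
have q0 : 0 <= y / v' by rewrite divr_ge0// ltW.
have /andP[n1 n2] := truncn_itv q0; set n := Num.truncn _ in n1 n2.
rewrite ler_pdivlMr// in n1; rewrite ltr_pdivrMr// -natr1 mulrDl mul1r in n2.
have Nn : (N <= n)%N.
  rewrite -ltnS -(ltr_nat R) -(ltr_pM2r v'0) -natr1 mulrDl mul1r.
  exact: le_lt_trans n2.
have s0 : 0 <= (y - n%:R * v') / z by rewrite divr_ge0 ?subr_ge0// ltW.
have /andP[m1 m2] := truncn_itv s0; set m := Num.truncn _ in m1 m2.
rewrite ler_pdivlMr// in m1; rewrite ltr_pdivrMr// -natr1 mulrDl mul1r in m2.
have mn : (m.+1 <= n)%N.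
  apply: leq_trans Nn; rewrite -(ltr_nat R) -(ltr_pM2r z0).
  by apply: le_lt_trans m1 _; lra.
have : words (v' *+ (n - m.+1) + u' *+ m.+1).
  by apply: wordsD; exact: words_mul.
move=> [l lE]; exists l; rewrite -lE zE' mulrnDl addrA -mulrnDr subnK//.
by rewrite -(mulr_natl v') -(mulr_natl z) -natr1 mulrDl mul1r; apply/andP; split; lra.
Qed.

(** A discrete group has a least positive element [h], and division by [h] leaves
    no remainder. *)
Lemma lattice_span : lattice_type r ->
  exists (h : R) (n : 'I_J -> nat), [/\ 0 < h, forall j, (0 < n j)%N
    & forall j, a j = (n j)%:R * h].
Proof.
move=> lat; have [_ [V V0 VE]] := lat 0 group0.
have /nbhs_ballP[delta /= d0 dV] := V0.
have gap z : log_group r z -> `|z| < delta -> z = 0.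
  move=> gz zd; have : (V `&` log_group r) z.
    by split=> //; apply: dV; rewrite /ball /= sub0r normrN.
  by rewrite VE.
pose P := [set z | log_group r z /\ 0 < z].
have Pd z : P z -> delta <= z.
  move=> [gz z0]; rewrite leNgt; apply/negP => zd.
  have z00 : z = 0 by apply: gap => //; rewrite gtr0_norm.
  by rewrite z00 ltxx in z0.
have hP : has_inf P.
  split; last by exists delta => z /Pd.
  by exists (a (Ordinal J0)); split; [exact: group_gen|exact: a0].
pose h := inf P.
have hd : delta <= h by apply: lb_le_inf; [case: hP|move=> z /Pd].
have h0 : 0 < h := lt_le_trans d0 hd.
have hz z : P z -> h <= z by apply: ge_inf; case: hP.
have gh : log_group r h.
  have [z Pz] := inf_adherent d0 hP; rewrite -/h => zh.
  have [hz'|] := ltP h z; last first.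
    by move=> zh'; rewrite (_ : h = z); [case: Pz|apply/le_anti; rewrite zh' hz].
  have e0 : 0 < z - h by rewrite subr_gt0.
  have [y Py] := inf_adherent e0 hP; rewrite -/h addrCA subrr addr0 => yz.
  have gzy : log_group r (z - y) by apply: groupB; [case: Pz|case: Py].
  have := gap _ gzy; rewrite ger0_norm ?subr_ge0 ?(ltW yz)// => /(_ _)/eqP.
  have hy := hz y Py; rewrite subr_eq0 gt_eqF// => h'.
  by have : false by apply: h'; lra.
have aE j : exists n, a j = n%:R * h /\ (0 < n)%N.
  have q0 : 0 <= a j / h by rewrite divr_ge0// ltW.
  have /andP[n1 n2] := truncn_itv q0; set n := Num.truncn _ in n1 n2.
  rewrite ler_pdivlMr// in n1; rewrite ltr_pdivrMr// -natr1 mulrDl mul1r in n2.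
  have aj : a j = n%:R * h.
    apply/eqP; rewrite -subr_eq0; apply/negPn/negP => ne.
    have : P (a j - n%:R * h).
      split; last by rewrite lt_neqAle eq_sym ne subr_ge0.
      by apply: groupB; [exact: group_gen|rewrite mulr_natl; exact: group_mul].
    by move/hz; lra.
  exists n; split=> //; rewrite lt0n; apply/eqP => n0.
  by have := a0 j; rewrite aj n0 mul0r ltxx.
have /(@choice _ _ _)[n nP] := aE.
by exists h, n; split=> // j; have [] := nP j.
Qed.

End log_groups.

(** * Integrals on the positive half-line *)

Section positive_integrals.
Context {R : realType}.
Local Notation leb := (@lebesgue_measure R).
Implicit Types (a b k s t : R) (f F : R -> R).

Lemma FTC_positive f F a b : 0 < a -> a <= b ->
  (forall x : R, 0 < x -> is_derive x 1 F (f x)) ->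
  (forall x : R, 0 < x -> {for x, continuous f}) ->
  \int[leb]_(x in `[a, b]) f x = F b - F a.
Proof.
move=> a0; rewrite le_eqVlt => /predU1P[<-|ab] dF cf.
  by rewrite set_itv1 Rintegral_set1 subrr.
rewrite /Rintegral (@continuous_FTC2 _ f F)//.
- apply: continuous_in_subspaceT => x /set_mem; rewrite /= in_itv/= => /andP[ax _].
  by apply: cf; exact: lt_le_trans ax.
- have cF (x : R) : 0 < x -> {for x, continuous F}.
    move=> x0; apply: differentiable_continuous; apply/derivable1_diffP.
    by apply: ex_derive; exact: dF.
  split.
  + move=> x; rewrite in_itv/= => /andP[ax _].
    by apply: ex_derive; apply: dF; exact: lt_trans ax.
  + by apply: cvg_at_right_filter; exact: cF.
  + by apply: cvg_at_left_filter; apply: cF; exact: lt_trans ab.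
- move=> x; rewrite in_itv/= => /andP[ax _].
  by rewrite derive1E; apply: derive_val; apply: dF; exact: lt_trans ax.
Qed.

Lemma continuous_powR_pos s x : 0 < x -> {for x, continuous (fun u : R => u `^ s)}.
Proof.
move=> x0; apply: differentiable_continuous; apply/derivable1_diffP.
by apply: derivable_powR; rewrite in_itv/= andbT.
Qed.

Lemma integral_powR a b s : 0 < a -> a <= b -> s != 0 ->
  \int[leb]_(x in `[a, b]) (x `^ (s - 1)) = (b `^ s - a `^ s) / s.
Proof.
move=> a0 ab s0.
have dF (x : R) : 0 < x -> is_derive x 1 (fun x => s^-1 * x `^ s) (x `^ (s - 1)).
  move=> x0; apply: is_derive_eq.
    by apply: is_deriveM; exact: is_derive1_powR.
  by rewrite scaler0 addr0 /GRing.scale /= mulrA mulVf// mul1r.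
apply: (etrans (FTC_positive a0 ab dF _)); last by rewrite -mulrBr mulrC.
by move=> x x0; exact: continuous_powR_pos.
Qed.

Lemma integral_inverse a b : 0 < a -> a <= b ->
  \int[leb]_(x in `[a, b]) x^-1 = ln b - ln a.
Proof.
move=> a0 ab; apply: (FTC_positive a0 ab (fun x x0 => is_derive1_ln x0)) => x x0.
by apply: inv_continuous; rewrite gt_eqF.
Qed.

Lemma integrable_powR_monotone f a b s : 0 < a -> {homo f : x y / x <= y} ->
  leb.-integrable `[a, b] (EFin \o (fun x => x `^ s * f x)).
Proof.
move=> a0 f_nd; apply: measurable_bounded_integrable => //.
- apply: (@le_lt_trans _ _ (lebesgue_measure (`[a, b]%classic : set R))) => //.
  by rewrite lebesgue_measure_itv/=; case: ifP => // _; rewrite -EFinB ltry.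
- apply: measurable_funM; last exact: nondecreasing_measurable.
  by apply: measurable_funTS; exact: measurable_powR.
- have [B hB] : exists B, forall x, a <= x <= b -> `|x `^ s| <= B.
    exists (a `^ s + b `^ s) => x /andP[ax xb]; have x0 := lt_le_trans a0 ax.
    rewrite ger0_norm ?powR_ge0//; have [s0|s0] := leP 0 s.
      apply: (@le_trans _ _ (b `^ s)); last by rewrite lerDr powR_ge0.
      by apply: ge0_ler_powR; rewrite ?nnegrE ?(ltW x0)// (le_trans (ltW x0)).
    apply: (@le_trans _ _ (a `^ s)); last by rewrite lerDl powR_ge0.
    rewrite -(opprK s) !(powRN _ (- s)) lef_pV2 ?posrE ?powR_gt0//.
    by apply: ge0_ler_powR; rewrite ?nnegrE ?(ltW x0) ?(ltW a0) ?oppr_ge0 ?(ltW s0).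
  exists (B * (`|f a| + `|f b|)); split; first exact: num_real.
  move=> M BM x /=; rewrite in_itv/= => xab; apply: (le_trans _ (ltW BM)).
  rewrite normrM ler_pM// ?hB//.
  have /andP[/f_nd fa /f_nd fb] := xab.
  by rewrite ler_norml; have := ler_norm (f b); have := ler_norm (- f a); rewrite normrN;
     have := normr_ge0 (f a); have := normr_ge0 (f b) => *; apply/andP; lra.
Qed.

Lemma Rintegral_chasles f a b c : a <= b -> b <= c ->
  leb.-integrable `[a, c] (EFin \o f) ->
  \int[leb]_(x in `[a, c]) f x =
    \int[leb]_(x in `[a, b]) f x + \int[leb]_(x in `[b, c]) f x.
Proof.
move=> ab bc intf.
have := Rintegral_itvB intf (x := b); rewrite !bnd_simp => /(_ ab bc).
rewrite Rintegral_itv_obnd_cbnd; first by move=> <-; rewrite addrC subrK.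
apply: integrableS intf => // x /=; rewrite !in_itv/= => /andP[bx ->].
by rewrite (le_trans ab)// ltW.
Qed.

(** The Lebesgue measure is [k] times its push-forward under multiplication by
    [k], by uniqueness of a measure with given values on intervals. *)
Lemma ge0_Rintegral_scale f k a b : 0 < k -> measurable_fun `[k * a, k * b]%classic f ->
  (forall x, 0 <= f x) ->
  \int[leb]_(x in `[k * a, k * b]) f x = k * \int[leb]_(x in `[a, b]) f (k * x).
Proof.
move=> k0 mf f0.
pose sc := fun x : measurableTypeR R => (k * x : measurableTypeR R).
have msc : measurable_fun [set: measurableTypeR R] sc by exact: mulrl_measurable.
pose sc_mf : {mfun measurableTypeR R >-> measurableTypeR R} :=
  HB.pack sc (isMeasurableFun.Build _ _ _ _ _ msc).
pose m := pushforward leb sc_mf.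
have kk : 0 <= k by exact: ltW.
have pre x y : sc @^-1` `[k * x, k * y]%classic = `[x, y]%classic.
  by apply/seteqP; split=> z /=; rewrite !in_itv/= !ler_pM2l.
have E (A : set (measurableTypeR R)) : measurable A -> leb A = mscale (NngNum kk) m A.
  move=> mA; apply: lebesgue_measure_unique => // _ [[x y] _ <-].
  transitivity (k%:E * leb (`](k^-1 * x)%R, (k^-1 * y)%R]%classic : set R))%E; last first.
    congr (_ * leb _)%E.
    by apply/seteqP; split=> z /=; rewrite !in_itv/= ltr_pdivrMl// ler_pdivlMl.
  rewrite !lebesgue_measure_itv/= !lte_fin ltr_pM2l ?invr_gt0//.
  case: ifP => _; last by rewrite mule0.
  by rewrite -!EFinB -EFinM mulrBr !mulVKf// gt_eqF.
rewrite /Rintegral (eq_measure_integral (mscale (NngNum kk) m)) => [|A mA _]; last exact: E.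
rewrite ge0_integral_mscale//; [|exact/measurable_EFinP|by move=> x _; rewrite lee_fin].
rewrite ge0_integral_pushforward//; [|exact/measurable_EFinP|by move=> x _; rewrite lee_fin].
rewrite pre.
rewrite -[RHS]/(k * fine (\int[leb]_(x in `[a, b]) (f (k * x))%:E)%E).
set I := (\int[_]_(x in _) _)%E; have I0 : (0 <= I)%E by apply: integral_ge0 => x _; rewrite lee_fin.
rewrite -/I; case: I I0 => [v| |] //= _.
by rewrite gt0_muley ?lte_fin//= mulr0.
Qed.

End positive_integrals.

(** * Averages of solutions of renewal equations *)

Section renewal_average.
Context {R : realType} {J : nat}.
Variables (p a : 'I_J -> R) (f : R -> R) (S : R).
Let mu := \sum_j p j * a j.
Hypotheses (p0 : forall j, 0 < p j) (p1 : \sum_j p j = 1)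
  (a_lower : exists2 amin : R, 0 < amin & forall j, amin <= a j)
  (f_bounded : forall T, exists B, forall t, 0 <= t <= T -> `|f t| <= B)
  (f_increments : forall eta, 0 < eta -> exists T, forall t, T <= t ->
    `|\sum_j p j * (f t - f (t - a j)) - S| <= eta).

(** [Q t = f t - S / mu * t] satisfies [Q t = \sum_j p j * Q (t - a j) + o(1)];
    as each step backwards has length at least [amin], [Q t] is [o(t)]. *)
Lemma renewal_average : (0 < J)%N -> forall eta, 0 < eta ->
  exists T, forall t, T <= t -> `|f t - S / mu * t| <= eta * t.
Proof.
move=> J0 eta eta0; have [amin am0 ham] := a_lower.
have a0 j : 0 < a j := lt_le_trans am0 (ham j).
have mu0 : 0 < mu.
  rewrite /mu (bigD1 (Ordinal J0))//= ltr_pwDl ?mulr_gt0//.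
  by apply: sumr_ge0 => j _; rewrite mulr_ge0// ltW.
pose A := \sum_i a i.
have aA i : a i <= A by rewrite /A (bigD1 i)//= lerDl sumr_ge0// => k _; exact: ltW.
have A0 : 0 < A by apply: lt_le_trans (aA (Ordinal J0)).
pose e := eta / 2 * amin.
have e0 : 0 < e by rewrite mulr_gt0// divr_gt0.
have [T1 hT1] := f_increments e0.
pose T := `|T1| + A.
have T1T : T1 <= T by rewrite /T; have := ler_norm T1; lra.
have AT : A <= T by rewrite /T; have := normr_ge0 T1; lra.
have [B0 hB0] := f_bounded T.
pose Q t := f t - S / mu * t.
pose B := B0 + `|S / mu| * T.
have Brec t : T <= t -> `|Q t - \sum_j p j * Q (t - a j)| <= e.
  move=> Tt; have := hT1 t (le_trans T1T Tt).
  have -> // : Q t - \sum_j p j * Q (t - a j) = \sum_j p j * (f t - f (t - a j)) - S.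
  have -> : S = \sum_j p j * (S / mu * a j).
    under eq_bigr do rewrite mulrCA; rewrite -mulr_sumr -/mu divfK// gt_eqF//.
  rewrite -{1}[Q t]mul1r -{1}p1 mulr_suml -!sumrB; apply: eq_bigr => j _.
  by rewrite /Q -mulrBr -mulrBr; congr (_ * _); ring.
have claim k : forall t, 0 <= t <= T + k%:R * amin -> `|Q t| <= B + eta / 2 * t.
  elim: k => [|k IH] t /andP[t0 tT].
    rewrite mul0r addr0 in tT.
    have h1 : `|f t| <= B0 by apply: hB0; rewrite t0.
    have h2 : `|S / mu * t| <= `|S / mu| * T by rewrite normrM (ger0_norm t0) ler_wpM2l.
    have h3 : 0 <= eta / 2 * t by rewrite mulr_ge0// divr_ge0// ltW.
    by apply: le_trans (ler_normB _ _) _; rewrite /B; lra.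
  have [tT'|Tt] := leP t T.
    by apply: IH; rewrite t0 (le_trans tT')// lerDl mulr_ge0// ltW.
  have h := Brec t (ltW Tt).
  have hs : `|\sum_j p j * Q (t - a j)| <= \sum_j p j * (B + eta / 2 * (t - amin)).
    apply: le_trans (ler_norm_sum _ _ _) _; apply: ler_sum => j _.
    rewrite normrM (gtr0_norm (p0 j)) ler_pM2l//.
    apply: (@le_trans _ _ (B + eta / 2 * (t - a j))).
      apply: IH; apply/andP; split; first by have := aA j; lra.
      by rewrite -natr1 mulrDl mul1r in tT; have := ham j; lra.
    by rewrite lerD2l ler_pM2l ?divr_gt0// lerB.
  rewrite -mulr_suml p1 mul1r in hs.
  have : `|Q t| <= `|Q t - \sum_j p j * Q (t - a j)| + `|\sum_j p j * Q (t - a j)|.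
    by rewrite -{1}(subrK (\sum_j p j * Q (t - a j)) (Q t)); exact: ler_normD.
  by rewrite /e in h *; lra.
exists (Num.max (Num.max T 0) (2 * B / eta)) => t; rewrite !ge_max => /andP[/andP[Tt t0] Bt].
have q0 : 0 <= t / amin by rewrite divr_ge0// ltW.
have /andP[_] := truncn_itv q0; rewrite ltr_pdivrMr// => tk.
have : `|Q t| <= B + eta / 2 * t.
  apply: (claim (Num.truncn (t / amin)).+1); rewrite t0/=.
  by apply: le_trans (ltW tk) _; rewrite lerDr; lra.
rewrite /Q; rewrite ler_pdivrMr// in Bt.
by move=> h; apply: (le_trans h); lra.
Qed.

End renewal_average.

(** * The renewal equation of the tube *)

Section exponential_substitution.
Context {R : realType}.

(** Renewal equations use the additive variable [t = - ln e]. *)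
Lemma cvg_at0_expR (f : R -> R) (l : R) :
  f e @[e --> 0^'+] --> l <->
  (forall eta, 0 < eta -> exists T, forall t, T <= t -> `|f (expR (- t)) - l| <= eta).
Proof.
split=> [/cvgrPdist_le h eta /h|h].
  move=> /nbhs_ballP[k /= k0 hk]; exists (1 - ln k) => t tk.
  rewrite distrC; apply: hk; last exact: expR_gt0.
  rewrite /ball /= sub0r normrN gtr0_norm ?expR_gt0//.
  by rewrite -[ltRHS]lnK ?posrE// ltr_expR; lra.
apply/cvgrPdist_le => eta /h[T hT]; near=> e.
have e0 : 0 < e by near: e; exact: nbhs_right_gt.
rewrite distrC -(@lnK _ e) ?posrE// -[ln e]opprK; apply: hT.
rewrite lerNr -ler_expR lnK ?posrE//.
by near: e; apply: nbhs_right_le; exact: expR_gt0.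
Unshelve. all: by end_near. Qed.

End exponential_substitution.

Definition log_scale {R : realType} (sg : R) (f : R -> R) (t : R) : R :=
  expR (- t) `^ sg * f (expR (- t)).

Section log_scale.
Context {R : realType} {J d : nat}.
Variables (r : 'I_J -> R) (kappa : nat -> R) (g v0 vG D : R) (W VG : R -> R).

Lemma expR_shift (r01 : forall j, 0 < r j < 1) t j :
  expR (- (t - - ln (r j))) = expR (- t) / r j.
Proof.
have /andP[r0 _] := r01 j.
by rewrite opprK opprD expRD (expRN (ln _)) lnK ?posrE.
Qed.

(** In logarithmic scales the recursion becomes a renewal equation, whose weights
    [r j `^ D] form a probability vector by Moran's equation. *)
Lemma log_scale_rec (H : tube_recursion d r kappa g v0 vG W VG) t :
  log_scale (D - d%:R) W t = log_scale (D - d%:R) VG t +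
    \sum_j r j `^ D * log_scale (D - d%:R) W (t - - ln (r j)).
Proof.
have r01 := rec_ratio H; have r0 j : 0 < r j by have /andP[] := r01 j.
rewrite /log_scale (rec_tube H) mulrDr mulr_sumr; congr (_ + _); apply: eq_bigr => j _.
have e0 := expR_gt0 (- t); rewrite (expR_shift r01); set e := expR _ in e0 *.
rewrite powRM ?(ltW e0) ?invr_ge0 ?(ltW (r0 j))//.
have -> : r j ^+ d = r j `^ D * (r j)^-1 `^ (D - d%:R).
  rewrite -powR_inv1 ?(ltW (r0 j))// -powRrM -powRD ?(gt_eqF (r0 j)) ?implybT//.
  by rewrite -powR_mulrn ?(ltW (r0 j))//; congr (_ `^ _); ring.
ring.
Qed.

End log_scale.

Section tube_renewal.
Context {R : realType} {J d : nat}.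
Variables (r : 'I_J -> R) (kappa : nat -> R) (g v0 vG D : R) (W VG : R -> R).
Hypotheses (H : tube_recursion d r kappa g v0 vG W VG)
  (kd : kappa d = - vG) (moran : \sum_j r j `^ D = 1) (dD : d%:R - 1 < D) (Dd : D < d%:R).
Local Notation leb := (@lebesgue_measure R).

Let r01 := rec_ratio H.
Let r0 j : 0 < r j. Proof. by have /andP[] := r01 j. Qed.
Let r1 j : r j < 1. Proof. by have /andP[] := r01 j. Qed.
Let g0 := rec_inradius H.
Let s := D - d%:R.
Let c u := u `^ (s - 1) * W u.
Let I a b := \int[leb]_(u in `[a, b]) c u.
Let p j := r j `^ D.
Let a j := - ln (r j).
(* A primitive of [u `^ (s - 1) * VG u] for [0 < u < g]. *)
Let Hpoly e := \sum_(m < d) kappa m * (e `^ (D - m%:R) / (D - m%:R)).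

(** The limit of [renewal_integral] at small scales. *)
Definition renewal_constant : R :=
  \sum_(m < d.+1) g `^ (D - m%:R) / (D - m%:R) * kappa m.
Local Notation S := renewal_constant.

Let s0 : s < 0. Proof. by rewrite subr_lt0. Qed.

Let integrable_c (b b' : R) : 0 < b -> leb.-integrable `[b, b'] (EFin \o c).
Proof. by move=> b0; apply: integrable_powR_monotone => //; exact: (rec_nondecreasing H). Qed.

Let Dm m : (m < d)%N -> 0 < D - m%:R.
Proof.
move=> md; have : m%:R + 1 <= d%:R :> R by rewrite natr1 ler_nat.
by have dD' := dD; lra.
Qed.

Let integral_poly e : 0 < e -> e <= g ->
  \int[leb]_(u in `[e, g]) (\sum_(m < d) kappa m * u `^ (D - m%:R - 1)) = Hpoly g - Hpoly e.
Proof.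
move=> e0 eg.
have dF (x : R) : 0 < x -> is_derive x 1 Hpoly (\sum_(m < d) kappa m * x `^ (D - m%:R - 1)).
  move=> x0.
  have -> : Hpoly = \sum_(m < d) (fun e : R => kappa m * (e `^ (D - m%:R) / (D - m%:R))).
    by apply/funext => y; rewrite fct_sumE.
  apply: is_derive_sum => m.
  have Dm0 := Dm (ltn_ord m).
  have -> : (fun e : R => kappa m * (e `^ (D - m%:R) / (D - m%:R))) =
      (fun e : R => kappa m / (D - m%:R) * e `^ (D - m%:R)).
    by apply/funext => y; ring.
  apply: is_derive_eq.
    by apply: is_deriveM; exact: is_derive1_powR.
  by rewrite scaler0 addr0 /GRing.scale /= mulrA divfK// gt_eqF.
apply: (FTC_positive e0 eg dF) => x x0.
apply: cvg_sumr => m; apply: cvgM; first exact: cvg_cst.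
exact: continuous_powR_pos.
Qed.

Let ratio_le e j : 0 < e -> e <= e / r j.
Proof. by move=> e0; rewrite ler_pdivlMr// ler_piMr// ltW. Qed.

Let measurable_c A : measurable_fun A c.
Proof.
apply: measurable_funTS; apply: measurable_funM; first exact: measurable_powR.
by apply: nondecreasing_measurable => //; exact: (rec_nondecreasing H).
Qed.

Let c_ge0 u : 0 <= c u.
Proof. by rewrite mulr_ge0 ?powR_ge0//; exact: (rec_ge0 H). Qed.

(* The substitution [u = r j * x]. *)
Let integral_c_scale e j : 0 < e -> e <= g ->
  p j * I (e / r j) (g / r j) =
    \int[leb]_(u in `[e, g]) (u `^ (s - 1) * (r j ^+ d * W (u / r j))).
Proof.
move=> e0 eg; rewrite /I ![_ / r j]mulrC ge0_Rintegral_scale ?invr_gt0// mulrA.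
have W_nd u v : u <= v -> W ((r j)^-1 * u) <= W ((r j)^-1 * v).
  by move=> uv; apply: (rec_nondecreasing H); rewrite ler_pM2l ?invr_gt0.
have intW : leb.-integrable `[e, g] (EFin \o (fun u => u `^ (s - 1) * W ((r j)^-1 * u))).
  exact: (integrable_powR_monotone _ _ e0 W_nd).
transitivity (\int[leb]_(u in `[e, g]) (r j ^+ d * (u `^ (s - 1) * W ((r j)^-1 * u)))); last first.
  by apply: eq_Rintegral => u _; rewrite mulrCA [u / _]mulrC.
rewrite RintegralZl//.
have -> : \int[leb]_(u in `[e, g]) c ((r j)^-1 * u) =
    (r j)^-1 `^ (s - 1) * \int[leb]_(u in `[e, g]) (u `^ (s - 1) * W ((r j)^-1 * u)).
  rewrite -RintegralZl//; apply: eq_Rintegral => u; rewrite inE /= in_itv/= => /andP[eu _].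
  by rewrite /c powRM ?invr_ge0 ?(ltW (r0 j)) ?(ltW (lt_le_trans e0 eu))// mulrA.
rewrite mulrA; congr (_ * _).
rewrite -powR_inv1 ?(ltW (r0 j))// -powRrM /p -!powRD; try by rewrite (gt_eqF (r0 j)) implybT.
rewrite -powR_mulrn ?(ltW (r0 j))//; congr (_ `^ _); rewrite /s; ring.
Qed.

(** In the variable [t = - ln e] this is [\sum_j p j * \int_(t - a j)^t Z] for the
    normalized volume [Z]; the renewal equation changes it only by the integral of
    the forcing term. *)
Definition renewal_integral e := \sum_j p j * I e (e / r j).

(** The recursion integrated against [u `^ (s - 1)] over [[e, g]]. *)
Let integral_VG e : 0 < e -> e <= g ->
  I e g - \sum_j p j * I (e / r j) (g / r j) = Hpoly g - Hpoly e.
Proof.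
move=> e0 eg; under eq_bigr do rewrite integral_c_scale//.
have intj j : leb.-integrable `[e, g] (EFin \o (fun u => u `^ (s - 1) * (r j ^+ d * W (u / r j)))).
  apply: (integrable_powR_monotone _ _ e0) => u v uv.
  rewrite ler_pM2l ?exprn_gt0//; apply: (rec_nondecreasing H).
  by rewrite ler_pM2r ?invr_gt0.
have sumE (l : seq 'I_J) :
    leb.-integrable `[e, g] (EFin \o (fun u => \sum_(j <- l) u `^ (s - 1) * (r j ^+ d * W (u / r j)))) /\
    \sum_(j <- l) \int[leb]_(u in `[e, g]) (u `^ (s - 1) * (r j ^+ d * W (u / r j))) =
    \int[leb]_(u in `[e, g]) (\sum_(j <- l) u `^ (s - 1) * (r j ^+ d * W (u / r j))).
  elim: l => [|j l [il IH]].
    split; last by rewrite big_nil; under eq_Rintegral do rewrite big_nil; rewrite Rintegral_cst// mul0r.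
    apply: eq_integrable (integrable0 _ _) => //.
    by move=> u _ /=; rewrite big_nil.
  split; last first.
    by rewrite big_cons IH -RintegralD//; apply: eq_Rintegral => u _; rewrite big_cons.
  apply: eq_integrable (integrableD _ (intj j) il) => //.
  by move=> u _ /=; rewrite big_cons EFinD.
have [ij ->] := sumE (index_enum _).
rewrite -RintegralB//; last exact: integrable_c.
rewrite -integral_poly//.
have E u : u \in (`[e, g[%classic : set R) ->
    c u - \sum_j u `^ (s - 1) * (r j ^+ d * W (u / r j)) =
    \sum_(m < d) kappa m * u `^ (D - m%:R - 1).
  rewrite inE /= in_itv/= => /andP[eu ug]; have u0 := lt_le_trans e0 eu.
  rewrite /c (rec_tube H) mulrDr mulr_sumr addrK (rec_generator_small H) ?u0//.
  rewrite mulr_sumr; apply: eq_bigr => m _; rewrite mulrCA; congr (_ * _).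
  rewrite -powR_mulrn ?(ltW u0)// -powRD; last by rewrite (gt_eqF u0) implybT.
  by congr (_ `^ _); rewrite natrB ?(ltW (ltn_ord m))// /s; [ring|exact: ltnW].
have int1 : leb.-integrable `[e, g] (EFin \o
    (fun u => c u - \sum_j u `^ (s - 1) * (r j ^+ d * W (u / r j)))).
  apply: eq_integrable (integrableB _ (integrable_c g e0) ij) => //.
have sub : `[e, g[%classic `<=` (`[e, g]%classic : set R).
  by move=> u /=; rewrite !in_itv/= => /andP[-> /ltW ->].
have int2 : leb.-integrable `[e, g[ (EFin \o
    (fun u => c u - \sum_j u `^ (s - 1) * (r j ^+ d * W (u / r j)))).
  exact: integrableS int1.
rewrite -Rintegral_itv_bndo_bndc// -[RHS]Rintegral_itv_bndo_bndc.
  by apply: eq_Rintegral.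
by apply: eq_integrable int2 => // u uI /=; rewrite E.
Qed.

(** Each window [[e, e / r j]] is [[e, g]] followed by [[g, g / r j]], without
    [[e / r j, g / r j]].  The first and last parts combine to [integral_VG], and
    the middle ones are explicit because [W] is constant beyond [g]. *)
Lemma renewal_integralE e : 0 < e -> e <= g -> renewal_integral e = S - Hpoly e.
Proof.
move=> e0 eg; have s0' := s0.
have split j : I e (e / r j) = I e g + I g (g / r j) - I (e / r j) (g / r j).
  have er := ratio_le j e0; have gr := ratio_le j g0.
  have egr : e / r j <= g / r j by rewrite ler_pM2r ?invr_gt0.
  have h1 := Rintegral_chasles er egr (integrable_c (g / r j) e0).
  have h2 := Rintegral_chasles eg gr (integrable_c (g / r j) e0).
  by rewrite /I -h2 h1; ring.
have Ig j : p j * I g (g / r j) = v0 * (g `^ s * (r j ^+ d - p j)) / s.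
  have gr := ratio_le j g0.
  have -> : I g (g / r j) = v0 * (((g / r j) `^ s - g `^ s) / s).
    rewrite -integral_powR ?lt_eqF// -RintegralZl//; last first.
      apply: eq_integrable (integrable_powR_monotone (g / r j) (s - 1) g0 (f := fun=> 1) _) => //.
      by move=> u _ /=; rewrite mulr1.
    apply: eq_Rintegral => u; rewrite inE /= in_itv/= => /andP[gu _].
    by rewrite /c (tube_large H)// mulrC.
  rewrite powRM ?invr_ge0 ?(ltW (r0 j)) ?(ltW g0)//.
  have -> : r j ^+ d = p j * (r j)^-1 `^ s.
    rewrite -powR_inv1 ?(ltW (r0 j))// -powRrM /p -powRD ?(gt_eqF (r0 j)) ?implybT//.
    by rewrite -powR_mulrn ?(ltW (r0 j))//; congr (_ `^ _); rewrite /s; ring.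
  by field; rewrite lt_eqF.
have sumIg : \sum_j p j * I g (g / r j) = - (vG * g `^ s / s).
  under eq_bigr do rewrite Ig.
  rewrite -!mulr_suml -!mulr_sumr sumrB moran.
  have : vG = v0 * (1 - \sum_j r j ^+ d).
    by have := rec_volume H; rewrite -mulr_suml; lra.
  by move=> ->; field; rewrite lt_eqF.
have -> : renewal_integral e =
    I e g - \sum_j p j * I (e / r j) (g / r j) + \sum_j p j * I g (g / r j).
  rewrite /renewal_integral -[X in X - _]mul1r -moran mulr_suml -sumrB -big_split/=.
  by apply: eq_bigr => j _; rewrite split /p; ring.
rewrite integral_VG// sumIg /S big_ord_recr/= kd -/s.
have -> : \sum_(i < d) g `^ (D - i%:R) / (D - i%:R) * kappa i = Hpoly g.
  by apply: eq_bigr => m _; rewrite mulrC.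
ring.
Qed.

Let Hpoly_cvg0 : Hpoly e @[e --> 0^'+] --> 0.
Proof.
have e0 : \sum_(m < d) kappa m * (0 / (D - m%:R)) = 0.
  by rewrite big1// => m _; rewrite mul0r mulr0.
rewrite -[X in _ --> X]e0 {e0}.
apply: cvg_sumr => m; apply: cvgM; first exact: cvg_cst.
apply: cvgM; last exact: cvg_cst.
exact: (powR_cvg0 (Dm (ltn_ord m))).
Qed.

Lemma renewal_integral_cvg : renewal_integral e @[e --> 0^'+] --> S.
Proof.
rewrite -[S]subr0; apply: cvg_trans (cvgB (cvg_cst S) Hpoly_cvg0).
apply: near_eq_cvg; near=> e; rewrite renewal_integralE//.
by near: e; apply: nbhs_right_le; exact: g0.
Unshelve. all: by end_near. Qed.

(** [Hpoly] increases from the limit [0], its derivative being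
    [e `^ (s - 1) * VG e], and the last term is positive because [s < 0]. *)
Lemma renewal_constant_gt0 : 0 < S.
Proof.
have g0' := g0; have s0' := s0.
have dif e : 0 < e -> e <= g -> 0 <= Hpoly g - Hpoly e.
  move=> e0 eg; rewrite -integral_poly//.
  have lt : leb.-integrable `[e, g] (EFin \o (fun u : R => \sum_(m < d) kappa m * u `^ (D - m%:R - 1))).
    apply: continuous_compact_integrable; first exact: segment_compact.
    apply: continuous_in_subspaceT => u /set_mem; rewrite /= in_itv/= => /andP[eu _].
    apply: cvg_sumr => m; apply: cvgM; first exact: cvg_cst.
    by apply: continuous_powR_pos; exact: lt_le_trans eu.
  rewrite -Rintegral_itv_bndo_bndc; last first.
    by apply: integrableS lt => // u /=; rewrite !in_itv/= => /andP[-> /ltW ->].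
  apply: Rintegral_ge0 => u; rewrite /= in_itv/= => /andP[eu ug].
  have u0 := lt_le_trans e0 eu.
  have -> : \sum_(m < d) kappa m * u `^ (D - m%:R - 1) = u `^ (s - 1) * VG u.
    rewrite (rec_generator_small H) ?u0// mulr_sumr; apply: eq_bigr => m _.
    rewrite mulrCA; congr (_ * _).
    rewrite -powR_mulrn ?(ltW u0)// -powRD; last by rewrite (gt_eqF u0) implybT.
    by congr (_ `^ _); rewrite natrB; [rewrite /s; ring|exact: ltnW].
  by rewrite mulr_ge0 ?powR_ge0//; exact: (rec_generator_ge0 H).
have Hg : 0 <= Hpoly g.
  rewrite leNgt; apply/negP => Hg; have Hg' : 0 < - Hpoly g by rewrite oppr_gt0.
  have /cvgrPdist_lt/(_ _ Hg') := Hpoly_cvg0.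
  move=> /(near0_exists g0)[e [he e0 eg]].
  have := dif e e0 (ltW eg); rewrite sub0r normrN in he.
  by have := ler_norm (- Hpoly e); rewrite normrN; lra.
rewrite /S big_ord_recr/= kd.
have -> : \sum_(i < d) g `^ (D - i%:R) / (D - i%:R) * kappa i = Hpoly g.
  by apply: eq_bigr => m _; rewrite mulrC.
rewrite ltr_wpDl// -/s.
have -> : g `^ s / s * - vG = (g `^ s * vG) / (- s) by field; rewrite lt_eqF.
rewrite divr_gt0 ?oppr_gt0// mulr_gt0 ?powR_gt0//; exact: (rec_generator H).
Qed.

End tube_renewal.

Section tube_asymptotics.
Context {R : realType} {J d : nat}.
Variables (r : 'I_J -> R) (kappa : nat -> R) (g v0 vG D : R) (W VG : R -> R).
Hypotheses (H : tube_recursion d r kappa g v0 vG W VG)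
  (kd : kappa d = - vG) (moran : \sum_j r j `^ D = 1) (dD : d%:R - 1 < D) (Dd : D < d%:R).
Local Notation leb := (@lebesgue_measure R).

Let r01 := rec_ratio H.
Let r0 j : 0 < r j. Proof. by have /andP[] := r01 j. Qed.
Let r1 j : r j < 1. Proof. by have /andP[] := r01 j. Qed.
Let g0 := rec_inradius H.
Let s := D - d%:R.
Let p j := r j `^ D.
Let a j := - ln (r j).
Let mu := \sum_j p j * a j.
Let Z := log_scale s W.
Let z := log_scale s VG.
Let M t := renewal_integral (d := d) r D W (expR (- t)).
Local Notation S := (renewal_constant (d := d) kappa g D).

Let s0 : s < 0. Proof. by rewrite subr_lt0. Qed.
Let p0 j : 0 < p j. Proof. exact: powR_gt0. Qed.
Let a0 j : 0 < a j. Proof. by rewrite oppr_gt0 ln_lt0. Qed.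

Let z_small eta : 0 < eta -> exists T, forall t, T <= t -> `|z t| <= eta.
Proof.
move=> eta0; have dD' := dD.
have [K K0 hK] := generator_tube_linear H.
have h : e `^ s * VG e @[e --> 0^'+] --> (0 : R).
  have s1 : 0 < s + 1 by rewrite /s; lra.
  apply: (@squeeze_cvgr _ _ _ _ (fun=> 0) (fun e => K * e `^ (s + 1))); last 2 first.
  - exact: cvg_cst.
  - by rewrite -[X in _ --> X](mulr0 K); apply: cvgM; [exact: cvg_cst|exact: (powR_cvg0 s1)].
  near=> e; have e0 : 0 < e by [].
  rewrite mulr_ge0 ?powR_ge0 ?(rec_generator_ge0 H)//=.
  rewrite powRD ?(gt_eqF e0) ?implybT// powRr1 ?(ltW e0)// mulrCA ler_wpM2l ?powR_ge0//.
  by apply: hK; rewrite e0; near: e; apply: nbhs_right_le; exact: g0.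
have [T hT] := proj1 (cvg_at0_expR _ _) h eta eta0.
by exists T => t /hT; rewrite subr0.
Unshelve. all: by end_near. Qed.

Let Z_ge0 t : 0 <= Z t.
Proof. by rewrite mulr_ge0 ?powR_ge0//; exact: (rec_ge0 H). Qed.

(** The upper bound holds at the exponent [D] itself, since
    [\sum_j r j `^ (d - 1) > 1] for [d - 1 < D]. *)
Let Z_bounded : exists2 B : R, 0 < B & exists T, forall t, T <= t -> Z t <= B.
Proof.
have alt : 1 < \sum_j r j `^ (d%:R - 1).
  by have := sum_ratio_powR_decr r01 (rec_index H) dD; rewrite moran.
have le1 : \sum_j r j `^ D <= 1 by rewrite moran.
have [A A0 hA] := tube_upper_bound H dD le1 (or_intror alt).
exists A => //; exists (- ln g) => t gt; rewrite /Z /log_scale.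
have e0 := expR_gt0 (- t); have eg : expR (- t) <= g.
  by rewrite -[leRHS]lnK ?posrE// ler_expR; lra.
set e := expR _ in e0 eg *.
have -> : A = e `^ s * (A * e `^ (d%:R - D)).
  rewrite mulrCA -powRD ?(gt_eqF e0) ?implybT//.
  have -> : s + (d%:R - D) = 0 by rewrite /s; ring.
  by rewrite powRr0 mulr1.
by rewrite ler_wpM2l ?powR_ge0//; apply: hA; rewrite e0.
Qed.

(** As [W] is monotone, only the power of [e] can make [Z] increase with [t]. *)
Let Z_slow w : 0 < w -> exists delta T, 0 < delta /\
  forall t u, T <= t -> t <= u <= t + delta -> Z u <= Z t + w.
Proof.
move=> w0; have s0' := s0; have [B B0 [T hT]] := Z_bounded.
have l0 : 0 < ln (1 + w / B) by rewrite ln_gt0// ltrDl divr_gt0.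
exists (ln (1 + w / B) / (- s)), T; split; first by rewrite divr_gt0 ?oppr_gt0.
move=> t u Tt /andP[tu ut].
apply: (@le_trans _ _ ((1 + w / B) * Z t)); last first.
  rewrite mulrDl mul1r lerD2l mulrAC ler_pdivrMr// ler_pM2l//; exact: hT.
rewrite /Z /log_scale mulrA; apply: ler_pM; rewrite ?powR_ge0 ?(rec_ge0 H)//; last first.
  by apply: (rec_nondecreasing H); rewrite ler_expR lerN2.
rewrite /powR !gt_eqF ?expR_gt0// !expRK.
have wB : 0 < 1 + w / B by rewrite ltr_wpDl// divr_gt0.
rewrite -{1}[1 + w / B]lnK ?posrE// -expRD ler_expR.
have : (u - t) * - s <= ln (1 + w / B) by rewrite -ler_pdivlMr ?oppr_gt0//; lra.
by lra.
Qed.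

Let A := \sum_i a i.

Let aA i : a i <= A.
Proof. by rewrite /A (bigD1 i)//= lerDl sumr_ge0// => k _; exact: ltW. Qed.

Let integral_inv_window c t j :
  \int[leb]_(u in `[expR (- t), expR (- t) / r j]) (u `^ (-1) * c) = c * a j.
Proof.
set e := expR (- t); have e0 : 0 < e by exact: expR_gt0.
have er : e <= e / r j by rewrite ler_pdivlMr// ler_piMr ?(ltW e0)// ltW.
have -> : a j = \int[leb]_(u in `[e, e / r j]) u^-1.
  by rewrite integral_inverse// ln_div ?posrE// /a; ring.
rewrite -RintegralZl//; last first.
  apply: eq_integrable (integrable_powR_monotone (e / r j) (-1) e0 (f := fun=> 1) _) => //.
  move=> u; rewrite inE /= in_itv/= => /andP[eu _].
  by rewrite mulr1 powR_inv1// ltW// (lt_le_trans e0).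
apply: eq_Rintegral => u; rewrite inE /= in_itv/= => /andP[eu _].
by rewrite mulrC powR_inv1// ltW// (lt_le_trans e0).
Qed.

Let window_integrand t j u : expR (- t) <= u <= expR (- t) / r j ->
  u `^ (s - 1) * W u = u `^ (-1) * Z (- ln u) /\ t - a j <= - ln u <= t.
Proof.
move=> /andP[eu uer]; have u0 := lt_le_trans (expR_gt0 _) eu.
split; first by rewrite /Z /log_scale opprK lnK ?posrE// mulrA -powRD ?(gt_eqF u0) ?implybT// addrC.
apply/andP; split.
  by rewrite lerNr -ler_expR lnK ?posrE// (expR_shift r01).
by rewrite lerNl -ler_expR lnK ?posrE.
Qed.

Let window_integral_ge c t j : (forall u, t - a j <= u <= t -> c <= Z u) ->
  c * a j <= \int[leb]_(u in `[expR (- t), expR (- t) / r j]) (u `^ (s - 1) * W u).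
Proof.
move=> h; have e0 := expR_gt0 (- t); rewrite -(integral_inv_window c t).
apply: le_Rintegral => //.
- exact: integrable_powR_monotone.
- by apply: integrable_powR_monotone => //; exact: (rec_nondecreasing H).
move=> u /=; rewrite in_itv/= => /window_integrand[-> /h].
by apply: ler_wpM2l; exact: powR_ge0.
Qed.

Let window_integral_le c t j : (forall u, t - a j <= u <= t -> Z u <= c) ->
  \int[leb]_(u in `[expR (- t), expR (- t) / r j]) (u `^ (s - 1) * W u) <= c * a j.
Proof.
move=> h; have e0 := expR_gt0 (- t); rewrite -(integral_inv_window c t).
apply: le_Rintegral => //.
- by apply: integrable_powR_monotone => //; exact: (rec_nondecreasing H).
- exact: integrable_powR_monotone.
move=> u /=; rewrite in_itv/= => /window_integrand[-> /h].
by apply: ler_wpM2l; exact: powR_ge0.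
Qed.

Let M_cvg eta : 0 < eta -> exists T, forall t, T <= t -> `|M t - S| <= eta.
Proof.
exact: (proj1 (cvg_at0_expR _ _) (renewal_integral_cvg H kd moran dD Dd)).
Qed.

(** The bound on upper limits applies to [Z] and to [- Z]. *)
Lemma nonlattice_tube_cvg : ~ lattice_type r ->
  W e * e `^ (D - d%:R) @[e --> 0^'+] --> S / mu.
Proof.
move=> nl.
have dense := nonlattice_words_dense (rec_index H) r01 nl.
have [B B0 [TB hB]] := Z_bounded.
have upper eta : 0 < eta -> exists T, forall t, T <= t -> Z t <= S / mu + eta.
  apply: (@renewal_limsup R J p a Z z M 0 A S (rec_index H) p0 moran a0) => //.
  - by move=> t _; exact: (log_scale_rec D H t).
  - by exists B, TB => t /hB; rewrite ger0_norm.
  - move=> w /Z_slow[delta [T [d0 hw]]]; exists delta, 0, T; split=> // t u Tt.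
    by rewrite subr0; exact: hw.
  - move=> c t _ h; rewrite /mu mulr_suml; apply: ler_sum => j _.
    rewrite -mulrA ler_pM2l// mulrC; apply: window_integral_ge => u /andP[u1 u2].
    by apply: h; rewrite u2 andbT; have := aA j; lra.
  - by move=> k /M_cvg[T hT]; exists T => t /hT; rewrite ler_distlC => /andP[+ _]; lra.
have lower eta : 0 < eta -> exists T, forall t, T <= t -> - Z t <= (- S) / mu + eta.
  apply: (@renewal_limsup R J p a (fun t => - Z t) (fun t => - z t) (fun t => - M t)
    0 A (- S) (rec_index H) p0 moran a0) => //.
  - move=> t _; rewrite {1}/Z (log_scale_rec D H t) opprD -sumrN; congr (_ + _).
    by apply: eq_bigr => j _; rewrite mulrN.
  - by move=> k /z_small[T hT]; exists T => t /hT; rewrite normrN.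
  - by exists B, TB => t /hB; rewrite normrN ger0_norm.
  - move=> w /Z_slow[delta [T [d0 hw]]]; exists delta, delta, (T + delta); split=> // t u Tt.
    rewrite subrK => /andP[u1 u2]; have : Z t <= Z u + w.
      by apply: hw; [lra|apply/andP; lra].
    by lra.
  - move=> c t _ h; rewrite lerNr -mulrN /mu mulr_suml; apply: ler_sum => j _.
    rewrite -mulrA (ler_pM2l (p0 j)) [leRHS]mulrC; apply: window_integral_le => u /andP[u1 u2].
    by rewrite lerNr; apply: h; rewrite u2 andbT; have := aA j; lra.
  - by move=> k /M_cvg[T hT]; exists T => t /hT; rewrite ler_distlC => /andP[_]; lra.
apply/cvg_at0_expR => eta eta0.
have [T1 h1] := upper eta eta0; have [T2 h2] := lower eta eta0.
exists (Num.max T1 T2) => t; rewrite ge_max => /andP[/h1 t1 /h2 t2].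
rewrite [W _ * _]mulrC -/s -/(log_scale s W t) -/Z ler_distlC; apply/andP.
by move: t2; rewrite mulNr; split; lra.
Qed.

Variables (V : R -> R) (K : R).
Hypotheses (K0 : 0 <= K) (V_nd : {homo V : x y / x <= y})
  (V_bounds : forall e, 0 < e <= 1 -> W e <= V e <= W e + K * e).

Let s1 : 0 < s + 1. Proof. by have := dD; rewrite /s; lra. Qed.

(** The difference is [O(e)], and [s + 1 > 0]. *)
Lemma tube_defect_cvg : V e * e `^ s - W e * e `^ s @[e --> 0^'+] --> (0 : R).
Proof.
apply: (@squeeze_cvgr _ _ _ _ (fun=> 0) (fun e => K * e `^ (s + 1))); last 2 first.
- exact: cvg_cst.
- by rewrite -[X in _ --> X](mulr0 K); apply: cvgM; [exact: cvg_cst|exact: (powR_cvg0 s1)].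
near=> e; have e0 : 0 < e by [].
have e1 : e <= 1 by near: e; apply: nbhs_right_le.
have /andP[V1 V2] : W e <= V e <= W e + K * e by apply: V_bounds; rewrite e0.
rewrite -mulrBl mulr_ge0 ?powR_ge0 ?subr_ge0//=.
rewrite powRD ?(gt_eqF e0) ?implybT// powRr1 ?(ltW e0)// [e `^ s * e]mulrC mulrA.
by rewrite ler_wpM2r ?powR_ge0//; lra.
Unshelve. all: by end_near. Qed.

Lemma nonlattice_measurable : ~ lattice_type r ->
  V e * e `^ (D - d%:R) @[e --> 0^'+] --> S / mu.
Proof.
move=> /nonlattice_tube_cvg h; rewrite -[X in _ --> X]add0r.
apply: cvg_trans (cvgD tube_defect_cvg h); apply: near_eq_cvg; near=> e.
by rewrite /= -/s subrK.
Unshelve. all: by end_near. Qed.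

(* In the variable [t] this is a primitive of [Z], and [M] is its weighted
   increment. *)
Let f t := \int[leb]_(u in `[expR (- t), 1]) (u `^ (s - 1) * W u).

Let intW e b : 0 < e -> leb.-integrable `[e, b] (EFin \o (fun u => u `^ (s - 1) * W u)).
Proof. by move=> e0; apply: integrable_powR_monotone => //; exact: (rec_nondecreasing H). Qed.

Let f_ge0 t : 0 <= f t.
Proof.
by apply: Rintegral_ge0 => u _; rewrite mulr_ge0 ?powR_ge0//; exact: (rec_ge0 H).
Qed.

Let exp_le1 (t : R) : 0 <= t -> expR (- t) <= 1.
Proof. by move=> t0; rewrite -expR0 ler_expR oppr_le0. Qed.

Let f_chasles (t u : R) : 0 <= u -> u <= t ->
  f t = \int[leb]_(u in `[expR (- t), expR (- u)]) (u `^ (s - 1) * W u) + f u.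
Proof.
move=> u0 ut; apply: Rintegral_chasles; [by rewrite ler_expR lerN2|exact: exp_le1|].
by apply: intW; exact: expR_gt0.
Qed.

Let f_average eta : 0 < eta -> exists T, forall t, T <= t -> `|f t - S / mu * t| <= eta * t.
Proof.
apply: (@renewal_average R J p a f S p0 moran) (rec_index H) _.
- have [lam /andP[lam0 lam1] hlam] := ratio_upper r01.
  exists (- ln lam); first by rewrite oppr_gt0 ln_lt0// lam0.
  by move=> j; rewrite lerN2 ler_ln ?posrE.
- move=> T; exists (f T) => t /andP[t0 tT]; rewrite ger0_norm ?f_ge0//.
  rewrite (f_chasles t0 tT) lerDr; apply: Rintegral_ge0 => u _.
  by rewrite mulr_ge0 ?powR_ge0//; exact: (rec_ge0 H).
- move=> k k0; have [T hT] := M_cvg k0; exists (Num.max T A) => t.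
  rewrite ge_max => /andP[/hT tT At]; move: tT.
  have -> // : M t = \sum_j p j * (f t - f (t - a j)).
  apply: eq_bigr => j _; congr (_ * _).
  have aj := aA j; have ta : 0 <= t - a j by lra.
  have tt : t - a j <= t by have := a0 j; lra.
  by rewrite (f_chasles ta tt) addrK (expR_shift r01).
Qed.

(** Up to the bounded contribution of [V - W] the average is [f t / t] with
    [t = ln T]. *)
Lemma tube_log_average :
  (ln T)^-1 * \int[leb]_(e in `[T^-1, 1]) (e `^ (- (d%:R - D)) * V e / e) @[T --> +oo]
    --> S / mu.
Proof.
have s1' := s1; have K0' := K0.
apply/cvgrPdist_le => eta eta0; have eta2 : 0 < eta / 2 by rewrite divr_gt0.
have [T0 hT0] := f_average eta2.
pose K' := K / (s + 1); have K'0 : 0 <= K' by rewrite divr_ge0// ltW.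
pose m := Num.max 1 (Num.max T0 (2 * K' / eta)).
near=> T.
have mT : expR m <= T by near: T; apply: nbhs_pinfty_ge; rewrite num_real.
have Tp : 0 < T := lt_le_trans (expR_gt0 _) mT.
have tE : T = expR (ln T) by rewrite lnK.
set t := ln T in tE *; have mt : m <= t by rewrite -ler_expR -tE.
have [t1 tT0 tK] : [/\ 1 <= t, T0 <= t & 2 * K' / eta <= t].
  by move: mt; rewrite /m !ge_max => /andP[-> /andP[-> ->]].
have t0 : 0 < t := lt_le_trans ltr01 t1.
have TE : T^-1 = expR (- t) by rewrite expRN -tE.
have e0 : 0 < expR (- t) by exact: expR_gt0.
have e1 : expR (- t) <= 1 by exact/exp_le1/ltW.
have intV : leb.-integrable `[expR (- t), 1] (EFin \o (fun u => u `^ (s - 1) * V u)).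
  exact: integrable_powR_monotone.
have ints : leb.-integrable `[expR (- t), 1] (EFin \o (fun u => u `^ s * K)).
  exact: integrable_powR_monotone.
have -> : \int[leb]_(e in `[T^-1, 1]) (e `^ (- (d%:R - D)) * V e / e) =
    \int[leb]_(u in `[expR (- t), 1]) (u `^ (s - 1) * V u).
  rewrite TE; apply: eq_Rintegral => u; rewrite inE /= in_itv/= => /andP[eu _].
  have u0 := lt_le_trans e0 eu.
  rewrite opprB -/s mulrAC powRD ?(gt_eqF u0) ?implybT//.
  by rewrite powR_inv1// ltW.
have Wle : f t <= \int[leb]_(u in `[expR (- t), 1]) (u `^ (s - 1) * V u).
  apply: le_Rintegral => //; first exact: intW.
  move=> u /=; rewrite in_itv/= => /andP[eu u1].
  rewrite ler_wpM2l ?powR_ge0//; have /andP[//] : W u <= V u <= W u + K * u.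
  by apply: V_bounds; rewrite u1 (lt_le_trans e0).
have Vle : \int[leb]_(u in `[expR (- t), 1]) (u `^ (s - 1) * V u) <= f t + K'.
  have -> : f t = \int[leb]_(u in `[expR (- t), 1]) (u `^ (s - 1) * V u) -
      \int[leb]_(u in `[expR (- t), 1]) (u `^ (s - 1) * V u - u `^ (s - 1) * W u).
    rewrite RintegralB//; [by rewrite opprB addrCA subrr addr0|exact: intW].
  suff : \int[leb]_(u in `[expR (- t), 1]) (u `^ (s - 1) * V u - u `^ (s - 1) * W u) <= K' by lra.
  apply: (@le_trans _ _ (\int[leb]_(u in `[expR (- t), 1]) (u `^ s * K))).
    apply: le_Rintegral => //.
      by apply: eq_integrable (integrableB _ intV (intW 1 e0)).
    move=> u /=; rewrite in_itv/= => /andP[eu u1]; have u0 := lt_le_trans e0 eu.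
    have /andP[_ Vu] : W u <= V u <= W u + K * u by apply: V_bounds; rewrite u0.
    rewrite -mulrBr; have -> : u `^ s * K = u `^ (s - 1) * (K * u).
      rewrite -{3}(powRr1 (ltW u0)) mulrCA -powRD ?(gt_eqF u0) ?implybT// subrK.
      exact: mulrC.
    by rewrite ler_wpM2l ?powR_ge0//; lra.
  have s1n : s + 1 != 0 by rewrite gt_eqF.
  have intp : leb.-integrable `[expR (- t), 1] (EFin \o (fun u : R => u `^ s)).
    apply: eq_integrable (integrable_powR_monotone 1 s e0 (f := fun=> 1) _) => //.
    by move=> u _ /=; rewrite mulr1.
  rewrite RintegralZr// -[X in \int[_]_(_ in _) (_ `^ X)](addrK 1 s) integral_powR//.
  rewrite powR1 /K' mulrAC ler_pM2r ?invr_gt0//.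
  by rewrite mulrBl mul1r gerBl mulr_ge0 ?powR_ge0.
set IV := \int[leb]_(u in _) _ in Wle Vle *.
have /ler_normlP[h1 h2] := hT0 t tT0.
have K't : K' <= eta / 2 * t by move: tK; rewrite ler_pdivrMr//; lra.
rewrite distrC ler_norml; apply/andP; split.
  rewrite lerBrDr -(ler_pM2l t0) mulVKf ?gt_eqF//.
  by rewrite mulrDr; lra.
rewrite lerBlDr -(ler_pM2l t0) mulVKf ?gt_eqF//.
by rewrite mulrDr; lra.
Unshelve. all: by end_near. Qed.

End tube_asymptotics.

(** * The lattice case *)

(** On an arithmetic progression the relations form a linear system with a
    Vandermonde matrix. *)
Lemma exponentials_independent (R : realType) (n : nat) (lam b : 'I_n -> R) (x0 delta : R) :
  injective lam -> 0 < delta ->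
  (forall k : nat, (k < n)%N -> \sum_i b i * expR (lam i * (x0 + k%:R * delta)) = 0) ->
  forall i, b i = 0.
Proof.
move=> lam_inj d0 h i.
pose w : 'rV[R]_n := \row_i expR (lam i * delta).
pose u : 'cV[R]_n := \col_i (b i * expR (lam i * x0)).
have Vu : Vandermonde n w *m u = 0.
  apply/colP => k; rewrite !mxE -[RHS](h k)//; apply: eq_bigr => j _.
  by rewrite !mxE -expRM_natr mulrCA -expRD; congr (_ * expR _); ring.
have unit : Vandermonde n w \in unitmx.
  rewrite unitmxE det_Vandermonde unitfE; apply/prodf_neq0 => j _.
  apply/prodf_neq0 => k jk; rewrite !mxE subr_eq0; apply/eqP => /expR_inj.
  move=> /(mulIf (lt0r_neq0 d0)) /lam_inj kj; by rewrite kj ltnn in jk.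
have : u = 0 by rewrite -[u](mulKmx unit) Vu mulmx0.
move=> /colP/(_ i); rewrite !mxE => /eqP; rewrite mulf_eq0 => /orP[/eqP//|].
by rewrite gt_eqF// expR_gt0.
Qed.

Section lattice_case.
Context {R : realType} {J d : nat}.
Variables (r : 'I_J -> R) (kappa : nat -> R) (g v0 vG D : R) (W VG : R -> R).
Hypotheses (H : tube_recursion d r kappa g v0 vG W VG)
  (moran : \sum_j r j `^ D = 1) (dD : d%:R - 1 < D) (Dd : D < d%:R).

Let r01 := rec_ratio H.
Let r0 j : 0 < r j. Proof. by have /andP[] := r01 j. Qed.
Let g0 := rec_inradius H.
Let s := D - d%:R.
Let p j := r j `^ D.
Let a j := - ln (r j).
Let Z := log_scale s W.
Let z := log_scale s VG.
Let p0 j : 0 < p j. Proof. exact: powR_gt0. Qed.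

Variables (h l : R) (n : 'I_J -> nat).
Hypotheses (h0 : 0 < h) (n0 : forall j, (0 < n j)%N) (aE : forall j, a j = (n j)%:R * h)
  (W_cvg : W e * e `^ (D - d%:R) @[e --> 0^'+] --> l).

(* The analogue of the renewal integral on the progression [x + N * h]. *)
Let M x N := \sum_j p j * \sum_(i < n j) Z (x + N%:R * h - i%:R * h).

(** The inner sums telescope to the renewal equation. *)
Let M_succ x N : M x N.+1 = M x N + z (x + N.+1%:R * h).
Proof.
apply/eqP; rewrite addrC -subr_eq -sumrB; apply/eqP.
transitivity (\sum_j p j * (Z (x + N.+1%:R * h) - Z (x + N.+1%:R * h - a j))).
  apply: eq_bigr => j _; rewrite -mulrBr -sumrB; congr (_ * _).
  rewrite aE.
  pose G i := Z (x + N.+1%:R * h - i%:R * h).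
  transitivity (\sum_(i < n j) (G i - G i.+1)).
    apply: eq_bigr => i _; rewrite /G; congr (_ - Z _).
    by rewrite -!natr1; ring.
  have tel m : \sum_(i < m) (G i - G i.+1) = G 0%N - G m.
    by elim: m => [|m IH]; rewrite ?big_ord0 ?subrr// big_ord_recr/= IH; ring.
  by rewrite tel /G mul0r subr0.
transitivity (z (x + N.+1%:R * h)); last by [].
under eq_bigr do rewrite mulrBr.
by rewrite sumrB -mulr_suml moran mul1r {1}/Z (log_scale_rec D H) addrK.
Qed.

Let M0 x : expR (- x) >= g -> M x 0 =
  (\sum_j p j * \sum_(i < n j) v0 * expR (s * i%:R * h)) * expR ((d%:R - D) * x).
Proof.
move=> gx; rewrite mulr_suml; apply: eq_bigr => j _; rewrite -mulrA; congr (_ * _).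
rewrite mulr_suml; apply: eq_bigr => i _; rewrite /Z /log_scale mul0r addr0.
have ih : 0 <= i%:R * h by rewrite mulr_ge0// ltW.
rewrite (tube_large H); last by apply: (le_trans gx); rewrite ler_expR; lra.
rewrite /powR gt_eqF ?expR_gt0// expRK mulrC -mulrA -expRD; congr (_ * expR _).
by rewrite /s; ring.
Qed.

Let z_small t : - ln g < t ->
  z t = \sum_(m < d) kappa m * expR ((m%:R - D) * t).
Proof.
move=> gt; have e0 := expR_gt0 (- t).
have eg : expR (- t) < g by rewrite -[ltRHS]lnK ?posrE// ltr_expR; lra.
rewrite /z /log_scale (rec_generator_small H) ?e0// mulr_sumr; apply: eq_bigr => m _.
rewrite mulrCA; congr (_ * _); rewrite /powR gt_eqF// expRK -expRM_natr -expRD.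
by congr expR; rewrite /s natrB; [ring|exact: ltnW].
Qed.

Let M_cvg x : M x N @[N --> \oo] --> l * \sum_j p j * (n j)%:R.
Proof.
rewrite mulr_sumr; apply: cvg_sumr => j; rewrite mulrCA; apply: cvgM; first exact: cvg_cst.
have -> : l * (n j)%:R = \sum_(i < n j) l by rewrite sumr_const card_ord mulr_natr.
apply: cvg_sumr => i; apply/cvgrPdist_le => eta eta0.
have [T hT] := proj1 (cvg_at0_expR _ _) W_cvg eta eta0.
near=> N; rewrite distrC /Z /log_scale mulrC; apply: hT.
suff : (T - x + i%:R * h) / h <= N%:R by rewrite ler_pdivrMr//; lra.
by near: N; exact: nbhs_infty_ger.
Unshelve. all: by end_near. Qed.

(** A limit [l] of the normalized volume would make [M x N] converge to a constant
    independent of [x].  Starting from the scales where [W] is constant and adding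
    up the increments, one finds for [x] in one period that the limit is a
    combination of the exponentials with exponents [m - D] for [m < d], whose
    coefficients are sums of geometric series, and of [A * expR ((d - D) * x)]
    with [A > 0].  The linear independence of these exponentials and of the
    constant function gives [A = 0]. *)
Lemma lattice_tube_not_cvg : False.
Proof.
have dD' := dD; have Dd' := Dd; have h0' := h0.
have Dm m : (m < d)%N -> m%:R - D < 0.
  by move=> md; have : m%:R + 1 <= d%:R :> R; [rewrite natr1 ler_nat|lra].
pose rho (m : nat) := expR ((m%:R - D) * h).
pose B (m : nat) := kappa m * (rho m / (1 - rho m)).
pose A := \sum_j p j * \sum_(i < n j) v0 * expR (s * i%:R * h).
have A0 : 0 < A.
  have n0' := n0; rewrite /A (bigD1 (Ordinal (rec_index H)))//= ltr_pwDl//.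
    apply: mulr_gt0 => //; case: (n _) (n0 (Ordinal (rec_index H))) => // k _.
    rewrite big_ord_recl ltr_pwDl ?mulr_gt0 ?expR_gt0 ?(rec_hull H)//.
    by apply: sumr_ge0 => i _; rewrite mulr_ge0 ?expR_ge0 ?(ltW (rec_hull H)).
  apply: sumr_ge0 => j _; rewrite mulr_ge0 ?(ltW (p0 j))//; apply: sumr_ge0 => i _.
  by rewrite mulr_ge0 ?expR_ge0 ?(ltW (rec_hull H)).
have key x : - ln g - h < x -> x <= - ln g ->
    A * expR ((d%:R - D) * x) + \sum_(m < d) B m * expR ((m%:R - D) * x)
      - l * \sum_j p j * (n j)%:R = 0.
  move=> x1 x2; apply/eqP; rewrite subr_eq0; apply/eqP.
  apply: (@cvg_unique _ _ (M x N @[N --> \oo])); [exact: Rhausdorff| |exact: M_cvg].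
  have -> : M x = (fun N => A * expR ((d%:R - D) * x) +
      \sum_(m < d) (kappa m * expR ((m%:R - D) * x)) * series (geometric (rho m) (rho m)) N).
    apply/funext; elim=> [|N IH].
      rewrite M0; last by rewrite -[leLHS]lnK ?posrE// ler_expR; lra.
      rewrite -/A -[LHS]addr0; congr (_ + _); rewrite big1// => m _.
      by rewrite /series /= big_geq// mulr0.
    rewrite M_succ IH z_small; last first.
      have Nh : 0 <= N%:R * h by rewrite mulr_ge0// ltW.
      by rewrite -natr1 mulrDl mul1r; lra.
    rewrite -addrA -big_split/=; congr (_ + _); apply: eq_bigr => m _.
    rewrite /series /= big_nat_recr//= [RHS]mulrDr; congr (_ + _).
    rewrite -[RHS]mulrA; congr (_ * _); rewrite -exprS /rho -expRM_natr -expRD.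
    by congr expR; ring.
  apply: cvgD; first exact: cvg_cst.
  apply: cvg_sumr => m; rewrite /B -mulrA [_ / _ * _]mulrC mulrA.
  apply: cvgM; first exact: cvg_cst.
  apply: cvg_geometric_series; rewrite gtr0_norm ?expR_gt0// -expR0 ltr_expR.
  by rewrite nmulr_rlt0// Dm.
pose N := d.+2.
pose lam (i : 'I_N) : R := if (i <= d)%N then i%:R - D else 0.
pose b (i : 'I_N) : R := if (i < d)%N then B i else if (i == d :> nat) then A
  else - (l * \sum_j p j * (n j)%:R).
have lam_neq0 (i : 'I_N) : (i <= d)%N -> i%:R - D != 0.
  rewrite leq_eqVlt => /predU1P[->|id]; first by rewrite gt_eqF// subr_gt0.
  by rewrite lt_eqF// Dm.
have lam_inj : injective lam.
  move=> i k; rewrite /lam; case: leqP => id; case: leqP => kd.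
  - move=> /(addIr _) /eqP; rewrite eqr_nat => /eqP ik; exact: val_inj.
  - by move/eqP; rewrite (negbTE (lam_neq0 _ id)).
  - by move/esym/eqP; rewrite (negbTE (lam_neq0 _ kd)).
  - move=> _; apply: val_inj.
    have top (m : 'I_N) : (d < m)%N -> m = d.+1 :> nat.
      by move=> dm; apply/eqP; rewrite eqn_leq dm -ltnS ltn_ord.
    exact: etrans (top i id) (esym (top k kd)).
pose delta := h / N.+1%:R.
have delta0 : 0 < delta by rewrite divr_gt0// ltr0n.
have Nd : N.+1%:R * delta = h by rewrite /delta mulrC divfK// pnatr_eq0.
have := @exponentials_independent R N lam b (- ln g - h + delta) delta lam_inj delta0.
move=> /(_ _ (Ordinal (ltnW (ltnSn d.+1)))) bd.
suff /bd : forall k, (k < N)%N -> \sum_i b i * expR (lam i * (- ln g - h + delta + k%:R * delta)) = 0.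
  by rewrite /b /= ltnn eqxx => A00; rewrite A00 ltxx in A0.
move=> k kN; set x := - ln g - h + delta + k%:R * delta.
have x1 : - ln g - h < x.
  have kd : 0 <= k%:R * delta by rewrite mulr_ge0// ltW.
  by rewrite /x; lra.
have x2 : x <= - ln g.
  have : (k%:R + 1) * delta <= N.+1%:R * delta.
    by rewrite ler_pM2r// natr1 ler_nat; lia.
  by rewrite /x Nd; lra.
rewrite -[RHS](key x x1 x2) !big_ord_recr/= /b /lam /= ltnn eqxx leqnn.
have -> : (d.+1 < d)%N = false by rewrite ltnNge leqnSn.
have -> : (d.+1 == d)%N = false by rewrite gtn_eqF.
rewrite mul0r expR0 mulr1 [X in X - _]addrC; congr (_ + _ - _).
by apply: eq_bigr => i _; rewrite /= ltn_ord (ltnW (ltn_ord i)).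
Qed.

End lattice_case.

(** * Divided differences and principal parts *)

Section analytic_order.
Context {K : numFieldType}.
Local Notation fn := (K^o -> K^o).
Implicit Types (f g u v : fn) (w c : K^o).

(** [analytic k f w]: the function [f] and its first [k] iterated divided
    differences at [w] are differentiable near [w].  This weak form of
    analyticity is stable under the field operations, by the algebraic rules
    for divided differences, and suffices to split off principal parts. *)
Fixpoint analytic (k : nat) f w : Prop :=
  if k is k'.+1 then exists c u, analytic k' u w /\
      \forall s \near w, f s = c + (s - w) * u s
  else \forall s \near w, derivable f s 1.

Lemma analytic0P f w : analytic 0 f w <-> \forall s \near w, derivable f s 1.
Proof. by []. Qed.

Lemma analyticSP k f w : analytic k.+1 f w <-> exists c u, analytic k u w /\
  \forall s \near w, f s = c + (s - w) * u s.
Proof. by []. Qed.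

Lemma analytic_near_eq k f g w : (\forall s \near w, f s = g s) ->
  analytic k f w -> analytic k g w.
Proof.
case: k => [|k] fg.
  move=> /analytic0P df; apply/analytic0P; have fg' := near_join fg; near=> s.
  apply: (@near_eq_derivable _ _ _ f) => //; last by near: s.
  by near: s.
move=> /analyticSP[c [u [au fE]]]; apply/analyticSP; exists c, u; split=> //.
near=> s; have <- : f s = g s by near: s.
by near: s.
Unshelve. all: by end_near. Qed.

Let near_all (P : K^o -> Prop) w : (forall s, P s) -> \forall s \near w, P s.
Proof. by move=> h; near=> s; exact: h. Unshelve. all: by end_near. Qed.

Let derivable_affine f c u w s : derivable u s 1 ->
  derivable (fun s => c + (s - w) * u s : K^o) s 1.
Proof.
move=> du; apply: (@derivableD _ _ _ (cst c) (fun s => (s - w) * u s : K^o)).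
  exact: derivable_cst.
exact: (@derivableM _ _ (fun s => s - w : K^o) u).
Qed.

Lemma analyticW k f w : analytic k.+1 f w -> analytic k f w.
Proof.
elim: k f => [|k IH] f /analyticSP[c [u [au fE]]].
  have af : analytic 0 (fun s => c + (s - w) * u s) w.
    move: au => /analytic0P au; apply/analytic0P.
    by apply: filterS au => s; exact: derivable_affine.
  by apply: analytic_near_eq af; apply: filterS fE => s ->.
apply/analyticSP; exists c, u; split=> //; exact: IH.
Qed.

Lemma analytic_cst k c w : analytic k (fun=> c) w.
Proof.
elim: k c => [|k IH] c.
  by apply/analytic0P; apply: near_all => s; exact: derivable_cst.
apply/analyticSP; exists c, (fun=> 0); split; [exact: IH|by apply: near_all => s; rewrite mulr0 addr0].
Qed.

Lemma analyticD k f g w : analytic k f w -> analytic k g w ->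
  analytic k (fun s => f s + g s) w.
Proof.
elim: k f g => [|k IH] f g.
  move=> /analytic0P df /analytic0P dg; apply/analytic0P.
  by apply: filterS2 df dg => s; exact: derivableD.
move=> /analyticSP[c [u [au fE]]] /analyticSP[c' [u' [au' gE]]].
apply/analyticSP; exists (c + c'), (fun s => u s + u' s); split; first exact: IH.
near=> s; have -> : f s = c + (s - w) * u s by near: s.
have -> : g s = c' + (s - w) * u' s by near: s.
by rewrite mulrDr addrACA.
Unshelve. all: by end_near. Qed.

Lemma analytic_shift k w : analytic k (fun s => s - w) w.
Proof.
case: k => [|k].
  by apply/analytic0P; apply: near_all => s; apply: (@derivableB _ _ _ id (cst w)); [exact: derivable_id|exact: derivable_cst].
apply/analyticSP; exists 0, (fun=> 1); split; first exact: analytic_cst.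
by apply: near_all => s; rewrite add0r mulr1.
Qed.

Lemma analyticM k f g w : analytic k f w -> analytic k g w ->
  analytic k (fun s => f s * g s) w.
Proof.
elim: k f g => [|k IH] f g.
  move=> /analytic0P df /analytic0P dg; apply/analytic0P.
  by apply: filterS2 df dg => s; exact: derivableM.
move=> af ag; have af' := analyticW af; have ag' := analyticW ag.
move: af ag => /analyticSP[c [u [au fE]]] /analyticSP[c' [u' [au' gE]]].
apply/analyticSP; exists (c * c'), (fun s => u s * g s + c * u' s); split.
  by apply: analyticD; apply: IH => //; exact: analytic_cst.
near=> s; have -> : f s = c + (s - w) * u s by near: s.
have -> : g s = c' + (s - w) * u' s by near: s.
ring.
Unshelve. all: by end_near. Qed.

Lemma analytic_neq0 f w : analytic 0 f w -> f w != 0 -> \forall s \near w, f s != 0.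
Proof.
move=> af fw; have df : derivable f w 1 by exact: (nbhs_singleton af).
have cf : {for w, continuous f}.
  by apply: differentiable_continuous; apply/derivable1_diffP.
exact: (@cvgr_neq0 _ K^o _ _ _ f (f w) cf fw).
Qed.

(** The divided difference of [f^-1] is [- u / (c * f)]. *)
Lemma analyticV k f w : analytic k f w -> f w != 0 -> analytic k (fun s => (f s)^-1) w.
Proof.
elim: k f => [|k IH] f af fw.
  have f0 := analytic_neq0 af fw; move: af => /analytic0P df; apply/analytic0P.
  by apply: filterS2 f0 df => s; exact: derivableV.
have af' := analyticW af; have af0 : analytic 0 f w by elim: k {IH af'} af => [|k IH'] /analyticW.
have f0 := analytic_neq0 af0 fw.
move: af => /analyticSP[c [u [au fE]]].
have cE : f w = c by rewrite (nbhs_singleton fE) subrr mul0r addr0.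
apply/analyticSP; exists c^-1, (fun s => - c^-1 * (u s * (f s)^-1)); split.
  apply: analyticM; first exact: analytic_cst.
  by apply: analyticM => //; exact: IH.
rewrite cE in fw; near=> s.
have fs : f s != 0 by near: s.
have fsE : f s = c + (s - w) * u s by near: s.
apply: (mulIf fs); rewrite mulVf// mulrDl.
have -> : (s - w) * (- c^-1 * (u s * (f s)^-1)) * f s = - (c^-1 * ((s - w) * u s)).
  by field; rewrite fw fs.
by rewrite fsE; field.
Unshelve. all: by end_near. Qed.

Lemma analytic_sum k n (f : 'I_n -> fn) w : (forall i, analytic k (f i) w) ->
  analytic k (fun s => \sum_(i < n) f i s) w.
Proof.
elim: n f => [|n IH] f af.
  apply: analytic_near_eq (analytic_cst k 0 w).
  by apply: near_all => s; rewrite big_ord0.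
apply: analytic_near_eq (analyticD (IH _ (fun i => af (widen_ord (leqnSn n) i))) (af ord_max)).
by apply: near_all => s; rewrite big_ord_recr.
Qed.

Lemma cvg_of_linear_bound (q : fn) (l B : K) (delta : K) : 0 < delta -> 0 <= B ->
  (forall h, h != 0 -> `|h| <= delta -> `|q h - l| <= B * `|h|) ->
  q h @[h --> (0 : K^o)^'] --> (l : K^o).
Proof.
move=> d0 B0 hq; apply/cvgrPdist_le => e e0.
have B1 : 0 < B + 1 by rewrite ltr_wpDl.
have eB : 0 < e / (B + 1) by rewrite divr_gt0.
near=> h.
have h0 : h != 0 by near: h; exact: nbhs_dnbhs_neq.
have hd : `|h| <= delta.
  by near: h; apply: dnbhs0_le.
have he : `|h| <= e / (B + 1).
  by near: h; apply: dnbhs0_le.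
rewrite distrC; apply: le_trans (hq h h0 hd) _.
apply: (@le_trans _ _ ((B + 1) * (e / (B + 1)))); last by rewrite mulrC divfK// gt_eqF.
by rewrite ler_pM// lerDl.
Unshelve. all: by end_near. Qed.

End analytic_order.

(** * Complex exponential and powers *)

Section complex_exponential.
Context {R : realType}.
Implicit Types (x y t : R) (z w s : R[i]).

Local Notation normc := ComplexField.Normc.normc.

Definition cexp z : R[i] :=
  (expR (complex.Re z) * cos (complex.Im z)) +i* (expR (complex.Re z) * sin (complex.Im z)).

Lemma cexpD z w : cexp (z + w) = cexp z * cexp w.
Proof.
case: z w => [a b] [c d]; rewrite /cexp /= expRD cosD sinD.
by apply/eqP; rewrite eq_complex /=; apply/andP; split; apply/eqP; ring.
Qed.

Lemma cexp0 : cexp 0 = 1.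
Proof. by rewrite /cexp /= expR0 cos0 sin0 mul1r mulr0. Qed.

Lemma cpowE x s : cpow x s = cexp (s * (ln x)%:C).
Proof. by case: s => a b; rewrite /cpow /cexp /= !mulr0 subr0 add0r. Qed.

Lemma cpow_real x t : 0 < x -> cpow x t%:C = (x `^ t)%:C.
Proof.
by move=> x0; rewrite /cpow /= mul0r cos0 sin0 mulr1 mulr0 /powR gt_eqF.
Qed.

Lemma cpowN x s : cpow x s * cpow x (- s) = 1.
Proof. by rewrite !cpowE -cexpD mulNr subrr cexp0. Qed.

Let ReD z w : complex.Re (z + w) = complex.Re z + complex.Re w.
Proof. by case: z w => [a b] [c d]. Qed.

Let ImD z w : complex.Im (z + w) = complex.Im z + complex.Im w.
Proof. by case: z w => [a b] [c d]. Qed.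

Let ReN z : complex.Re (- z) = - complex.Re z.
Proof. by case: z. Qed.

Let ImN z : complex.Im (- z) = - complex.Im z.
Proof. by case: z. Qed.

Let Re_sum n (f : 'I_n -> R[i]) :
  complex.Re (\sum_(i < n) f i) = \sum_(i < n) complex.Re (f i).
Proof.
by elim: n f => [|n IH] f; rewrite ?big_ord0// !big_ord_recr/= ReD IH.
Qed.

Let Im_sum n (f : 'I_n -> R[i]) :
  complex.Im (\sum_(i < n) f i) = \sum_(i < n) complex.Im (f i).
Proof.
by elim: n f => [|n IH] f; rewrite ?big_ord0// !big_ord_recr/= ImD IH.
Qed.

Let ReMr z t : complex.Re (z * t%:C) = complex.Re z * t.
Proof. by case: z => a b /=; rewrite mulr0 subr0. Qed.

Let ImMr z t : complex.Im (z * t%:C) = complex.Im z * t.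
Proof. by case: z => a b /=; rewrite mulr0 add0r. Qed.

Let real_complexX t n : t%:C ^+ n = (t ^+ n)%:C :> R[i].
Proof. by rewrite rmorphXn. Qed.

(** The Taylor remainder is taken along the ray from [0] to [z], so that the real
    mean value theorem applies to its real and imaginary parts. *)
Definition cexp_remainder k z t : R[i] :=
  cexp (z * t%:C) - \sum_(j < k) z ^+ j / j`!%:R * t%:C ^+ j.

Let is_derive_power_sum k (c : nat -> R) t :
  is_derive t 1 (fun t => \sum_(j < k.+1) c j * t ^+ j)
    (\sum_(j < k) c j.+1 * j.+1%:R * t ^+ j).
Proof.
have -> : (fun t => \sum_(j < k.+1) c j * t ^+ j) = horner (\poly_(j < k.+1) c j).
  by apply/funext => u; rewrite horner_poly.
apply: is_derive_eq; rewrite (@horner_coef_wide _ k); last first.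
  by apply/leq_sizeP => j kj; rewrite coef_deriv coef_poly ltnS ltnNge kj mul0rn.
by apply: eq_bigr => j _; rewrite coef_deriv coef_poly ltnS ltn_ord mulr_natr.
Qed.

Let is_derive_cexp z t :
  is_derive t 1 (fun t => complex.Re (cexp (z * t%:C)))
    (complex.Re (z * cexp (z * t%:C))) /\
  is_derive t 1 (fun t => complex.Im (cexp (z * t%:C)))
    (complex.Im (z * cexp (z * t%:C))).
Proof.
case: z => x y.
have dl u : is_derive t 1 (fun t => u * t) u.
  by apply: is_derive_eq (is_deriveZ u (is_derive_id t 1)) _; rewrite /GRing.scale/= mulr1.
have de := is_derive1_comp (is_derive_expR (x * t)) (dl x).
have dc := is_derive1_comp (is_derive_cos (y * t)) (dl y).
have ds := is_derive1_comp (is_derive_sin (y * t)) (dl y).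
split.
- have -> : (fun t => complex.Re (cexp ((x +i* y) * t%:C))) =
      (expR \o (fun t => x * t)) * (cos \o (fun t => y * t)).
    by apply/funext => u; rewrite /cexp ReMr ImMr.
  apply: (is_derive_eq (is_deriveM de dc)).
  by rewrite /cexp /= !mulr0 subr0 add0r /GRing.scale /=; ring.
- have -> : (fun t => complex.Im (cexp ((x +i* y) * t%:C))) =
      (expR \o (fun t => x * t)) * (sin \o (fun t => y * t)).
    by apply/funext => u; rewrite /cexp ReMr ImMr.
  apply: (is_derive_eq (is_deriveM de ds)).
  by rewrite /cexp /= !mulr0 subr0 add0r /GRing.scale /=; ring.
Qed.

Let is_derive_remainder k z t :
  is_derive t 1 (fun t => complex.Re (cexp_remainder k.+1 z t))
    (complex.Re (z * cexp_remainder k z t)) /\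
  is_derive t 1 (fun t => complex.Im (cexp_remainder k.+1 z t))
    (complex.Im (z * cexp_remainder k z t)).
Proof.
have [dre dim] := is_derive_cexp z t.
have zE : z * cexp_remainder k z t = z * cexp (z * t%:C) -
    \sum_(j < k) (z ^+ j.+1 / j.+1`!%:R * j.+1%:R) * t%:C ^+ j.
  rewrite /cexp_remainder mulrBr mulr_sumr; congr (_ - _); apply: eq_bigr => j _.
  rewrite factS natrM invfM exprS.
  have j1 : j.+1%:R != 0 :> R[i] by rewrite pnatr_eq0.
  have j2 : j`!%:R != 0 :> R[i] by rewrite pnatr_eq0 -lt0n fact_gt0.
  move: (j.+1%:R : R[i]) (j`!%:R : R[i]) j1 j2 => a b a0 b0.
  by field; rewrite a0 b0.
split.
- have -> : (fun t => complex.Re (cexp_remainder k.+1 z t)) =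
      (fun t => complex.Re (cexp (z * t%:C))) -
      (fun t => \sum_(j < k.+1) complex.Re (z ^+ j / j`!%:R) * t ^+ j).
    apply/funext => u; rewrite /cexp_remainder ReD ReN Re_sum; congr (_ - _).
    by apply: eq_bigr => j _; rewrite real_complexX ReMr.
  apply: (is_derive_eq (is_deriveB dre (is_derive_power_sum k (fun j => complex.Re (z ^+ j / j`!%:R)) t))).
  rewrite zE ReD ReN Re_sum; congr (_ - _); apply: eq_bigr => j _.
  by rewrite real_complexX ReMr -[j.+1%:R in RHS](rmorph_nat (real_complex R)) ReMr.
- have -> : (fun t => complex.Im (cexp_remainder k.+1 z t)) =
      (fun t => complex.Im (cexp (z * t%:C))) -
      (fun t => \sum_(j < k.+1) complex.Im (z ^+ j / j`!%:R) * t ^+ j).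
    apply/funext => u; rewrite /cexp_remainder ImD ImN Im_sum; congr (_ - _).
    by apply: eq_bigr => j _; rewrite real_complexX ImMr.
  apply: (is_derive_eq (is_deriveB dim (is_derive_power_sum k (fun j => complex.Im (z ^+ j / j`!%:R)) t))).
  rewrite zE ImD ImN Im_sum; congr (_ - _); apply: eq_bigr => j _.
  by rewrite real_complexX ImMr -[j.+1%:R in RHS](rmorph_nat (real_complex R)) ImMr.
Qed.

Let mean_value_bound (f df : R -> R) K t : 0 <= t <= 1 -> f 0 = 0 ->
  (forall u : R, is_derive u 1 f (df u)) -> (forall u, 0 <= u <= 1 -> `|df u| <= K) ->
  `|f t| <= K.
Proof.
move=> /andP[t0 t1] f0 fdf dfK.
have K0 : 0 <= K by apply: le_trans (dfK 0 _); rewrite ?lexx ?ler01.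
have cf : {within `[0, t], continuous f}.
  apply: continuous_subspaceT => u; apply: differentiable_continuous.
  by apply/derivable1_diffP; apply: ex_derive.
have [u] := MVT_segment t0 (fun u _ => fdf u) cf.
rewrite f0 !subr0 in_itv/= => /andP[u0 ut] ->.
rewrite normrM (ger0_norm t0) -[leRHS]mulr1 ler_pM// dfK// u0 /=.
exact: le_trans ut t1.
Qed.

(** The derivative of the remainder of order [k.+1] along the ray is [z] times the
    remainder of order [k]. *)
Lemma cexp_remainder_le k z t : 0 <= t <= 1 ->
  let B := expR `|complex.Re z| * (`|complex.Re z| + `|complex.Im z|) ^+ k in
  `|complex.Re (cexp_remainder k z t)| <= B /\
  `|complex.Im (cexp_remainder k z t)| <= B.
Proof.
case: z => x y /=; elim: k t => [|k IH] t t01.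
  rewrite expr0 mulr1 /cexp_remainder big_ord0 subr0 /cexp /= mulr0 subr0 mulr0 add0r.
  have xt : expR (x * t) <= expR `|x|.
    rewrite ler_expR; apply: le_trans (ler_norm _) _; rewrite normrM.
    by move: t01 => /andP[t0 t1]; rewrite (ger0_norm t0) ler_piMr.
  split; rewrite normrM (ger0_norm (expR_ge0 _)) -[leRHS]mulr1 ler_pM ?expR_ge0//.
    by rewrite ler_norml cos_geN1 cos_le1.
  by rewrite ler_norml sin_geN1 sin_le1.
pose M := `|x| + `|y|; rewrite -/M.
have M0 : 0 <= M by rewrite addr_ge0.
have step (a b u v : R) : `|a| <= `|x| -> `|b| <= `|y| ->
    `|u| <= expR `|x| * M ^+ k -> `|v| <= expR `|x| * M ^+ k ->
    `|a * u + b * v| <= expR `|x| * M ^+ k.+1.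
  move=> ax bx uB vB; apply: le_trans (ler_normD _ _) _.
  rewrite exprS mulrCA /M mulrDl !normrM.
  by rewrite lerD// ler_pM.
have r0 : cexp_remainder k.+1 (x +i* y) 0 = 0.
  rewrite /cexp_remainder mulr0 cexp0 big_ord_recl expr0 fact0 expr0 big1; last first.
    by move=> i _; rewrite /= expr0n /= mulr0.
  by rewrite divr1 mulr1 addr0 subrr.
split.
- apply: (@mean_value_bound (fun t => complex.Re (cexp_remainder k.+1 (x +i* y) t))
      (fun t => complex.Re ((x +i* y) * cexp_remainder k (x +i* y) t))) => //.
  + by rewrite r0.
  + by move=> u; have [] := is_derive_remainder k (x +i* y) u.
  + move=> u u01; have [] := IH u u01; case: (cexp_remainder _ _ _) => a b /= aB bB.
    by rewrite -mulNr; apply: step => //; rewrite normrN.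
- apply: (@mean_value_bound (fun t => complex.Im (cexp_remainder k.+1 (x +i* y) t))
      (fun t => complex.Im ((x +i* y) * cexp_remainder k (x +i* y) t))) => //.
  + by rewrite r0.
  + by move=> u; have [] := is_derive_remainder k (x +i* y) u.
  + move=> u u01; have [] := IH u u01; case: (cexp_remainder _ _ _) => a b /= aB bB.
    exact: step.
Qed.

Lemma cexp_taylor k z : `|z| <= 1 ->
  `|cexp z - \sum_(j < k) z ^+ j / j`!%:R| <= (expR 1 * 2 ^+ k.+1)%:C * `|z| ^+ k.
Proof.
move=> z1.
have normE w : `|w| = (normc w)%:C by [].
have norm_ge w : `|complex.Re w| <= normc w /\ `|complex.Im w| <= normc w.
  case: w => a b /=; rewrite -!sqrtr_sqr; split; apply: ler_wsqrtr.
    by rewrite lerDl sqr_ge0.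
  by rewrite lerDr sqr_ge0.
have norm_le w : normc w <= `|complex.Re w| + `|complex.Im w|.
  case: w => a b /=; rewrite -[leRHS]ger0_norm ?addr_ge0// -sqrtr_sqr.
  apply: ler_wsqrtr; rewrite sqrrD !real_normK ?num_real//.
  by rewrite lerD2r lerDl mulrn_wge0// mulr_ge0.
have z1' : normc z <= 1 by move: z1; rewrite normE lecR.
have remE : cexp z - \sum_(j < k) z ^+ j / j`!%:R = cexp_remainder k z 1.
  rewrite /cexp_remainder mulr1; congr (_ - _); apply: eq_bigr => j _.
  by rewrite expr1n mulr1.
rewrite remE !normE real_complexX -(rmorphM (real_complex R)) lecR.
have [rz iz] := norm_ge z.
have [] := @cexp_remainder_le k z 1 _; first by rewrite ler01 lexx.
have : expR `|complex.Re z| * (`|complex.Re z| + `|complex.Im z|) ^+ k <=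
    expR 1 * (2 * normc z) ^+ k.
  apply: ler_pM; rewrite ?expR_ge0 ?exprn_ge0 ?addr_ge0//.
    by rewrite ler_expR (le_trans rz).
  by rewrite lerXn2r ?nnegrE ?addr_ge0// ?mulr_ge0// ?(le_trans _ rz)// mulr2n mulrDl !mul1r lerD.
move=> B b1 b2; apply: le_trans (norm_le _) _.
have -> : expR 1 * 2 ^+ k.+1 * normc z ^+ k =
   expR 1 * (2 * normc z) ^+ k + expR 1 * (2 * normc z) ^+ k.
  by rewrite exprMn exprS; ring.
by apply: lerD; apply: le_trans B.
Qed.

Local Notation fn := (R[i]^o -> R[i]^o).

(** The addition formula reduces this to [0], where the Taylor estimate of order
    [2] applies. *)
Lemma derivable_cexp z : derivable (cexp : fn) z 1.
Proof.
apply/cvg_ex; exists (cexp z : R[i]^o).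
pose q (h : R[i]^o) : R[i]^o := (cexp h - 1) / h.
have cq : q h @[h --> (0 : R[i]^o)^'] --> (1 : R[i]^o).
  apply: (@cvg_of_linear_bound _ q 1 (expR 1 * 2 ^+ 3)%:C 1) => //.
    by rewrite lecR mulr_ge0 ?expR_ge0// exprn_ge0.
  move=> h h0 h1; have := cexp_taylor 2 h1.
  rewrite 2!big_ord_recl big_ord0 /= expr0 expr1 !divr1 addr0.
  have -> : q h - 1 = (cexp h - (1 + h)) / h.
    by rewrite /q; field.
  by rewrite normrM normfV ler_pdivrMr ?normr_gt0// -mulrA -expr2.
have -> : (fun h : R[i]^o => h^-1 *: ((cexp : fn) (h *: 1 + z) - (cexp : fn) z)) =
    (fun h => (cexp z : R[i]^o) * q h).
  apply/funext => h; rewrite /q /GRing.scale /= mulr1 cexpD.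
  by move: (h^-1) => k; ring.
rewrite -[X in _ --> X]mulr1; apply: cvgMr; exact: cq.
Qed.

Definition cexp_quotient z : R[i] :=
  if z == 0 then 2^-1 else (cexp z - 1 - z) / z ^+ 2.

Lemma cexp_quotientE z : cexp z = 1 + z * (1 + z * cexp_quotient z).
Proof.
rewrite /cexp_quotient; case: eqVneq => [->|z0]; first by rewrite cexp0 !mul0r addr0.
by field.
Qed.

(** At [0] the Taylor estimate of order [4] gives the derivative [1 / 6]. *)
Lemma derivable_cexp_quotient z : derivable (cexp_quotient : fn) z 1.
Proof.
have [->|z0] := eqVneq z 0; last first.
  have aid : analytic 0 (id : fn) z.
    by apply/analytic0P; near=> s; exact: derivable_id.
  have aexp : analytic 0 (cexp : fn) z.
    by apply/analytic0P; near=> s; exact: derivable_cexp.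
  have aq : analytic 0 (fun s => (cexp s + (-1 + -1 * s)) * (s * s)^-1) z.
    have acst (c : R[i]^o) := analytic_cst 0 c z.
    have zz : (z : R[i]^o) * z != 0 by rewrite mulf_neq0.
    have asq := analyticV (analyticM aid aid) zz.
    exact: (analyticM (analyticD aexp (analyticD (acst (-1)) (analyticM (acst (-1)) aid))) asq).
  apply: (nbhs_singleton (_ : analytic 0 cexp_quotient z)).
  apply: analytic_near_eq aq; near=> s.
  have s0 : s != 0.
    by near: s; apply: (analytic_neq0 aid).
  by rewrite /cexp_quotient (negbTE s0) mulN1r addrA expr2.
apply/cvg_ex; exists (6^-1 : R[i]^o).
apply: (@cvg_of_linear_bound _ _ _ (expR 1 * 2 ^+ 5)%:C 1) => //.
  by rewrite lecR mulr_ge0 ?expR_ge0// exprn_ge0.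
move=> h h0 h1; have := cexp_taylor 4 h1.
rewrite 4!big_ord_recl big_ord0 /= /bump /= expr0 expr1 !divr1 addr0.
have -> : h^-1 *: ((cexp_quotient : fn) (h *: 1 + 0) - (cexp_quotient : fn) 0) - 6^-1 =
    (cexp h - (1 + (h + (h ^+ 2 / 2 + h ^+ 3 / 6)))) / h ^+ 3.
  rewrite /GRing.scale /= mulr1 addr0 /cexp_quotient eqxx (negbTE h0).
  by field.
by move=> B; rewrite normrM normfV normrX ler_pdivrMr ?exprn_gt0 ?normr_gt0// -mulrA -exprS.
Unshelve. all: by end_near. Qed.

Let derivable_linear_comp (f : fn) (w L s : R[i]) : (forall z, derivable f z 1) ->
  derivable ((fun s => f ((s - w) * L)) : fn) s 1.
Proof.
move=> df; apply/derivable1_diffP.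
apply: (@differentiable_comp _ _ _ _ (fun s : R[i]^o => (s - w) * L : R[i]^o) f);
  last exact/derivable1_diffP.
apply/derivable1_diffP.
have dw : derivable ((fun s => s - w) : fn) s 1.
  by apply: (@derivableB _ _ _ (id : fn) (cst w : fn)).
have dL : derivable (cst L : fn) s 1 by exact: derivable_cst.
have := derivableM dw dL.
by [].
Qed.

Lemma cpow_expansion x (w : R[i]) : exists2 u : fn, analytic 1 u w &
  u w = cpow x w * (ln x)%:C /\ forall s, cpow x s = cpow x w + (s - w) * u s.
Proof.
pose L := (ln x)%:C : R[i].
pose v (s : R[i]) := cexp_quotient ((s - w) * L).
exists (fun s => cpow x w * (L + (s - w) * (L ^+ 2 * v s))).
  apply/analyticSP; exists (cpow x w * L), (fun s => cpow x w * (L ^+ 2 * v s)).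
  split; last by near=> s; ring.
  apply: analyticM; first exact: analytic_cst.
  apply: analyticM; first exact: analytic_cst.
  apply/analytic0P; near=> s; apply: derivable_linear_comp.
  exact: derivable_cexp_quotient.
split; first by rewrite subrr mul0r addr0.
move=> s; rewrite -[in LHS](subrK w s) cpowE mulrDl cexpD -/L.
rewrite [cexp ((s - w) * L)]cexp_quotientE -/(v s) cpowE -/L.
by move: (v s) (cexp (w * L)) => a b; ring.
Unshelve. all: by end_near. Qed.

Lemma analytic_cpow x (w : R[i]) : analytic 2 (cpow x : fn) w.
Proof.
have [u au [_ uE]] := cpow_expansion x w; apply/analyticSP.
by exists (cpow x w), u; split=> //; near=> s; exact: uE.
Unshelve. all: by end_near. Qed.

End complex_exponential.

(** * Residues of the zeta functions *)

Section zeta_residues.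
Context {R : realType}.
Local Notation fn := (R[i]^o -> R[i]^o).

(** The residue is the constant term of the expansion of [N / u]. *)
Lemma residue_simple_pole (N P u : fn) (w : R[i]^o) :
  analytic 1 N w -> analytic 1 u w -> u w != 0 ->
  (forall s, P s = (s - w) * u s) ->
  residue_at (fun s => N s / P s) w (N w / u w).
Proof.
move=> aN au uw PE.
have aV := analyticV au uw.
have /analyticSP[c [v [av qE]]] := analyticM aN aV.
have cE : c = N w / u w by rewrite (nbhs_singleton qE) subrr mul0r addr0.
exists 0%N, (fun=> N w / u w), v; split=> //.
near=> s.
have sw : s - w != 0 by rewrite subr_eq0; near: s; exact: (@nbhs_dnbhs_neq R[i]^o w).
have qs : N s * (u s)^-1 = c + (s - w) * v s.
  by near: s; exact: nbhs_dnbhs.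
rewrite big_ord_recl big_ord0 addr0 /= expr1 PE invfM mulrCA mulrC qs -cE.
by rewrite mulrDl [(s - w) * _]mulrC mulfK.
Unshelve. all: by end_near. Qed.

Variables (J : nat) (r : 'I_J -> R) (D : R).
Hypothesis r01 : forall j, 0 < r j < 1.
Hypothesis moran : \sum_(j < J) r j `^ D = 1.

Let mu := \sum_(j < J) r j `^ D * - ln (r j).
Hypothesis mu_gt0 : 0 < mu.

(** The denominator vanishes at [D] by Moran's equation, and the derivative of
    [cpow (r j)] is [cpow (r j)] times [ln (r j)]. *)
Let zeta_denominator : exists2 u : fn, analytic 1 u D%:C & u D%:C = mu%:C /\
  forall s, 1 - \sum_(j < J) cpow (r j) s = (s - D%:C) * u s.
Proof.
have /choice[u uP] j : exists u : fn, [/\ analytic 1 u D%:C,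
    u D%:C = cpow (r j) D%:C * (ln (r j))%:C
  & forall s, cpow (r j) s = cpow (r j) D%:C + (s - D%:C) * u s].
  by have [u au [uD uE]] := cpow_expansion (r j) D%:C; exists u.
have rD j : cpow (r j) D%:C = (r j `^ D)%:C.
  by rewrite cpow_real//; have /andP[] := r01 j.
exists (fun s => -1 * \sum_(j < J) u j s).
  apply: analyticM; first exact: analytic_cst.
  by apply: analytic_sum => j; have [] := uP j.
split.
  rewrite mulN1r /mu rmorph_sum -sumrN; apply: eq_bigr => j _.
  by have [_ -> _] := uP j; rewrite rD -mulrN -!rmorphN -rmorphM.
move=> s; have -> : \sum_(j < J) cpow (r j) s =
    1 + (s - D%:C) * \sum_(j < J) u j s.
  rewrite -[1 in RHS](rmorph1 (real_complex R)) -moran rmorph_sum mulr_sumr -big_split.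
  by apply: eq_bigr => j _ /=; have [_ _ ->] := uP j; rewrite rD.
by rewrite opprD addNKr mulN1r mulrN.
Qed.

Let muC_neq0 : mu%:C != 0 :> R[i].
Proof. by rewrite -[0](rmorph0 (real_complex R)) (inj_eq (@complexI R)) gt_eqF. Qed.

Lemma residue_zeta : residue_at (zeta r) D%:C (mu^-1)%:C.
Proof.
have [u au [uD uE]] := zeta_denominator.
have := @residue_simple_pole (fun=> 1) (fun s => 1 - \sum_(j < J) cpow (r j) s)
  u D%:C (analytic_cst _ _ _) au _ uE.
by rewrite uD div1r fmorphV; apply.
Qed.

(** The powers of [e] cancel, and the finite sum is analytic at [D]. *)
Lemma residue_zeta_tiling d g (kappa : nat -> R) (e : R) : 0 < g ->
  (forall m : 'I_d.+1, D - m%:R != 0) ->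
  residue_at (fun s => zeta_tiling d r g kappa s e * cpow e (s - d%:R)) D%:C
    (mu^-1 * \sum_(m < d.+1) g `^ (D - m%:R) / (D - m%:R) * kappa m)%:C.
Proof.
move=> g0 Dm; have [u au [uD uE]] := zeta_denominator.
pose N (s : R[i]^o) : R[i]^o :=
  \sum_(m < d.+1) cpow g (s - m%:R) / (s - m%:R) * (kappa m)%:C.
have natC m : m%:R = (m%:R : R)%:C :> R[i] by rewrite rmorph_nat.
have aN : analytic 1 N D%:C.
  apply: analytic_sum => m; apply: analyticM; last exact: analytic_cst.
  have acst (c : R[i]^o) := analytic_cst 1 c D%:C.
  apply: analyticM.
    have := analyticM (analyticW (analytic_cpow g D%:C)) (acst (cpow g (- m%:R))).
    apply: analytic_near_eq; near=> s.
    by rewrite !cpowE -cexpD -mulrDl.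
  have Dm0 : D%:C - m%:R != 0 :> R[i].
    by rewrite natC -rmorphB -[0](rmorph0 (real_complex R)) (inj_eq (@complexI R)).
  apply: analyticV => //.
  have := analyticD (analytic_shift 1 D%:C) (acst (D%:C - m%:R)).
  by apply: analytic_near_eq; near=> s; rewrite addrA subrK.
have ND : N D%:C = (\sum_(m < d.+1) g `^ (D - m%:R) / (D - m%:R) * kappa m)%:C.
  rewrite rmorph_sum; apply: eq_bigr => m _.
  by rewrite natC -rmorphB cpow_real// !rmorphM fmorphV.
have := @residue_simple_pole N (fun s => 1 - \sum_(j < J) cpow (r j) s)
  u D%:C aN au _ uE.
rewrite uD ND => /(_ muC_neq0).
rewrite rmorphM fmorphV [_^-1 * _]mulrC.
congr residue_at; apply/funext => s.
rewrite /zeta_tiling /zeta -/(N s) -[s - d%:R]opprB div1r.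
by rewrite [RHS]mulrAC -[X in _ = X * _]mulrA cpowN mulr1 mulrC.
Unshelve. all: by end_near. Qed.

End zeta_residues.

(** * Minkowski content of the fractal *)

Lemma fractal_tube_recursion (R : realType) (n J : nat)
    (phi : 'I_J -> 'rV[R]_n.+1 -> 'rV[R]_n.+1) (r : 'I_J -> R)
    (F : set 'rV[R]_n.+1) (kappa : nat -> R) :
  let C := convex_hull F in
  let G := C `\` hutchinson phi C in
  (0 < J)%N -> (forall j, 0 < r j < 1) -> (forall j, similitude (phi j) (r j)) ->
  F !=set0 -> compact F -> F = hutchinson phi F ->
  tileset_condition phi C -> nontriviality_condition phi C ->
  pearse_winter_condition C F -> diphase_steiner_like G kappa ->
  tube_recursion n.+1 r kappa (inradius G) (volume C°) (volume G)
    (inner_tube F) (fun e => volume (inner_neighborhood G e)).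
Proof.
move=> C G J0 r01 simi F0 cF FE TSC NTC PWC [_ oG Gsmall Glarge _].
split=> //.
- exact: (inradius_gt0 cF NTC oG).
- exact: (hull_volume_gt0 cF NTC).
- exact: (generator_volume_gt0 cF NTC oG).
- exact: (inner_tube_nondecreasing cF).
- by move=> e; exact: volume_ge0.
- exact: (inner_tube_le cF).
- exact: (inner_tube_rec r01 simi F0 cF FE TSC NTC PWC oG).
- exact: (hull_volumeE r01 simi cF FE TSC NTC PWC oG).
- by move=> e; exact: volume_ge0.
- exact: (sum_ratio_lt1 r01 simi cF TSC NTC oG).
Qed.

(** In dimension [0] the only point is covered by every tile that is not empty. *)
Lemma nontrivial_dimension (R : realType) (J : nat)
    (phi : 'I_J -> 'rV[R]_0 -> 'rV[R]_0) (C : set 'rV[R]_0) :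
  (0 < J)%N -> ~ nontriviality_condition phi C.
Proof.
move=> J0; apply=> x /interior_subset Cx.
by exists (Ordinal J0) => //; exists x => //; apply/rowP => -[].
Qed.

Lemma moran_entropy_gt0 (R : realType) (J : nat) (r : 'I_J -> R) (D : R) :
  (0 < J)%N -> (forall j, 0 < r j < 1) -> 0 < \sum_(j < J) r j `^ D * - ln (r j).
Proof.
case: J r => // J r _ r01.
have pos j : 0 < r j `^ D * - ln (r j).
  have /andP[r0 r1] := r01 j.
  by rewrite mulr_gt0 ?powR_gt0// oppr_gt0 ln_lt0// r0.
rewrite big_ord_recl ltr_wpDr ?pos//; apply: sumr_ge0 => j _; exact: ltW.
Qed.

Theorem theorem2 (R : realType) (d J : nat)
    (phi : 'I_J -> 'rV[R]_d -> 'rV[R]_d) (r : 'I_J -> R)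
    (F : set 'rV[R]_d) (D : R) (kappa : nat -> R) :
  let C := convex_hull F in
  let G := C `\` hutchinson phi C in
  let g := inradius G in
  let S := \sum_(m < d.+1) g `^ (D - m%:R) / (D - m%:R) * kappa m in
  (2 <= J)%N ->
  (forall j, 0 < r j < 1) ->
  (forall j, similitude (phi j) (r j)) ->
  F !=set0 -> compact F -> F = hutchinson phi F ->
  has_dim C d ->
  tileset_condition phi C ->
  nontriviality_condition phi C ->
  pearse_winter_condition C F ->
  connected G ->
  diphase_steiner_like G kappa ->
  minkowski_dimension F D ->
  d%:R - 1 < D ->
  (~ lattice_type r ->
    [/\ minkowski_measurable F D,
        forall e : R, 0 < e ->
          residue_at (fun s => zeta_tiling d r g kappa s e * cpow e (s - d%:R))
            D%:C (minkowski_content F D)%:C,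
        exists2 rho : R[i], residue_at (zeta r) D%:C rho
          & (minkowski_content F D)%:C = rho * S%:C
      & minkowski_content F D
          = S / \sum_(j < J) (r j `^ D * ln (r j)^-1)]) /\
  (lattice_type r ->
    [/\ ~ minkowski_measurable F D,
        cvg (log_average F D T @[T --> +oo])
      & forall e : R, 0 < e ->
          residue_at (fun s => zeta_tiling d r g kappa s e * cpow e (s - d%:R))
            D%:C (average_minkowski_content F D)%:C]).
Proof.
case: d phi F => [|n] phi F C G g S J2 r01 simi F0 cF FE _ TSC NTC PWC _ dG dimF dD.
  by case: (nontrivial_dimension (ltnW J2) NTC).
have J0 := ltnW J2.
have H := fractal_tube_recursion J0 r01 simi F0 cF FE TSC NTC PWC dG.
rewrite -/C -/G -/g in H.
have [bG oG _ _ kd] := dG.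
have [K K0 VW] := tube_le r01 simi F0 cF FE TSC NTC PWC oG.
have moran := moran_equation H K0 VW dimF dD.
have Dd := dimension_lt H K0 VW dimF dD.
have V_nd := tube_nondecreasing F0 cF.
pose mu := \sum_(j < J) r j `^ D * - ln (r j).
have mu0 : 0 < mu := moran_entropy_gt0 D J0 r01.
have S0 : 0 < S := renewal_constant_gt0 H kd dD Dd.
have g0 : 0 < g := rec_inradius H.
have Dm (m : 'I_n.+2) : D - m%:R != 0.
  have := ltn_ord m; rewrite ltnS leq_eqVlt => /predU1P[->|mn].
    by rewrite lt_eqF// subr_lt0.
  have : (m%:R : R) <= n.+1%:R - 1 by rewrite -natr1 addrK ler_nat.
  by move=> mD; rewrite gt_eqF// subr_gt0; lra.
have res e : residue_at (fun s => zeta_tiling n.+1 r g kappa s e *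
    cpow e (s - n.+1%:R)) D%:C (S / mu)%:C.
  by rewrite mulrC; exact: (residue_zeta_tiling r01 moran mu0).
split=> lat.
  have content := nonlattice_measurable H kd moran dD Dd VW lat.
  have contentE : minkowski_content F D = S / mu by exact/cvg_lim.
  rewrite contentE; split=> //.
  - split; first by apply/cvg_ex; exists (S / mu).
    by rewrite contentE gt_eqF// divr_gt0.
  - exists (mu^-1)%:C; first exact: (residue_zeta r01 moran mu0).
    by rewrite -rmorphM mulrC.
  - congr (_ / _); apply: eq_bigr => j _; rewrite lnV ?posrE//.
    by have /andP[] := r01 j.
have average : log_average F D T @[T --> +oo] --> S / mu.
  exact: (tube_log_average H kd moran dD Dd K0 V_nd VW).
split=> //.
- move=> [/cvg_ex[l Vl] _].
  have [h [m [h0 m0 rE]]] := lattice_span J0 r01 lat.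
  apply: (lattice_tube_not_cvg H moran dD Dd h0 m0 rE (l := l)).
  have := cvgB Vl (tube_defect_cvg dD VW); rewrite subr0.
  set f := (X in X @ _ --> _) => fl.
  suff -> : (fun e => inner_tube F e * e `^ (D - n.+1%:R)) = f by exact: fl.
  by apply/funext => e; rewrite /f /= subKr.
- by apply/cvg_ex; exists (S / mu).
- by move=> e _; have -> : average_minkowski_content F D = S / mu by exact/cvg_lim.
Qed.
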